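(* Let $\mathcal W$ be a real-valued even tempered distribution on $\mathbb R$ with $\widehat{\mathcal W}\in L^\infty(\mathbb R)$. Let $c\ge0$ and let $u\in\mathcal E(\mathbb R)$ be a solution to $$icu'+u''+u\,\bigl(\mathcal W*(1-|u|^2)\bigr)=0\quad\text{in }\mathbb R.$$ Assume that $M_c(\xi)=\xi^2+2\widehat{\mathcal W}(\xi)-c^2>0$ for a.e. $\xi\in\mathbb R$ and that $L_c=1/M_c\in\mathcal S'(\mathbb R)$, and let $\mathcal L_c\in\mathcal S'(\mathbb R)$ be defined by $\widehat{\mathcal L_c}=L_c$. Assume moreover that $$(1+|\cdot|)^s\mathcal L_c\in L^p(\mathbb R)\quad\text{for some }p\in(1,\infty],\ s>1-\tfrac1p.$$ Let $q$ be the conjugate exponent of $p$ and $\eta=1-|u|^2$. Then $$|\cdot|^\ell D^k\eta\in L^q(\mathbb R)\cap L^\infty(\mathbb R),\qquad\lim_{x\to\pm\infty}|x|^\ell D^k\eta(x)=0,\qquad\text{for all }\ell\in\Bigl(0,s-1+\frac1p\Bigr),\ k\in\mathbb N.$$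
   Context: Fourier transform convention: $\widehat f(\xi)=\int_{\mathbb R}e^{-ix\xi}f(x)\,dx$; $\mathcal S'(\mathbb R)$ is the space of tempered distributions. For $f\in L^2(\mathbb R)$, $\mathcal W*f\in L^2(\mathbb R)$ is defined by $\widehat{\mathcal W*f}=\widehat{\mathcal W}\,\widehat f$. The energy space is $\mathcal E(\mathbb R)=\{v\in H^1_{\rm loc}(\mathbb R;\mathbb C): 1-|v|^2\in L^2(\mathbb R),\ v'\in L^2(\mathbb R)\}$. The equation is understood in the sense of distributions; every solution in $\mathcal E(\mathbb R)$ is in fact of class $C^\infty$. Conventions: $1/p=0$ if $p=\infty$, $1/p+1/q=1$, and $\mathbb N$ includes $0$. *)

(* Defs.v *)
From HB Require Import structures.
From mathcomp Require Import all_boot all_order all_algebra.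
From mathcomp Require Import all_classical all_reals all_analysis.
From mathcomp Require Import complex.

Set Implicit Arguments.
Unset Strict Implicit.
Unset Printing Implicit Defensive.

Import Order.TTheory GRing.Theory Num.Theory.
Import numFieldNormedType.Exports.

Local Open Scope classical_set_scope.
Local Open Scope ring_scope.
Local Open Scope complex_scope.

Section complex_functions.
Context {R : realType}.
Implicit Types (f g phi : R -> R[i]) (p : \bar R).

Local Notation mu := (@lebesgue_measure R).

(* The modulus as an element of R; the norm `|z| of R[i] lives in R[i]. *)
Definition cmod (z : R[i]) : R := complex.Re `|z|.

Definition re_fun f : R -> R := fun x => complex.Re (f x).
Definition im_fun f : R -> R := fun x => complex.Im (f x).

Definition cmeasurable f :=
  measurable_fun [set: R] (re_fun f) /\ measurable_fun [set: R] (im_fun f).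

Definition cLfun p f :=
  cmeasurable f /\ (fun x => cmod (f x)) \in Lfun mu p.

Definition cL1loc f :=
  locally_integrable [set: R] (re_fun f) /\
  locally_integrable [set: R] (im_fun f).

Definition cL2loc f :=
  cmeasurable f /\ locally_integrable [set: R] (fun x => cmod (f x) ^+ 2).

(* Meaningful when the real and imaginary parts of f are both integrable. *)
Definition cintegral f : R[i] :=
  (\int[mu]_x re_fun f x)%R +i* (\int[mu]_x im_fun f x)%R.

Definition smooth (h : R -> R) := forall n (x : R), derivable h^`(n)%classic x 1.

Definition csmooth f := smooth (re_fun f) /\ smooth (im_fun f).

Definition cderiven n f : R -> R[i] :=
  fun x => (re_fun f)^`(n)%classic x +i* (im_fun f)^`(n)%classic x.

(* C_c^oo *)
Definition test_function phi :=
  csmooth phi /\ compact (closure [set x | phi x != 0]).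

Definition schwartz_values (j k : nat) phi : set R :=
  range (fun x => `|x| ^+ j * cmod (cderiven k phi x)).

Definition schwartz phi :=
  csmooth phi /\ forall j k, has_ubound (schwartz_values j k phi).

Definition schwartz_seminorm (j k : nat) phi : R :=
  sup (schwartz_values j k phi).

Definition fourier phi : R -> R[i] := fun xi =>
  cintegral (fun x => (cos (x * xi) -i* sin (x * xi)) * phi x).

End complex_functions.

Section distributions.
Context {R : realType}.
Implicit Types (f g phi psi u v w m : R -> R[i]).
Implicit Types (T : (R -> R[i]) -> R[i]).

(* A tempered distribution is a functional T of which only the values on
   Schwartz functions matter: elsewhere T is arbitrary, and no property of T
   below refers to those values.  The pairing is bilinear, without complex
   conjugation.  Continuity is with respect to the topology of the Schwartz
   space, generated by the seminorms sup_x |x|^j |D^k phi(x)|. *)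
Definition tempered T :=
  (forall (a : R[i]) phi psi, schwartz phi -> schwartz psi ->
     T (fun x => a * phi x + psi x) = a * T phi + T psi) /\
  (exists (N : nat) (K : R), forall phi, schwartz phi ->
     cmod (T phi) <=
       K * \sum_(j < N.+1) \sum_(k < N.+1) schwartz_seminorm j k phi).

Definition real_distribution T :=
  forall phi, schwartz phi -> (forall x, complex.Im (phi x) = 0) ->
    complex.Im (T phi) = 0.

Definition even_distribution T :=
  forall phi, schwartz phi -> T (fun x => phi (- x)) = T phi.

Definition fourier_distribution T : (R -> R[i]) -> R[i] :=
  fun phi => T (fourier phi).

Definition distribution_of f : (R -> R[i]) -> R[i] :=
  fun phi => cintegral (fun x => f x * phi x).

(* The distribution T is the locally integrable function f.  As C_c^oo is
   dense in the Schwartz space, this determines a tempered T from f; testing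
   on C_c^oo only does not require f * phi to be integrable for every
   Schwartz function phi. *)
Definition represents T f :=
  cL1loc f /\ forall phi, test_function phi -> T phi = distribution_of f phi.

Definition tempered_function f := exists T, tempered T /\ represents T f.

(* g is the L^2 function whose Fourier transform is m times that of f, where
   the Fourier transforms of L^2 functions are those of tempered
   distributions.  For m the Fourier transform of W, this says g = W * f. *)
Definition fourier_multiplier m f g :=
  [/\ cLfun 2%:E f, cLfun 2%:E g &
    exists F, [/\ cLfun 2%:E F,
      represents (fourier_distribution (distribution_of f)) F &
      represents (fourier_distribution (distribution_of g))
        (fun xi => m xi * F xi)]].

Definition weak_derivative v w :=
  [/\ cL1loc v, cL1loc w & forall phi, test_function phi ->
    distribution_of v (cderiven 1 phi) = - distribution_of w phi].

Definition H1loc v :=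
  cL2loc v /\ exists2 w, weak_derivative v w & cL2loc w.

Definition eta_fun v : R -> R := fun x => 1 - cmod (v x) ^+ 2.

Definition energy_space v :=
  [/\ H1loc v, cLfun 2%:E (fun x => (eta_fun v x)%:C) &
    exists2 w, weak_derivative v w & cLfun 2%:E w].

(* i c u' + u'' + u (W * (1 - |u|^2)) = 0 in the sense of distributions, with
   m the Fourier transform of W *)
Definition solution (c : R) m u :=
  exists g, fourier_multiplier m (fun x => (eta_fun u x)%:C) g /\
    forall phi, test_function phi ->
      (0 +i* c) * (- distribution_of u (cderiven 1 phi))
      + distribution_of u (cderiven 2 phi)
      + distribution_of (fun x => u x * g x) phi = 0.

Definition Mc (c : R) m : R -> R[i] :=
  fun xi => (xi%:C) ^+ 2 + 2 * m xi - (c%:C) ^+ 2.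

End distributions.

(* Main.v *)
Require Import Defs.
From HB Require Import structures.
From mathcomp Require Import all_boot all_order all_algebra.
From mathcomp Require Import all_classical all_reals all_analysis.
From mathcomp Require Import measurable_realfun ess_sup_inf complex.
From mathcomp Require Import ring lra.

(* Write u = a + i b, eta = 1 - |u|^2 and g = W * eta.  The momentum
   a b' - b a' - c eta / 2 is constant and square integrable, hence zero, so
   that eta'' = 2 g - c^2 eta - F with F = 2 |u'|^2 + 2 eta g.  In Fourier
   variables this reads M_c eta^ = F^, i.e. eta = L_c * F.  As 1 / M_c is
   O(1 / (1 + xi^2)), this identity and the Bessel inequality bootstrap to
   smoothness, with all derivatives of eta and g square integrable and
   vanishing at infinity.  Since F' = 4 eta' g + 2 eta g', near infinity every
   derivative of F up to the order k >= 1 is at most a small multiple of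
   Phi = sum_(i <= k) |eta^(i)|, F itself being controlled there through
   |u'|^2 = (eta'^2 + c^2 eta^2) / (4 |u|^2).  By Hoelder's inequality
   (1 + |x|)^l L_c is integrable for l < s - 1 + 1/p.  Convolving with L_c
   against a truncation of the weight (1 + |x|)^l then bounds the weighted
   L^1 norm of Phi by half of itself plus a constant, uniformly in the
   truncation.  Pointwise decay follows from
   |f(x)| <= int_x^(x+1) (|f| + |f'|). *)

Set Implicit Arguments.
Unset Strict Implicit.
Unset Printing Implicit Defensive.

Import Order.TTheory GRing.Theory Num.Theory.
Import numFieldNormedType.Exports.

Local Open Scope classical_set_scope.
Local Open Scope ring_scope.

(** * Integration on the real line *)

Section integrable_functions.
Context {R : realType}.
Local Notation mu := (@lebesgue_measure R).
Implicit Types f g h : R -> R.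

(** The symbol of [W] is merely bounded, so [g] inherits no decay from eta: its derivatives are only
    known to tend to 0. The absorption works because each term of F^(i), once |u'|^2 is eliminated,
    is a product of some eta^(j) and of a factor tending to 0. No order of derivation is lost: F^(i)
    involves eta up to order i when i >= 1, and up to order 1 when i = 0. All orders up to some k >=
    1 can therefore be estimated together.

    The analysis is carried out on real functions. Complex functions are handled through real and
    imaginary parts, and Fourier transforms through cosine and sine transforms. The parity of the
    symbol then forces [g] to be real and the cosine transform of the kernel to be 1 / M_c.

    Distributions are identified with functions by testing on compactly supported functions, whereas
    the transforms of these have full support. Cut-offs bridge this gap, both when a transform is
    inverted and when a tempered distribution is applied to a transform. *)

Definition L1 f := mu.-integrable [set: R] (EFin \o f).

Lemma ae_imp (P Q : R -> Prop) : (forall x, P x -> Q x) ->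
  {ae mu, forall x, P x} -> {ae mu, forall x, Q x}.
Proof.
by move=> PQ; apply: (@filterS _ _ (ae_filter_ringOfSetsType mu)).
Qed.

Lemma ae_and (P Q : R -> Prop) : {ae mu, forall x, P x} ->
  {ae mu, forall x, Q x} -> {ae mu, forall x, P x /\ Q x}.
Proof.
by move=> p q; apply: (@filterI _ _ (ae_filter_ringOfSetsType mu)).
Qed.

Lemma L1_measurable f : L1 f -> measurable_fun [set: R] f.
Proof. by move=> /integrableP[/measurable_EFinP]. Qed.

Lemma L1_EFin_measurable f : L1 f -> measurable_fun [set: R] (EFin \o f).
Proof. by move=> /integrableP[]. Qed.

Lemma L1_lty f : L1 f -> (\int[mu]_x `|f x|%:E < +oo)%E.
Proof. by move=> /integrableP[]. Qed.

Lemma L1_leP f g : measurable_fun [set: R] f -> L1 g ->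
  (forall x, `|f x| <= g x) -> L1 f.
Proof.
move=> mf ig fg; apply: (le_integrable measurableT _ _ ig).
  exact/measurable_EFinP.
by move=> x _ /=; rewrite lee_fin (le_trans (fg x))// ler_norm.
Qed.

Lemma L1P f : measurable_fun [set: R] f ->
  (\int[mu]_x `|f x|%:E < +oo)%E -> L1 f.
Proof. by move=> mf h; apply/integrableP; split => //; exact/measurable_EFinP. Qed.

Lemma L1D f g : L1 f -> L1 g -> L1 (fun x => f x + g x).
Proof. by move=> f1 g1; exact: (integrableD measurableT f1 g1). Qed.

Lemma L1N f : L1 f -> L1 (fun x => - f x).
Proof. exact: integrableN. Qed.

Lemma L1B f g : L1 f -> L1 g -> L1 (fun x => f x - g x).
Proof. by move=> f1 g1; apply: L1D => //; exact: L1N. Qed.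

Lemma L1Z (k : R) f : L1 f -> L1 (fun x => k * f x).
Proof. by move=> f1; exact: (integrableZl measurableT k f1). Qed.

Lemma L1Zr (k : R) f : L1 f -> L1 (fun x => f x * k).
Proof. by move=> f1; under eq_fun do rewrite mulrC; exact: L1Z. Qed.

Lemma L1_norm f : L1 f -> L1 (fun x => `|f x|).
Proof. exact: integrable_norm. Qed.

Lemma L1_sum (I : Type) (r : seq I) (P : pred I) (F : I -> R -> R) :
  (forall i, P i -> L1 (F i)) -> L1 (fun x => \sum_(i <- r | P i) F i x).
Proof.
move=> h; elim: r => [|i r IH].
  under eq_fun do rewrite big_nil.
  exact: (@integrable0 _ _ R mu setT).
under eq_fun do rewrite big_cons.
by case: (boolP (P i)) => // Pi; apply: L1D => //; exact: h.
Qed.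

Lemma L1_bddM (k : R -> R) f (M : R) : measurable_fun [set: R] k -> L1 f ->
  (forall x, `|k x| <= M) -> L1 (fun x => k x * f x).
Proof.
move=> mk f1 kM; apply: (@L1_leP _ (fun x => M * `|f x|)).
- by apply: measurable_funM => //; exact: L1_measurable.
- exact/L1Z/L1_norm.
- by move=> x; rewrite normrM ler_wpM2r.
Qed.

Lemma L1_bddMr (k : R -> R) f (M : R) : measurable_fun [set: R] k -> L1 f ->
  (forall x, `|k x| <= M) -> L1 (fun x => f x * k x).
Proof.
by move=> mk f1 kM; under eq_fun do rewrite mulrC; exact: (@L1_bddM _ _ M).
Qed.

Lemma int_eq f g : (forall x, f x = g x) -> \int[mu]_x f x = \int[mu]_x g x.
Proof. by move=> fg; apply: eq_Rintegral => x _; exact: fg. Qed.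

Lemma int_le f g : L1 f -> L1 g -> (forall x, f x <= g x) ->
  \int[mu]_x f x <= \int[mu]_x g x.
Proof. by move=> f1 g1 fg; apply: le_Rintegral => // x _. Qed.

Lemma int_ge0 f : (forall x, 0 <= f x) -> 0 <= \int[mu]_x f x.
Proof. by move=> f0; apply: Rintegral_ge0 => x _. Qed.

Lemma int_norm f : L1 f -> `|\int[mu]_x f x| <= \int[mu]_x `|f x|.
Proof. by move=> f1; exact: le_normr_Rintegral. Qed.

Lemma intD f g : L1 f -> L1 g ->
  \int[mu]_x (f x + g x) = \int[mu]_x f x + \int[mu]_x g x.
Proof. by move=> f1 g1; exact: RintegralD. Qed.

Lemma intB f g : L1 f -> L1 g ->
  \int[mu]_x (f x - g x) = \int[mu]_x f x - \int[mu]_x g x.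
Proof. by move=> f1 g1; exact: RintegralB. Qed.

Lemma intZ (k : R) f : L1 f -> \int[mu]_x (k * f x) = k * \int[mu]_x f x.
Proof. by move=> f1; exact: RintegralZl. Qed.

Lemma intN f : L1 f -> \int[mu]_x (- f x) = - \int[mu]_x f x.
Proof.
move=> f1; rewrite -mulN1r -intZ//.
by apply: eq_Rintegral => x _; rewrite mulN1r.
Qed.

Lemma int0 : \int[mu]_x (0 : R) = 0.
Proof. by rewrite Rintegral_cst// mul0r. Qed.

Lemma L1_EFin f : L1 f -> (\int[mu]_x (f x)%:E)%E = (\int[mu]_x f x)%:E.
Proof.
by move=> f1; rewrite /Rintegral fineK//; exact: integrable_fin_num.
Qed.

Lemma eq_ae_L1 f g : measurable_fun [set: R] g -> L1 f ->
  {ae mu, forall x, f x = g x} -> L1 g.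
Proof.
move=> mg f1 fg; apply: L1P => //.
suff <- : (\int[mu]_x `|f x|%:E = \int[mu]_x `|g x|%:E)%E by exact: L1_lty.
apply: ae_eq_integral => //.
- by apply/measurable_EFinP; apply: measurableT_comp => //; exact: L1_measurable.
- by apply/measurable_EFinP; apply: measurableT_comp.
- by apply: ae_imp fg => x /= -> _.
Qed.

Lemma eq_ae_int f g : measurable_fun [set: R] f -> measurable_fun [set: R] g ->
  {ae mu, forall x, f x = g x} -> \int[mu]_x f x = \int[mu]_x g x.
Proof.
move=> mf mg fg; congr fine; apply: ae_eq_integral => //.
- exact/measurable_EFinP.
- exact/measurable_EFinP.
- by apply: ae_imp fg => x /= -> _.
Qed.

Lemma dct (f_ : nat -> R -> R) f g : (forall n, measurable_fun [set: R] (f_ n)) ->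
  measurable_fun [set: R] f -> L1 g ->
  (forall n x, `|f_ n x| <= g x) -> (forall x, f_ n x @[n --> \oo] --> f x) ->
  L1 f /\ \int[mu]_x f_ n x @[n --> \oo] --> \int[mu]_x f x.
Proof.
move=> mf_ mf g1 fg ff.
have [] := @dominated_convergence _ (measurableTypeR R) R mu _ measurableT
  (fun n => EFin \o f_ n) (EFin \o f) (EFin \o g).
- by move=> n; apply/measurable_EFinP; exact: mf_.
- exact/measurable_EFinP.
- apply: aeW => x _; apply: cvg_EFin; first exact: nearW.
  exact: ff.
- exact: g1.
- by apply: aeW => x n _; rewrite /= lee_fin.
move=> f1 _ /= h; split => //.
by apply: fine_cvg; rewrite -L1_EFin.
Qed.

(** Monotone convergence as a source of integrability. Both the Bessel inequality and the removal of
    the truncated weights end this way. *)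
Lemma int_mono (f_ : nat -> R -> R) f (B : R) :
  (forall n, L1 (f_ n)) -> measurable_fun [set: R] f ->
  (forall n x, 0 <= f_ n x) -> (forall x, nondecreasing_seq (f_ ^~ x)) ->
  (forall x, f_ n x @[n --> \oo] --> f x) ->
  (forall n, \int[mu]_x f_ n x <= B) -> L1 f.
Proof.
move=> f_1 mf f0 nd ff fB; apply: L1P => //.
have f0' x : 0 <= f x.
  have := ff x => ffx; rewrite -(cvg_lim _ ffx)//.
  by apply: limr_ge; [apply/cvg_ex; exists (f x) | exact: nearW].
have -> : (\int[mu]_x `|f x|%:E = limn (fun n => \int[mu]_x (f_ n x)%:E))%E.
  rewrite -monotone_convergence//.
  - apply: eq_integral => x _; rewrite ger0_norm//; apply/esym/cvg_lim => //.
    by apply: cvg_EFin; [exact: nearW | exact: ff].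
  - by move=> n; exact: L1_EFin_measurable.
  - by move=> n x _; rewrite lee_fin.
  - by move=> x _ m n mn; rewrite lee_fin nd.
apply: (@le_lt_trans _ _ B%:E); last exact: ltry.
apply: lime_le.
  apply: ereal_nondecreasing_is_cvgn => m n mn; apply: ge0_le_integral => //.
  - by move=> x _; rewrite lee_fin.
  - exact: L1_EFin_measurable.
  - exact: L1_EFin_measurable.
  - by move=> x _; rewrite lee_fin nd.
by apply: nearW => n; rewrite L1_EFin// lee_fin.
Qed.

End integrable_functions.

(** * Interchange of integrals *)

Section fubini.
Context {R : realType}.
Local Notation mu := (@lebesgue_measure R).
Implicit Types f g h : R -> R.

Lemma measurable_fst_comp f : measurable_fun [set: R] f ->
  measurable_fun [set: R * R] (fun z => f z.1).
Proof. by move=> mf; exact: measurableT_comp. Qed.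

Lemma measurable_snd_comp f : measurable_fun [set: R] f ->
  measurable_fun [set: R * R] (fun z => f z.2).
Proof. by move=> mf; exact: measurableT_comp. Qed.

Lemma measurable_of_continuous f : continuous f -> measurable_fun [set: R] f.
Proof. exact: continuous_measurable_fun. Qed.

(** Boundedness of the kernel makes the double integral absolutely convergent. The kernels used are
    cosines, sines and the indicator of a half-plane. *)
Lemma fubini_kernel f g (k : R * R -> R) (M : R) : L1 f -> L1 g ->
  measurable_fun [set: R * R] k -> (forall z, `|k z| <= M) ->
  \int[mu]_x (f x * \int[mu]_y (g y * k (x, y))) =
  \int[mu]_y (g y * \int[mu]_x (f x * k (x, y))).
Proof.
move=> f1 g1 mk kM.
have M0 : 0 <= M by exact: le_trans (normr_ge0 _) (kM (0, 0)).
pose h (z : R * R) : \bar R := (f z.1 * (g z.2 * k z))%:E.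
have mh0 : measurable_fun [set: R * R] (fun z => f z.1 * (g z.2 * k z)).
  apply: measurable_funM.
    by apply: (measurable_fst_comp (f := f)); exact: L1_measurable.
  apply: measurable_funM => //.
  by apply: (measurable_snd_comp (f := g)); exact: L1_measurable.
have mh : measurable_fun [set: R * R] h by exact/measurable_EFinP.
have gk x : L1 (fun y => g y * k (x, y)).
  apply: (@L1_bddMr _ _ _ M) => // ; first exact: measurable_fun_pair2.
have fk y : L1 (fun x => f x * k (x, y)).
  apply: (@L1_bddMr _ _ _ M) => // ; first exact: measurable_fun_pair1.
have ih : (mu \x mu)%E.-integrable [set: R * R] h.
  apply/(integrable12ltyP mu mu mh).
  apply: (@le_lt_trans _ _ (\int[mu]_x (`|f x| * (M * \int[mu]_y `|g y|))%:E)%E).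
    apply: ge0_le_integral => //.
    - by move=> x _; apply: integral_ge0.
    - apply: (@measurable_fun_fubini_tonelli_F _ _ (measurableTypeR R)
        (measurableTypeR R) R mu (abse \o h)) => //.
        exact: measurableT_comp.
      by move=> z; exact: abse_ge0.
    - by apply: L1_EFin_measurable; apply: L1Zr; exact: L1_norm.
    move=> x _.
    rewrite /h /=; under eq_integral do rewrite normrM.
    rewrite L1_EFin; last by apply: L1Z; exact: L1_norm.
    rewrite lee_fin intZ; last exact: L1_norm.
    rewrite ler_wpM2l// -intZ; last exact: L1_norm.
    apply: int_le; [exact: L1_norm|by apply: L1Z; exact: L1_norm|].
    by move=> y; rewrite normrM mulrC ler_wpM2r.
  by rewrite L1_EFin ?ltry//; apply: L1Zr; exact: L1_norm.
have := Fubini ih; rewrite /h /= => E.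
congr fine.
transitivity (\int[mu]_x \int[mu]_y (f x * (g y * k (x, y)))%:E)%E.
  apply: eq_integral => x _; rewrite L1_EFin; last by apply: L1Z; exact: gk.
  by rewrite intZ.
rewrite E; apply: eq_integral => y _.
rewrite -intZ// -L1_EFin; last by apply: L1Z; exact: fk.
by apply: eq_integral => x _; rewrite mulrCA.
Qed.

Lemma tonelli (h : R * R -> R) : measurable_fun [set: R * R] h ->
  (forall z, 0 <= h z) ->
  (\int[mu]_x \int[mu]_y (h (x, y))%:E = \int[mu]_y \int[mu]_x (h (x, y))%:E)%E.
Proof.
move=> mh h0; apply: (@fubini_tonelli _ _ (measurableTypeR R) (measurableTypeR R)
  R mu mu (fun z => (h z)%:E)); first exact/measurable_EFinP.
by move=> z; rewrite lee_fin.
Qed.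

End fubini.

(** * Translation and reflection of integrals *)

Section change_of_variable.
Context {R : realType}.
Local Notation mu := (@lebesgue_measure R).
Implicit Types f g h : R -> R.

(** The translated measure agrees with Lebesgue measure on half-open intervals, and these determine
    it. *)
Lemma lebesgue_measure_shift (b : R) (A : set R) : measurable A ->
  pushforward mu ((fun x => x + b) : _ -> measurableTypeR R) A = mu A.
Proof.
move=> mA; apply/esym.
have mphi : measurable_fun [set: measurableTypeR R]
    ((fun x => x + b) : _ -> measurableTypeR R).
  apply: (measurable_of_continuous (f := fun x => x + b)) => x.
  by apply: cvgD; [exact: cvg_id|exact: cvg_cst].
pose m2 : {measure set (measurableTypeR R) -> \bar R} := pushforward mu ((fun x => x + b) : _ -> measurableTypeR R).
apply: (@lebesgue_measure_unique R (m2 mphi)) => //= _ [[p q]] _ <-.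
rewrite /pushforward /= lebesgue_measure_itv/=.
have -> : (fun x => x + b) @^-1` `]p, q] = `]p - b, q - b]%classic.
  by apply/seteqP; split => x /=; rewrite !in_itv/= ltrBlDr lerBrDr.
rewrite lebesgue_measure_itv/= !lte_fin ltrD2r; case: ifP => // _.
by rewrite -!EFinD; congr EFin; ring.
Qed.

Lemma ge0_integral_shift (b : R) f : measurable_fun [set: R] f ->
  (forall x, 0 <= f x) ->
  (\int[mu]_x (f (x + b))%:E = \int[mu]_x (f x)%:E)%E.
Proof.
move=> mf f0.
have mphi : measurable_fun [set: measurableTypeR R]
    ((fun x => x + b) : _ -> measurableTypeR R).
  apply: (measurable_of_continuous (f := fun x => x + b)) => x.
  by apply: cvgD; [exact: cvg_id|exact: cvg_cst].
have := @ge0_integral_pushforward _ _ (measurableTypeR R) (measurableTypeR R) R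
  ((fun x => x + b) : measurableTypeR R -> measurableTypeR R) mphi mu setT (fun x => (f x)%:E).
rewrite preimage_setT => <-//.
- apply: eq_measure_integral => A mA _; exact: lebesgue_measure_shift.
- exact/measurable_EFinP.
- by move=> x _; rewrite lee_fin.
Qed.

Lemma ge0_integral_opp f : measurable_fun [set: R] f ->
  (forall x, 0 <= f x) ->
  (\int[mu]_x (f (- x))%:E = \int[mu]_x (f x)%:E)%E.
Proof.
move=> mf f0.
have := @ge0_integral_pushforward _ _ (measurableTypeR R) (measurableTypeR R) R
  (-%R : measurableTypeR R -> measurableTypeR R) (@oppr_measurable R setT) mu setT (fun x => (f x)%:E).
rewrite preimage_setT => <-//.
- apply: eq_measure_integral => A mA _; exact: lebesgue_measureN.
- exact/measurable_EFinP.
- by move=> x _; rewrite lee_fin.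
Qed.

Lemma L1_opp f : L1 f -> L1 (fun x => f (- x)).
Proof.
move=> f1; apply: L1P.
  by apply: (measurableT_comp (L1_measurable f1)); exact: oppr_measurable.
rewrite (ge0_integral_opp (f := fun x => `|f x|)) ?L1_lty//.
by apply: measurableT_comp => //; exact: L1_measurable.
Qed.

(** The change of variable holds for nonnegative integrands first, so [f] is written as the
    difference of |f| + f and |f|. *)
Lemma int_opp f : L1 f -> \int[mu]_x f (- x) = \int[mu]_x f x.
Proof.
move=> f1.
have mf := L1_measurable f1.
have fE x : f x = (`|f x| + f x) - `|f x| by ring.
rewrite (int_eq (g := fun x => (`|f (- x)| + f (- x)) - `|f (- x)|)); last first.
  by move=> x; ring.
rewrite [RHS](int_eq (g := fun x => (`|f x| + f x) - `|f x|)); last first.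
  by move=> x; ring.
have f1' := L1_opp f1.
rewrite intB; [|by apply: L1D => //; exact: L1_norm|exact: L1_norm].
rewrite intB; [|by apply: L1D => //; exact: L1_norm|exact: L1_norm].
congr (_ - _); congr fine.
  rewrite (ge0_integral_opp (f := fun x => `|f x| + f x))//.
    by apply: measurable_funD => //; exact: measurableT_comp.
  by move=> x; rewrite -lerBlDr sub0r -normrN ler_norm.
rewrite (ge0_integral_opp (f := fun x => `|f x|))//.
exact: measurableT_comp.
Qed.

End change_of_variable.

(** * Absolutely continuous functions *)

Section primitives.
Context {R : realType}.
Local Notation mu := (@lebesgue_measure R).
Implicit Types (f g h : R -> R) (x y : R).

Lemma indicE01 (A : set R) x : 0 <= (\1_A x : R) <= 1.
Proof. by rewrite indicE; case: (_ \in _); rewrite /= ?lexx ?ler01. Qed.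

Lemma indic_norm_le1 (A : set R) x : `|\1_A x : R| <= 1.
Proof. by have /andP[h0 h1] := indicE01 A x; rewrite ger0_norm. Qed.

Lemma measurable_itv_indic (i : interval R) : measurable_fun [set: R] (\1_[set` i] : R -> R).
Proof. exact: measurable_indic. Qed.
Hint Resolve measurable_itv_indic : core.

Lemma integral_indicE (A : set R) f :
  \int[mu]_(x in A) f x = \int[mu]_x (f x * \1_A x).
Proof.
rewrite Rintegral_mkcond; apply: int_eq => x.
by rewrite patchE indicE; case: ifP => _ /=; rewrite ?mulr1 ?mulr0.
Qed.

Lemma integrable_indicE (A : set R) f : measurable A ->
  mu.-integrable A (EFin \o f) <-> L1 (fun x => f x * \1_A x).
Proof.
move=> mA; rewrite /L1 integrable_mkcond//.
suff -> : (EFin \o f) \_ A = EFin \o (fun x => f x * \1_A x) by [].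
apply/funext => x; rewrite patchE /= indicE; case: ifP => _ /=;
  by rewrite ?mulr1 ?mulr0.
Qed.

(** The indicator is kept inside the integrand, so that the rules for integrals over the whole line
    apply directly. *)
Definition locint f := measurable_fun [set: R] f /\
  forall x y, L1 (fun t => f t * \1_`[x, y] t).

Lemma locint_measurable f : locint f -> measurable_fun [set: R] f.
Proof. by case. Qed.

Lemma locint_L1 f : L1 f -> locint f.
Proof.
move=> f1; split; first exact: L1_measurable.
by move=> x y; apply: (@L1_bddMr _ _ _ 1) => // t; exact: indic_norm_le1.
Qed.

Lemma locintD f g : locint f -> locint g -> locint (fun x => f x + g x).
Proof.
move=> [mf hf] [mg hg]; split; first exact: measurable_funD.
by move=> x y; under eq_fun do rewrite mulrDl; exact: L1D.
Qed.

Lemma locintZ (k : R) f : locint f -> locint (fun x => k * f x).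
Proof.
move=> [mf hf]; split; first exact: measurable_funM.
by move=> x y; under eq_fun do rewrite -mulrA; exact: L1Z.
Qed.

Lemma locintN f : locint f -> locint (fun x => - f x).
Proof. by move=> h; under eq_fun do rewrite -mulN1r; exact: locintZ. Qed.

Lemma locintB f g : locint f -> locint g -> locint (fun x => f x - g x).
Proof. by move=> hf hg; apply: locintD => //; exact: locintN. Qed.

Lemma continuous_locbdd f x y : continuous f ->
  exists M, 0 <= M /\ forall t, t \in `[x, y] -> `|f t| <= M.
Proof.
move=> cf; have [xy|yx] := leP x y; last first.
  exists 0; split => // t; rewrite in_itv/= => /andP[h1 h2].
  by have := le_lt_trans (le_trans h1 h2) yx; rewrite ltxx.
have cnf : {within `[x, y], continuous (fun t => `|f t|)}.
  apply: continuous_subspaceT => t; apply: continuous_comp; first exact: cf.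
  exact: norm_continuous.
have [t0 _ ht] := EVT_max xy cnf.
by exists `|f t0|.
Qed.

Lemma locintM_cont (k : R -> R) f : continuous k -> locint f -> locint (fun x => k x * f x).
Proof.
move=> ck [mf hf]; split.
  by apply: measurable_funM => //; exact: measurable_of_continuous.
move=> x y; have [M [M0 hM]] := continuous_locbdd x y ck.
apply: (@L1_leP _ _ (fun t => M * `|f t * \1_`[x, y] t|)).
- apply: measurable_funM => //; apply: measurable_funM => //.
  exact: measurable_of_continuous.
- by apply: L1Z; exact: L1_norm.
- move=> t; rewrite -mulrA normrM indicE; case: (boolP (t \in _)) => tI /=.
    by rewrite ler_wpM2r// hM// -inE.
  by rewrite mulr0 normr0 !mulr0.
Qed.

Lemma locint_cst (k : R) : locint (fun=> k).
Proof.
split; first exact: measurable_cst.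
by move=> x y; apply: L1Z; exact: integrable_indic_itv.
Qed.

Lemma locint_cont f : continuous f -> locint f.
Proof.
move=> cf; have := locintM_cont cf (locint_cst 1).
by under eq_fun do rewrite mulr1.
Qed.

Lemma locint_bddM (k : R -> R) f (M : R) : measurable_fun [set: R] k ->
  (forall x, `|k x| <= M) -> locint f -> locint (fun x => k x * f x).
Proof.
move=> mk kM [mf hf]; split; first exact: measurable_funM.
move=> x y; under eq_fun do rewrite -mulrA.
exact: (@L1_bddM _ _ _ M).
Qed.

(** From |f| <= 1 + f^2. *)
Lemma locint_sqr f : measurable_fun [set: R] f -> locint (fun x => f x ^+ 2) ->
  locint f.
Proof.
move=> mf h2; split => // x y.
have [_ /(_ x y) h] := locintD (locint_cst 1) h2.
apply: L1_leP h _; first exact: measurable_funM.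
move=> t; rewrite normrM [X in _ * X]ger0_norm; last by case/andP: (indicE01 `[x, y] t).
rewrite ler_wpM2r//.
by have := sqr_ge0 (`|f t| - 1); have := normr_ge0 (f t); rewrite -[f t ^+ 2]real_normK ?num_real//; nra.
Qed.

Lemma near_ge x (e : R) : 0 < e -> \forall z \near x, x - e <= z.
Proof.
move=> e0; exists e => // z /=; rewrite ltr_norml => /andP[_ h]; lra.
Qed.

(* f is locally absolutely continuous with f' = g almost everywhere. *)
Definition prim f g := locint g /\ forall x y, x <= y ->
  f y - f x = \int[mu]_t (g t * \1_`[x, y] t).

Lemma eq_ae_prim f g h : prim f g -> measurable_fun [set: R] h ->
  {ae mu, forall x, g x = h x} -> prim f h.
Proof.
move=> [[mg ig] fg] mh gh.
have E x y : {ae mu, forall t, g t * \1_`[x, y] t = h t * \1_`[x, y] t}.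
  by apply: ae_imp gh => t ->.
have mhI x y : measurable_fun [set: R] (fun t => h t * \1_`[x, y] t).
  exact: measurable_funM.
split; first split => // x y; first by apply: eq_ae_L1 (E x y).
move=> x y xy; rewrite fg//; apply: eq_ae_int => //.
exact: measurable_funM.
Qed.

Lemma prim_continuous f g : prim f g -> continuous f.
Proof.
move=> [[mg ig] fg] x.
have ig' : mu.-integrable `[x - 1, x + 1] (EFin \o g).
  exact/integrable_indicE.
have h : x - 1 <= x + 1 by lra.
have cP := parameterized_integral_continuous h ig'.
have : {for x, continuous (fun z => f (x - 1) + parameterized_integral mu (x - 1) z g)}.
  apply: cvgD; first exact: cvg_cst.
  have xI : x \in `](x - 1), (x + 1)[ by rewrite in_itv/=; apply/andP; split; lra.
  have h3 : x - 1 < x + 1 by lra.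
  by have /(continuous_within_itvP _ h3)[/(_ x xI)] := cP.
move=> h2; rewrite /continuous_at.
rewrite -[f x](_ : f (x - 1) + parameterized_integral mu (x - 1) x g = _); last first.
  rewrite /parameterized_integral /= integral_indicE -fg; last by lra.
  by rewrite addrC subrK.
apply: cvg_trans h2; apply: near_eq_cvg; near=> z.
have xz : x - 1 <= z.
  near: z; exact: near_ge.
by rewrite /parameterized_integral /= integral_indicE -fg// addrC subrK.
Unshelve. all: by end_near. Qed.

Lemma prim_derivable f g x : prim f g -> {for x, continuous g} ->
  is_derive x 1 f (g x).
Proof.
move=> [[mg ig] fg] cg.
have ig' : mu.-integrable `[x - 1, x + 1] (EFin \o g).
  exact/integrable_indicE.
have h1 : x < x + 1 by lra.
have h2 : x - 1 < x by lra.
have [d1 d2] := continuous_FTC1_closed h1 ig' h2 cg.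
have : is_derive x 1 (fun z => f (x - 1) + \int[mu]_(t in `[(x - 1), z]) g t) (g x).
  have dd : is_derive x 1 (fun z => \int[mu]_(t in `[(x - 1), z]) g t) (g x).
    by rewrite -d2 derive1E; exact: derivableP.
  by have := is_deriveD (is_derive_cst (f (x - 1)) x 1) dd; rewrite add0r.
apply: near_eq_is_derive; near=> z.
have xz : x - 1 <= z.
  near: z; exact: near_ge.
by rewrite integral_indicE -fg// addrC subrK.
Unshelve. all: by end_near. Qed.

Lemma derive_prim f g : (forall x, is_derive x 1 f (g x)) -> continuous g -> prim f g.
Proof.
move=> df cg; split; first exact: locint_cont.
move=> x y; rewrite le_eqVlt => /predU1P[->|xy].
  rewrite subrr -integral_indicE set_itv1 Rintegral_set1//.
rewrite -integral_indicE /Rintegral.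
rewrite (@continuous_FTC2 _ g f x y xy).
- by rewrite -EFinB.
- exact: continuous_subspaceT.
- have cf : continuous f.
    by move=> z; apply: differentiable_continuous; apply/derivable1_diffP; have [] := df z.
  split.
  + by move=> z _; have [] := df z.
  + by apply: cvg_at_right_filter; exact: cf.
  + by apply: cvg_at_left_filter; exact: cf.
- by move=> z _; rewrite derive1E; have [_ ->] := df z.
Qed.

Lemma primD f f' g g' : prim f f' -> prim g g' ->
  prim (fun x => f x + g x) (fun x => f' x + g' x).
Proof.
move=> [lf hf] [lg hg]; split; first exact: locintD.
move=> x y xy; under eq_Rintegral do rewrite mulrDl.
by rewrite intD -?hf -?hg//; [ring|exact: lf.2|exact: lg.2].
Qed.

Lemma primZ (k : R) f f' : prim f f' -> prim (fun x => k * f x) (fun x => k * f' x).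
Proof.
move=> [lf hf]; split; first exact: locintZ.
move=> x y xy; under eq_Rintegral do rewrite -mulrA.
by rewrite intZ -?hf//; [ring|exact: lf.2].
Qed.

Lemma prim_cst (k : R) : prim (fun=> k) (fun=> 0).
Proof.
split; first exact: locint_cst.
by move=> x y _; under eq_Rintegral do rewrite mul0r; rewrite int0 subrr.
Qed.

(** Fubini on the triangle x <= t <= s <= y: integrating f'(t) g'(s) first in s or first in t gives
    the two sides of the integration by parts formula. *)
Lemma primM f f' g g' : prim f f' -> prim g g' ->
  prim (fun x => f x * g x) (fun x => f' x * g x + f x * g' x).
Proof.
move=> pf pg; have cf := prim_continuous pf; have cg := prim_continuous pg.
have [lf hf] := pf; have [lg hg] := pg.
have lf'g : locint (fun x => f' x * g x).
  by under eq_fun do rewrite mulrC; exact: locintM_cont.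
have lfg' : locint (fun x => f x * g' x) by exact: locintM_cont.
split; first exact: locintD.
move=> x y xy; under eq_Rintegral do rewrite mulrDl.
rewrite intD; [|exact: lf'g.2|exact: lfg'.2].
(* Indicator of the half-plane t <= s, which cuts the triangle out of the square. *)
pose k (z : R * R) : R := ((z.1 <= z.2)%R : bool)%:R.
have mk : measurable_fun [set: R * R] k.
  have -> : k = \1_[set z : R * R | z.1 <= z.2].
    apply/funext => z; rewrite /k indicE; congr (nat_of_bool _)%:R.
    by apply/idP/idP; rewrite inE.
  apply: measurable_indic; rewrite -[X in measurable X]setTI.
  have := @measurable_fun_ler _ (R * R)%type R setT fst snd
    (@measurable_fst _ _ R R) (@measurable_snd _ _ R R) measurableT [set true].
  by apply.
have k1 z : `|k z| <= 1 by rewrite /k; case: (z.1 <= z.2); rewrite ?normr1 ?normr0.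
have E := fubini_kernel (lf.2 x y) (lg.2 x y) mk k1.
have I1 t : f' t * \1_`[x, y] t * \int[mu]_s (g' s * \1_`[x, y] s * k (t, s)) =
            f' t * \1_`[x, y] t * (g y - g t).
  rewrite indicE; case: (boolP (t \in _)) => tI; last by rewrite mulr0 !mul0r.
  move: tI; rewrite inE/= in_itv/= => /andP[xt ty].
  rewrite (hg _ _ ty); congr (_ * _); apply: int_eq => s.
  rewrite -mulrA; congr (_ * _); rewrite !indicE !mem_setE !in_itv/= /k/=.
  have [ts|ts] := leP t s; rewrite ?(le_trans xt ts) /= ?mulr1 ?mulr0//.
have I2 s : g' s * \1_`[x, y] s * \int[mu]_t (f' t * \1_`[x, y] t * k (t, s)) =
            g' s * \1_`[x, y] s * (f s - f x).
  rewrite indicE; case: (boolP (s \in _)) => tI; last by rewrite mulr0 !mul0r.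
  move: tI; rewrite inE/= in_itv/= => /andP[xs sy].
  rewrite (hf _ _ xs); congr (_ * _); apply: int_eq => t.
  rewrite -mulrA; congr (_ * _); rewrite !indicE !mem_setE !in_itv/= /k/=.
  have [ts|ts] := leP t s; rewrite ?(le_trans ts sy) /= ?mulr1 ?mulr0 ?andbT ?andbF//.
rewrite (int_eq I1) (int_eq I2) in E.
have E1 : \int[mu]_t (f' t * \1_`[x, y] t * (g y - g t)) =
   g y * (f y - f x) - \int[mu]_t (f' t * g t * \1_`[x, y] t).
  rewrite hf// -intZ; last exact: lf.2.
  rewrite -intB; [|by apply: L1Z; exact: lf.2|exact: lf'g.2].
  by apply: int_eq => t; ring.
have E2 : \int[mu]_t (g' t * \1_`[x, y] t * (f t - f x)) =
   \int[mu]_t (f t * g' t * \1_`[x, y] t) - f x * (g y - g x).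
  rewrite hg// -intZ; last exact: lg.2.
  rewrite -intB; [|exact: lfg'.2|by apply: L1Z; exact: lg.2].
  by apply: int_eq => t; ring.
rewrite E1 E2 in E; move: E.
set a := \int[mu]_t _; set b := \int[mu]_t _.
by move=> E; lra.
Qed.

End primitives.

(** * Smooth functions and test functions *)

Section smooth_functions.
Context {R : realType}.
Implicit Types (f g h : R -> R) (x y : R).

(** The derivative is a witness to be supplied, which keeps inductions over sums, products and
    compositions free of computations with iterated derivatives. The index is shifted: [Cn n]
    provides n + 1 derivatives. *)
Fixpoint Cn n f : Prop := exists f',
  (forall x, is_derive x 1 f (f' x)) /\
  if n is n'.+1 then Cn n' f' else True.

Lemma is_derive_continuous f f' : (forall x, is_derive x 1 f (f' x)) -> continuous f.
Proof.
move=> df z; apply: differentiable_continuous; apply/derivable1_diffP.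
by have [] := df z.
Qed.

Lemma is_derive_derive1 f f' : (forall x, is_derive x 1 f (f' x)) -> f^`()%classic = f'.
Proof. by move=> df; apply/funext => x; rewrite derive1E; have [_ ->] := df x. Qed.

Lemma smoothP f : smooth f <-> forall n, Cn n f.
Proof.
split => [sf n|h n].
  suff : forall k, Cn n f^`(k)%classic by move=> /(_ 0%N).
  have df k x : is_derive x 1 f^`(k)%classic (f^`(k.+1)%classic x).
    by rewrite derive1nS derive1E; apply: derivableP; exact: sf.
  elim: n => [|n IH] k /=; exists f^`(k.+1)%classic; split; first exact: df.
  - exact: I.
  - exact: df.
  - exact: IH.
elim: n f h => [|n IH] f h x.
  by have [f' [/(_ x)[]]] := h 0%N.
rewrite derive1Sn; apply: IH => m.
by have [f' [/is_derive_derive1 <-]] := h m.+1.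
Qed.

(** Meant for explicit families, such as [flat] or the transforms of test functions, whose
    derivatives stay in the family. *)
Lemma smooth_ind (P : (R -> R) -> Prop) f :
  (forall h, P h -> exists h', (forall x, is_derive x 1 h (h' x)) /\ P h') ->
  P f -> smooth f.
Proof.
move=> step Pf; apply/smoothP => n.
elim: n f Pf => [|n IH] f /step[f' [df Pf']]; exists f'; split => //.
exact: IH.
Qed.

Lemma smooth_is_derive f x : smooth f -> is_derive x 1 f (f^`()%classic x).
Proof. by move=> /(_ 0%N x) h; rewrite derive1E; exact: derivableP. Qed.

Lemma smooth_derive f : smooth f -> smooth f^`()%classic.
Proof. by move=> sf n x; rewrite -derive1Sn; exact: sf. Qed.

Lemma smooth_continuous f : smooth f -> continuous f.
Proof. by move=> sf; apply: (@is_derive_continuous _ f^`()%classic) => x; exact: smooth_is_derive. Qed.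

Lemma smooth_cst (k : R) : smooth (fun=> k).
Proof.
apply: (@smooth_ind (fun f => exists k, f = fun=> k)); last by exists k.
move=> h [{}k ->]; exists (fun=> 0); split; last by exists 0.
by move=> x; exact: is_derive_cst.
Qed.

Lemma smooth_id : smooth (fun x : R => x).
Proof.
apply/smoothP => -[|n]; exists (fun=> 1); split=> //;
  try (by move=> x; exact: is_derive_id).
by move: n; apply/smoothP; exact: smooth_cst.
Qed.

Lemma CnD n f g : Cn n f -> Cn n g -> Cn n (fun x => f x + g x).
Proof.
elim: n f g => [|n IH] f g [f' [df hf]] [g' [dg hg]];
  exists (fun x => f' x + g' x); split => //.
- by move=> x; exact: is_deriveD.
- by move=> x; exact: is_deriveD.
- exact: IH.
Qed.

Lemma Cn_le n f : Cn n.+1 f -> Cn n f.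
Proof.
elim: n f => [|n IH] f [f' [df hf]]; exists f'; split => //.
exact: IH.
Qed.

Lemma is_deriveM_fun f g x (df dg : R) : is_derive x 1 f df -> is_derive x 1 g dg ->
  is_derive x 1 (fun x => f x * g x) (df * g x + f x * dg).
Proof.
move=> hf hg; have := is_deriveM hf hg.
rewrite (_ : _ *: _ + _ *: _ = df * g x + f x * dg)//.
by rewrite /GRing.scale /=; ring.
Qed.

Lemma CnM n f g : Cn n f -> Cn n g -> Cn n (fun x => f x * g x).
Proof.
elim: n f g => [|n IH] f g cf cg.
  have [f' [df _]] := cf; have [g' [dg _]] := cg.
  exists (fun x => f' x * g x + f x * g' x); split => // x.
  exact: is_deriveM_fun.
have [f' [df hf]] := cf; have [g' [dg hg]] := cg.
exists (fun x => f' x * g x + f x * g' x); split => [x|].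
  exact: is_deriveM_fun.
by apply: CnD; apply: IH => //; exact: Cn_le.
Qed.

Lemma smoothD f g : smooth f -> smooth g -> smooth (fun x => f x + g x).
Proof. by move=> /smoothP sf /smoothP sg; apply/smoothP => n; exact: CnD. Qed.

Lemma smoothM f g : smooth f -> smooth g -> smooth (fun x => f x * g x).
Proof. by move=> /smoothP sf /smoothP sg; apply/smoothP => n; exact: CnM. Qed.

Lemma smoothZ (k : R) f : smooth f -> smooth (fun x => k * f x).
Proof. by move=> sf; apply: smoothM; [exact: smooth_cst|exact: sf]. Qed.

Lemma smoothN f : smooth f -> smooth (fun x => - f x).
Proof. by move=> sf; under eq_fun do rewrite -mulN1r; exact: smoothZ. Qed.

Lemma smoothB f g : smooth f -> smooth g -> smooth (fun x => f x - g x).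
Proof. by move=> sf sg; apply: smoothD; [exact: sf|exact: smoothN]. Qed.

Lemma is_derive_affine (a b : R) x : is_derive x 1 (fun x => a * x + b) a.
Proof.
have h1 : is_derive x 1 (fun x : R => a * x) (0 * x + a * 1).
  exact: (@is_deriveM_fun (fun=> a) (fun x => x)).
have := is_deriveD h1 (is_derive_cst b x 1).
by rewrite mul0r mulr1 add0r addr0.
Qed.

Lemma is_derive_comp_affine (a b : R) f f' : (forall x, is_derive x 1 f (f' x)) ->
  forall x, is_derive x 1 (fun x => f (a * x + b)) (a * f' (a * x + b)).
Proof.
move=> df x.
have := @is_derive1_comp R f (fun x => a * x + b) x (f' (a * x + b)) a (df _)
  (is_derive_affine a b x).
by rewrite mulrC.
Qed.

Lemma smooth_affine (a b : R) f : smooth f -> smooth (fun x => f (a * x + b)).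
Proof.
move=> /smoothP sf; apply/smoothP => n; move: (sf n); elim: n f {sf} => [|n IH] f [f' [df hf]].
  exists (fun x => a * f' (a * x + b)); split => //.
  exact: is_derive_comp_affine.
exists (fun x => a * f' (a * x + b)); split.
  exact: is_derive_comp_affine.
apply: CnM; last exact: IH.
by move: n {IH hf}; apply/smoothP; exact: smooth_cst.
Qed.

End smooth_functions.

(** * A family of smooth functions, flat at the origin *)

Section bump.
Context {R : realType}.
Implicit Types (p q : {poly R}) (x : R).

(* Functions p(1/x) exp(-1/x) on x > 0 form a class closed under derivation. *)
Definition flat p x : R := if 0 < x then p.[x^-1] * expR (- x^-1) else 0.

Lemma expRN_monomial_le n (t : R) : 0 <= t -> t ^+ n * expR (- t) <= n`!%:R.
Proof.
move=> t0; rewrite expRN ler_pdivrMr ?expR_gt0//.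
case: n => [|n]; first by rewrite expr0 mul1r -expR0 ler_expR.
have := expR_ge1Dxn n t0; rewrite -ler_pdivrMl ?ltr0n ?fact_gt0// mulrC.
by apply: le_trans; rewrite lerDr.
Qed.

(** With t = 1 / x, dividing by x^2 leaves q(t) exp(-t) where q = X^2 p, and t^n exp(-t) <= n!
    bounds each monomial. The quadratic bound is what makes the derivative at 0 vanish. *)
Lemma flat_quadratic p : exists C, forall x, `|flat p x| <= C * x ^+ 2.
Proof.
pose q := 'X^2 * p.
exists (\sum_(i < size q) `|q`_i| * i`!%:R) => x.
rewrite /flat; case: ifPn => [x0|_]; last first.
  rewrite normr0; apply: mulr_ge0; last exact: sqr_ge0.
  by apply: sumr_ge0 => i _; apply: mulr_ge0.
rewrite -ler_pdivrMr ?exprn_gt0//.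
have t0 : 0 <= x^-1 by rewrite invr_ge0 ltW.
have -> : `|p.[x^-1] * expR (- x^-1)| / x ^+ 2 = `|q.[x^-1] * expR (- x^-1)|.
  rewrite /q hornerM hornerXn -mulrA [RHS]normrM mulrC; congr (_ * _).
  by rewrite ger0_norm ?exprn_ge0// exprVn.
rewrite horner_coef mulr_suml; apply: le_trans (ler_norm_sum _ _ _) _.
apply: ler_sum => i _; rewrite -mulrA normrM ler_wpM2l//.
rewrite ger0_norm; first exact: expRN_monomial_le.
by rewrite mulr_ge0 ?exprn_ge0 ?expR_ge0.
Qed.

Lemma is_derive0_quadratic (f : R -> R) (C : R) : (forall x, `|f x| <= C * x ^+ 2) ->
  is_derive (0 : R) 1 f 0.
Proof.
move=> fC.
have f0 : f 0 = 0.
  by apply/normr0_eq0/le_anti; rewrite normr_ge0 andbT (le_trans (fC 0))// expr0n mulr0.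
have h : (fun h : R => h^-1 *: ((f \o shift 0) (h *: 1) - f 0)) @ 0^' --> (0 : R).
  apply/cvgrPdist_le => e e0.
  have K0 : 0 < (`|C| + 1)^-1 * e by rewrite mulr_gt0// invr_gt0 ltr_wpDl.
  near=> t.
  have t0 : t != 0 by near: t; exact: nbhs_dnbhs_neq.
  rewrite /= sub0r normrN f0 subr0 addr0 [t *: 1]mulr1 normrM.
  rewrite normfV ler_pdivrMl ?normr_gt0//.
  apply: le_trans (fC t) _.
  rewrite -[t ^+ 2]real_normK ?num_real// expr2 mulrA mulrC ler_wpM2l//.
  apply: (@le_trans _ _ ((`|C| + 1) * `|t|)).
    by rewrite ler_wpM2r// (le_trans (ler_norm C))// lerDl.
  rewrite -ler_pdivlMl ?ltr_wpDl//; near: t.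
  exact: dnbhs0_le.
apply: DeriveDef; first by apply/cvg_ex; exists 0.
exact/cvg_lim.
Unshelve. all: by end_near. Qed.

(** For x > 0 the chain rule produces x^-2 (p - p')(1 / x) exp(-1 / x), again a member of the
    family; at 0 the quadratic bound applies. *)
Lemma is_derive_flat p x : is_derive x 1 (flat p) (flat ('X^2 * (p - p^`())) x).
Proof.
have [x0|x0|->] := ltgtP x 0.
- rewrite {2}/flat ltNge (ltW x0)/=.
  have := is_derive_cst (0 : R) x 1; apply: near_eq_is_derive.
  near=> z; rewrite /flat; have : z < 0 by near: z; exact: lt_nbhsl.
  by move=> z0; rewrite ltNge (ltW z0).
- have xn0 : x != 0 by rewrite gt_eqF.
  have dV : is_derive x 1 (fun x : R => x^-1) (- x ^- 2).
    by have := is_deriveV xn0 (is_derive_id x 1); rewrite [X in is_derive _ _ _ X]mulr1.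
  have dp : is_derive x 1 (fun x : R => p.[x^-1]) (p^`().[x^-1] * - x ^- 2).
    exact: (@is_derive1_comp R (horner p) (fun x => x^-1)).
  have de : is_derive x 1 (fun x : R => expR (- x^-1)) (expR (- x^-1) * - - x ^- 2).
    exact: (@is_derive1_comp R expR (fun x => - x^-1)).
  have := is_deriveM_fun dp de.
  rewrite {2}/flat x0.
  rewrite (_ : _ + _ = ('X^2 * (p - p^`())).[x^-1] * expR (- x^-1)); last first.
    by rewrite !hornerE/=; field.
  apply: near_eq_is_derive.
  near=> z; have : 0 < z by near: z; exact: lt_nbhsr.
  by move=> z0; rewrite /flat z0.
- rewrite {2}/flat ltxx.
  have [C hC] := flat_quadratic p.
  exact: is_derive0_quadratic hC.
Unshelve. all: by end_near. Qed.

Lemma smooth_flat p : smooth (flat p).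
Proof.
apply: (@smooth_ind _ (fun f => exists p, f = flat p)); last by exists p.
move=> h [{}p ->]; exists (flat ('X^2 * (p - p^`()))); split; last by eexists.
by move=> x; exact: is_derive_flat.
Qed.

End bump.

(** * Real test functions and bumps approximating an interval *)

Section test_functions.
Context {R : realType}.
Implicit Types (f g : R -> R) (x : R).

Definition testfun f := smooth f /\ exists M : R, forall x, M < `|x| -> f x = 0.

Lemma testfun_smooth f : testfun f -> smooth f.
Proof. by case. Qed.

Lemma testfun_continuous f : testfun f -> continuous f.
Proof. by case=> /smooth_continuous. Qed.

Lemma testfunM f g : smooth f -> testfun g -> testfun (fun x => f x * g x).
Proof.
move=> sf [sg [M gM]]; split; first exact: smoothM sf sg.
by exists M => x /gM ->; rewrite mulr0.
Qed.

Lemma testfunZ (k : R) f : testfun f -> testfun (fun x => k * f x).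
Proof. by move=> tf; apply: testfunM tf; exact: smooth_cst. Qed.

Lemma testfunD f g : testfun f -> testfun g -> testfun (fun x => f x + g x).
Proof.
move=> [sf [M fM]] [sg [M' gM]]; split; first exact: smoothD sf sg.
exists (Num.max M M') => x; rewrite gt_max => /andP[h1 h2].
by rewrite fM// gM// addr0.
Qed.

Lemma testfunB f g : testfun f -> testfun g -> testfun (fun x => f x - g x).
Proof.
move=> tf tg; apply: testfunD tf _.
under eq_fun do rewrite -mulN1r; exact: testfunZ tg.
Qed.

Lemma testfun_derive f : testfun f -> testfun f^`()%classic.
Proof.
move=> [sf [M fM]]; split; first exact: smooth_derive sf.
exists M => x Mx.
have : is_derive x 1 f 0.
  have := is_derive_cst (0 : R) x 1; apply: near_eq_is_derive; near=> z.
  rewrite fM//; near: z.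
  have : (fun z => `|z|) @ x --> `|x| by exact: norm_continuous.
  by move=> /cvgr_gt; apply.
by rewrite derive1E => -[_ ->].
Unshelve. all: by end_near. Qed.

Lemma testfun_is_derive f x : testfun f -> is_derive x 1 f (f^`()%classic x).
Proof. by case=> sf _; exact: smooth_is_derive. Qed.

Lemma testfun_affine (a b : R) f : a != 0 -> testfun f ->
  testfun (fun x => f (a * x + b)).
Proof.
move=> a0 [sf [M fM]]; split; first exact: smooth_affine sf.
exists ((`|M| + `|b|) / `|a|) => x.
rewrite ltr_pdivrMr ?normr_gt0// => h; apply: fM.
have h1 : `|a * x| - `|b| <= `|a * x + b|.
  by have := lerB_dist (a * x) (- b); rewrite normrN opprK.
rewrite normrM mulrC in h1.
by have := ler_norm M; lra.
Qed.

Lemma testfun_opp f : testfun f -> testfun (fun x => f (- x)).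
Proof.
move=> tf; have := @testfun_affine (-1) 0 f _ tf.
rewrite oppr_eq0 oner_eq0 => /(_ isT).
by under eq_fun do rewrite mulN1r addr0.
Qed.

Lemma testfun_bounded f : testfun f -> exists C, forall x, `|f x| <= C.
Proof.
move=> tf; have [sf [M fM]] := tf.
have [C [C0 hC]] := continuous_locbdd (- M) M (testfun_continuous tf).
exists C => x; have [xM|Mx] := leP `|x| M; last by rewrite fM// normr0.
by apply: hC; rewrite in_itv/= -ler_norml.
Qed.

Lemma testfun_L1 f : testfun f -> L1 f.
Proof.
move=> tf; have cf := testfun_continuous tf; have [sf [M fM]] := tf.
have [_ /(_ (- M) M)] := locint_cont cf.
suff -> : (fun t => f t * \1_`[- M, M] t) = f by [].
apply/funext => x; rewrite indicE; case: (boolP (x \in _)) => xM /=.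
  by rewrite mulr1.
rewrite mulr0 fM// ltNge; apply: contra xM.
by rewrite inE /= in_itv/= ler_norml.
Qed.

Lemma testfun_mulL1 f k : locint k -> testfun f -> L1 (fun x => k x * f x).
Proof.
move=> [mk ik] tf; have cf := testfun_continuous tf; have [sf [M fM]] := tf.
have [C hC] := testfun_bounded tf.
have := @L1_bddMr R f _ C (measurable_of_continuous cf) (ik (- M) M) hC.
suff -> : (fun x => k x * \1_`[- M, M] x * f x) = (fun x => k x * f x) by [].
apply/funext => x; rewrite indicE; case: (boolP (x \in _)) => xM /=.
  by rewrite mulr1.
rewrite [f x]fM ?mulr0// ltNge; apply: contra xM.
by rewrite inE /= in_itv/= ler_norml.
Qed.

(** Steepening the two factors with n makes the bump tend pointwise to the indicator of []a, b[],
    staying between 0 and 1. This takes the place of mollification. *)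
Definition bump (a b : R) (n : nat) x : R :=
  flat 1 (n.+1%:R * (x - a)) * flat 1 (n.+1%:R * (b - x)).

Lemma flat1E x : flat 1 x = if 0 < x then expR (- x^-1) else 0.
Proof. by rewrite /flat hornerC mul1r. Qed.

Lemma flat1_ge0 x : 0 <= flat (1 : {poly R}) x.
Proof. by rewrite flat1E; case: ifP => // _; exact: expR_ge0. Qed.

Lemma flat1_le1 x : flat (1 : {poly R}) x <= 1.
Proof.
rewrite flat1E; case: ifPn => [x0|_]; last exact: ler01.
by rewrite expR_le1 oppr_le0 invr_ge0 ltW.
Qed.

Lemma bump_ge0 a b n x : 0 <= bump a b n x.
Proof. by rewrite mulr_ge0 ?flat1_ge0. Qed.

Lemma bump_le1 a b n x : bump a b n x <= 1.
Proof. by rewrite mulr_ile1 ?flat1_ge0 ?flat1_le1. Qed.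

Lemma bump_out a b n x : ~~ (a < x < b) -> bump a b n x = 0.
Proof.
rewrite negb_and -!leNgt => /orP[xa|bx]; rewrite /bump !flat1E.
  by rewrite pmulr_rgt0 ?ltr0n// subr_gt0 ltNge xa mul0r.
by rewrite [0 < _ * (b - x)]pmulr_rgt0 ?ltr0n// subr_gt0 [x < b]ltNge bx mulr0.
Qed.

Lemma testfun_bump a b n : testfun (bump a b n).
Proof.
split.
  apply: smoothM.
    have := @smooth_affine R n.+1%:R (- (n.+1%:R * a)) _ (@smooth_flat R 1).
    by under eq_fun do rewrite -mulrBr.
  have := @smooth_affine R (- n.+1%:R) (n.+1%:R * b) _ (@smooth_flat R 1).
  by under eq_fun do rewrite mulNr addrC -mulrBr.
exists (`|a| + `|b|) => x h; apply: bump_out; apply/negP => /andP[ax xb].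
suff : `|x| <= `|a| + `|b| by rewrite leNgt h.
rewrite ler_norml; have := ler_norm a; have := ler_norm (- a); have := ler_norm b.
by have := ler_norm (- b); rewrite !normrN => *; apply/andP; split; lra.
Qed.

Lemma flat1_cvg (x : R) : 0 < x -> flat 1 (n.+1%:R * x) @[n --> \oo] --> (1 : R).
Proof.
move=> x0.
have -> : (fun n => flat 1 (n.+1%:R * x)) = (fun n => expR (- (n.+1%:R^-1 * x^-1))).
  by apply/funext => n; rewrite flat1E pmulr_rgt0 ?ltr0n// x0 invfM.
rewrite -[X in _ --> X](@expR0 R) -[0 in X in _ --> expR X]oppr0 -[0 in X in _ --> X](mul0r x^-1).
apply: (@cvg_comp _ _ _ _ expR _ (nbhs (- (0 * x^-1)))); last exact: continuous_expR.
by apply: cvgN; apply: cvgM; [exact: cvg_harmonic|exact: cvg_cst].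
Qed.

Lemma bump_cvg a b x : bump a b n x @[n --> \oo] --> (\1_`]a, b[ x : R).
Proof.
rewrite indicE mem_setE in_itv/=; case: (boolP (a < x < b)) => /=.
  move=> /andP[ax xb]; rewrite -[X in _ --> X](mulr1 1).
  by apply: cvgM; apply: flat1_cvg; rewrite subr_gt0.
move=> h; under eq_fun do rewrite bump_out//.
exact: cvg_cst.
Qed.

End test_functions.

(** * Weak derivatives *)

Section du_bois_reymond.
Context {R : realType}.
Local Notation mu := (@lebesgue_measure R).
Implicit Types (f g k : R -> R) (x y : R).

Lemma ae_neq (a : R) : {ae mu, forall t, t <> a}.
Proof.
exists [set a]; split => //; first exact: lebesgue_measure_set1.
by move=> t /= /contrapT ->.
Qed.

Lemma indic_itv_ae x y : {ae mu, forall t, (\1_`]x, y[ t : R) = \1_`[x, y] t}.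
Proof.
apply: ae_imp (ae_and (ae_neq x) (ae_neq y)) => t [/eqP tx /eqP ty].
rewrite !indicE !mem_setE !in_itv/=.
have [_|_|h] := ltgtP x t; last by rewrite h eqxx in tx.
  by have [_|_|h] := ltgtP t y; last by rewrite h eqxx in ty.
by [].
Qed.

Lemma prim_exists g : locint g -> exists f, prim f g.
Proof.
move=> lg; have [mg ig] := lg.
(* For either sign of x one of the two intervals is empty or a point, so this is the signed integral
   from 0 to x. *)
exists (fun x => \int[mu]_t (g t * \1_`[0, x] t) - \int[mu]_t (g t * \1_`[x, 0] t)).
split => // x y xy.
rewrite -intB; [|exact: ig|exact: ig]; rewrite -intB; [|exact: ig|exact: ig].
rewrite -intB; [|by apply: L1B; exact: ig|by apply: L1B; exact: ig].
have mI a b : measurable_fun [set: R] (fun t => g t * \1_`[a, b] t).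
  by have /L1_measurable := ig a b.
apply: eq_ae_int; [|exact: mI|].
  by apply: measurable_funB; apply: measurable_funB; exact: mI.
apply: ae_imp (ae_and (ae_neq 0) (ae_and (ae_neq x) (ae_neq y))) => t [/eqP t0 [/eqP tx /eqP ty]].
rewrite -!mulrBr; congr (_ * _).
rewrite !indicE !mem_setE !in_itv/=.
have [h0|h0|h0] := ltgtP 0 t; last by rewrite h0 eqxx in t0.
  have [hx|hx|hx] := ltgtP x t; last by rewrite hx eqxx in tx.
    by have [hy|hy|hy] := ltgtP t y => /=; rewrite ?subr0.
  have [hy|hy|hy] := ltgtP t y => /=; rewrite ?subr0 ?subrr//; lra.
have [hx|hx|hx] := ltgtP x t; last by rewrite hx eqxx in tx.
  have [hy|hy|hy] := ltgtP t y => /=; rewrite ?subr0 ?subrr ?sub0r ?opprK//; lra.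
have [hy|hy|hy] := ltgtP t y => /=; rewrite ?subr0 ?subrr ?sub0r ?opprK//; lra.
Qed.

Lemma locint_locally f : locally_integrable [set: R] f -> locint f.
Proof.
move=> [mf _ h]; split => // x y.
apply: (integrable_indicE f (measurable_itv `[x, y])).1.
apply/integrableP; split.
  by apply/measurable_EFinP; exact: measurable_funS mf.
by apply: h => //; exact: segment_compact.
Qed.

Lemma locally_locint f : locint f -> locally_integrable [set: R] f.
Proof.
move=> [mf h]; split => //; first exact: openT.
move=> K _ cK; have [M [_ hM]] := compact_bounded cK.
have KM : K `<=` `[- (`|M| + 1), `|M| + 1].
  move=> x Kx; rewrite /= in_itv/= -ler_norml; apply: (hM (`|M| + 1)) => //.
  by rewrite ltr_pwDr// ler_norm.
pose I : interval R := `[- (`|M| + 1), `|M| + 1].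
have /(integrable_indicE f (measurable_itv I)).2 /integrableP[_] := h (- (`|M| + 1)) (`|M| + 1).
 apply: le_lt_trans; apply: ge0_subset_integral => //.
- exact: compact_measurable.
- by apply/measurable_EFinP/measurableT_comp => //; exact: measurable_funS mf.
Qed.

(** Bumps tend to indicators of intervals, so by dominated convergence every integral of [k] over an
    interval is zero. At a Lebesgue point, [k] is then the derivative of the zero function. *)
Lemma dubois_reymond k : locint k ->
  (forall psi, testfun psi -> \int[mu]_x (k x * psi x) = 0) ->
  {ae mu, forall x, k x = 0}.
Proof.
move=> lk h; have [mk ik] := lk.
have mI a b : measurable_fun [set: R] (fun t => k t * \1_`[a, b] t).
  by have /L1_measurable := ik a b.
have mO a b : measurable_fun [set: R] (fun t => k t * \1_`]a, b[ t).
  by apply: measurable_funM => //; exact: measurable_itv_indic.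
have k0 a b : \int[mu]_t (k t * \1_`[a, b] t) = 0.
  transitivity (\int[mu]_t (k t * \1_`]a, b[ t)).
    by apply: eq_ae_int => //; apply: ae_imp (indic_itv_ae a b) => t ->.
  have [] := @dct R (fun n t => k t * bump a b n t) (fun t => k t * \1_`]a, b[ t)
     (fun t => `|k t * \1_`[a, b] t|).
  - move=> n; apply: measurable_funM => //; apply: measurable_of_continuous.
    exact/testfun_continuous/testfun_bump.
  - exact: mO.
  - exact/L1_norm/ik.
  - move=> n x; rewrite normrM [X in _ <= X]normrM ler_wpM2l//.
    rewrite indicE mem_setE in_itv/=; case: (boolP (a <= x <= b)) => /= hx.
      by rewrite normr1 ger0_norm ?bump_le1 ?bump_ge0.
    rewrite bump_out ?normr0//; apply: contra hx => /andP[/ltW -> /ltW ->] //.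
  - by move=> x; apply: cvgM; [exact: cvg_cst|exact: bump_cvg].
  move=> _ /cvg_lim <-//.
  rewrite (_ : (fun n => _) = fun=> 0); first exact: lim_cst.
  by apply/funext => n; rewrite h//; exact: testfun_bump.
have := lebesgue_differentiation (locally_locint lk).
apply: ae_imp => x lx.
have ik' : mu.-integrable `[x - 1, x + 1] (EFin \o k).
  exact/integrable_indicE.
have h1 : x < x + 1 by lra.
have [|_] := FTC1_lebesgue_pt h1 ik' _ lx; first by rewrite /= lte_fin; lra.
have -> : (fun y => \int[mu]_(t in `[(x - 1), y]) k t) = fun=> 0.
  by apply/funext => y; rewrite integral_indicE k0.
by rewrite derive1_cst.
Qed.

(** If all test functions had mean zero, the constant 1 would be orthogonal to them and hence zero
    almost everywhere. *)
Lemma testfun_int_neq0 : exists theta : R -> R, testfun theta /\ \int[mu]_x theta x = 1.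
Proof.
have [theta [tt t0]] : exists theta : R -> R, testfun theta /\ \int[mu]_x theta x != 0.
  apply: contrapT => hn.
  have h1 : {ae mu, forall x : R, (1 : R) = 0}.
    apply: (@dubois_reymond (fun=> 1)); first exact: locint_cst.
    move=> psi tpsi; apply: contrapT => /eqP p0; apply: hn; exists psi; split => //.
    by move: p0; under eq_Rintegral do rewrite mul1r.
  have : (\int[mu]_x (\1_`[0%R, 1%R] x : R)%:E)%E = 0%E.
    rewrite -(@integral0 _ _ R mu setT); apply: ae_eq_integral => //.
      by apply/measurable_EFinP; exact: measurable_itv_indic.
    by apply: ae_imp h1 => x /eqP; rewrite oner_eq0.
  rewrite integral_indic//= setIT lebesgue_measure_itv/= lte_fin ltr01 oppr0 addr0.
  by move=> /eqP; rewrite eqe oner_eq0.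
exists (fun x => (\int[mu]_x theta x)^-1 * theta x); split; first exact: testfunZ.
by rewrite intZ ?mulVf//; exact: testfun_L1.
Qed.

Lemma prim_testfun_int0 f g (M : R) : prim f g -> L1 g ->
  (forall x, M < `|x| -> f x = 0) -> (forall x, M < `|x| -> g x = 0) ->
  \int[mu]_x g x = 0.
Proof.
move=> [lg pf] g1 fM gM.
pose N := `|M| + 1.
have MN : M < N by rewrite /N ltr_pwDr// ler_norm.
have N0 : 0 <= N by rewrite /N addr_ge0.
transitivity (\int[mu]_x (g x * \1_`[- N, N] x)).
  apply: int_eq => x; rewrite indicE mem_setE in_itv/= -ler_norml.
  case: (leP `|x| N) => /= xN; first by rewrite mulr1.
  by rewrite gM ?mul0r// (lt_trans MN).
rewrite -pf; last by lra.
by rewrite !fM ?subrr// ?normrN ger0_norm.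
Qed.

(** The primitive based to the left of the support is zero there, and to the right it equals the
    mean of [chi], which is 0. *)
Lemma testfun_antiderivative chi : testfun chi -> \int[mu]_x chi x = 0 ->
  exists phi, testfun phi /\ (forall x, is_derive x 1 phi (chi x)).
Proof.
move=> tc c0; have cc := testfun_continuous tc; have [sc [M cM]] := tc.
have [P0 pP0] := prim_exists (locint_cont cc).
pose N := `|M| + 1.
have MN : M < N by rewrite /N ltr_pwDr// ler_norm.
have N0 : 0 <= N by rewrite /N addr_ge0.
pose phi x := P0 x - P0 (- N).
have dphi x : is_derive x 1 phi (chi x).
  have := is_deriveB (prim_derivable pP0 (cc x)) (is_derive_cst (P0 (- N)) x 1).
  by rewrite subr0.
have sphi : smooth phi.
  apply/smoothP => -[|n]; exists chi; split => //.
  by move: n; exact/smoothP.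
exists phi; split => //; split => //.
have out x y : x <= y -> (forall t, x <= t <= y -> chi t = 0) -> P0 x = P0 y.
  move=> xy h; apply/esym/eqP; rewrite -subr_eq0 pP0.2//; apply/eqP.
  transitivity (\int[mu]_t (0 : R)); last exact: int0.
  apply: int_eq => t; rewrite indicE mem_setE in_itv/=.
  by case: (boolP (x <= t <= y)) => /= [/h ->|_]; rewrite ?mul0r ?mulr0.
have ends : P0 N = P0 (- N).
  apply/eqP; rewrite -subr_eq0 pP0.2; last by lra.
  rewrite -[X in _ == X]c0; apply/eqP/int_eq => x.
  rewrite indicE mem_setE in_itv/= -ler_norml.
  case: (leP `|x| N) => /= xN; first by rewrite mulr1.
  by rewrite cM ?mul0r// (lt_trans MN).
exists N => x; rewrite /phi; have [x0|x0] := leP 0 x; rewrite ?(ger0_norm x0) ?(ltr0_norm x0) => Nx.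
  rewrite -ends (@out N x) ?subrr ?ltW// => t /andP[h1 h2]; apply: cM.
  by rewrite (lt_le_trans MN)// (le_trans h1)// ler_norm.
rewrite (@out x (- N)) ?subrr//; first by lra.
move=> t /andP[h1 h2]; apply: cM.
by rewrite (lt_le_trans MN)// -normrN (le_trans _ (ler_norm _))// lerNr.
Qed.

(** Subtracting from a test function its mean times [theta] leaves the derivative of a test
    function. Hence k minus the integral of k theta annihilates all test functions. *)
Lemma weak_const k : locint k ->
  (forall phi, testfun phi -> \int[mu]_x (k x * phi^`()%classic x) = 0) ->
  exists c : R, {ae mu, forall x, k x = c}.
Proof.
move=> lk h; have [theta [tt t1]] := testfun_int_neq0.
exists (\int[mu]_x (k x * theta x)); set c := \int[mu]_x _.
suff : {ae mu, forall x, k x - c = 0} by apply: ae_imp => x /eqP; rewrite subr_eq0 => /eqP.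
apply: dubois_reymond; first by apply: locintB => //; exact: locint_cst.
move=> psi tp; pose m := \int[mu]_x psi x.
pose chi x := psi x - m * theta x.
have tchi : testfun chi by apply: testfunB => //; exact: testfunZ.
have [||phi [tphi /is_derive_derive1 phiE]] := @testfun_antiderivative chi => //.
  rewrite intB ?intZ; [|exact: testfun_L1..|exact/L1Z/testfun_L1].
  by rewrite t1 mulr1 subrr.
have := h _ tphi; rewrite phiE /chi.
have kp : L1 (fun x => k x * psi x) by exact: testfun_mulL1.
have kt : L1 (fun x => k x * theta x) by exact: testfun_mulL1.
rewrite (int_eq (g := fun x => k x * psi x - m * (k x * theta x))); last by move=> x; ring.
rewrite intB//; last exact: L1Z.
rewrite intZ// -/c => E.
rewrite (int_eq (g := fun x => k x * psi x - c * psi x)); last by move=> x; ring.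
rewrite intB//; last exact/L1Z/testfun_L1.
by rewrite intZ -/m; [lra|exact: testfun_L1].
Qed.

(** The difference between [k] and a primitive of [w] has weak derivative zero, so it is
    constant. *)
Lemma weak_derivative_prim k w : locint k -> locint w ->
  (forall phi, testfun phi ->
    \int[mu]_x (k x * phi^`()%classic x) = - \int[mu]_x (w x * phi x)) ->
  exists v, prim v w /\ {ae mu, forall x, k x = v x}.
Proof.
move=> lk lw h; have [v0 pv0] := prim_exists lw.
have cv0 := prim_continuous pv0; have lv0 := locint_cont cv0.
have [||c hc] := @weak_const (fun x => k x - v0 x); first exact: locintB.
  move=> phi tphi; have tphi' := testfun_derive tphi.
  have I1 := testfun_mulL1 lk tphi'; have I2 := testfun_mulL1 lv0 tphi'.
  have I3 := testfun_mulL1 lw tphi.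
  rewrite (int_eq (g := fun x => k x * phi^`()%classic x - v0 x * phi^`()%classic x)); last first.
    by move=> x; rewrite mulrBl.
  rewrite intB// h//.
  have pp : prim phi phi^`()%classic.
    apply: derive_prim; last exact: testfun_continuous.
    by move=> x; exact: testfun_is_derive.
  have [_ [M1 hM1]] := tphi; have [_ [M2 hM2]] := tphi'.
  have := @prim_testfun_int0 _ _ (Num.max M1 M2) (primM pv0 pp).
  rewrite intD// => E; suff : \int[mu]_x (w x * phi x) + \int[mu]_x (v0 x * phi^`()%classic x) = 0 by lra.
  apply: E; first exact: L1D.
    by move=> x; rewrite gt_max => /andP[/hM1 -> _]; rewrite mulr0.
  by move=> x; rewrite gt_max => /andP[/hM1 -> /hM2 ->]; rewrite !mulr0 addr0.
exists (fun x => v0 x + c); split.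
  have := primD pv0 (prim_cst c).
  by under [X in prim _ X -> _]eq_fun do rewrite addr0.
by apply: ae_imp hc => x; lra.
Qed.

End du_bois_reymond.

(** * Cosine and sine transforms *)

Section tails.
Context {R : realType}.
Local Notation mu := (@lebesgue_measure R).
Implicit Types (f g h : R -> R) (x y : R).

Lemma int_indic_itv1 (a : R) : \int[mu]_x (\1_`[a, a + 1] x : R) = 1.
Proof.
rewrite (int_eq (g := fun x => 1 * \1_`[a, a + 1] x)); last by move=> x; rewrite mul1r.
rewrite -integral_indicE Rintegral_cst//= lebesgue_measure_itv/= lte_fin ltrDl ltr01.
by rewrite -EFinD/= mul1r; ring.
Qed.

Lemma L1_indic_itv (a b : R) : L1 (\1_`[a, b] : R -> R).
Proof. exact: integrable_indic_itv. Qed.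

Lemma ge0_int_indic_le f (A B : set R) : L1 (fun t => f t * \1_A t) ->
  L1 (fun t => f t * \1_B t) -> (forall t, 0 <= f t) -> A `<=` B ->
  \int[mu]_t (f t * \1_A t) <= \int[mu]_t (f t * \1_B t).
Proof.
move=> fA fB f0 AB; apply: int_le => // t; rewrite ler_wpM2l// !indicE.
have [tA|//] := boolP (t \in A); rewrite ?ler01//.
by rewrite mem_set//; apply: AB; rewrite inE in tA.
Qed.

(** For y in the unit interval |f(x)| <= |f(y)| + int |g|; this is averaged over y. *)
Lemma prim_norm_le f g x (a : R) : prim f g -> a <= x <= a + 1 ->
  `|f x| <= \int[mu]_t ((`|f t| + `|g t|) * \1_`[a, a + 1] t).
Proof.
move=> pf /andP[ax xa]; have cf := prim_continuous pf; have [[mg ig] fE] := pf.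
have [_ iaf] : locint (fun t => `|f t|).
  apply: locint_cont => z; apply: continuous_comp; first exact: cf.
  exact: norm_continuous.
have iag u v : L1 (fun t => `|g t| * \1_`[u, v] t).
  have := L1_norm (ig u v); under eq_fun do rewrite normrM.
  by under eq_fun do rewrite [X in _ * X]ger0_norm//.
pose B := \int[mu]_t (`|g t| * \1_`[a, a + 1] t).
have hB u v : a <= u -> u <= v -> v <= a + 1 -> `|f v - f u| <= B.
  move=> au uv va; rewrite fE//; apply: (le_trans (int_norm (ig u v))).
  rewrite (int_eq (g := fun t => `|g t| * \1_`[u, v] t)); last first.
    by move=> t; rewrite normrM [X in _ * X]ger0_norm//.
  apply: ge0_int_indic_le => // t /=; rewrite !in_itv/= => /andP[h1 h2].
  by rewrite (le_trans au h1) (le_trans h2 va).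
have hx y : a <= y <= a + 1 -> `|f x| <= `|f y| + B.
  move=> /andP[ay ya]; have [xy|yx] := leP x y.
    have := hB x y ax xy ya; have := ler_distD 0 (f x) (f y).
    by rewrite !subr0 distrC => h1 h2; have := ler_normD (f x - f y) (f y); rewrite subrK distrC; lra.
  have := hB y x ay (ltW yx) xa.
  by have := ler_normD (f x - f y) (f y); rewrite subrK; lra.
have -> : `|f x| = \int[mu]_t (`|f x| * \1_`[a, a + 1] t).
  by rewrite intZ ?int_indic_itv1 ?mulr1//; exact: L1_indic_itv.
have -> : \int[mu]_t ((`|f t| + `|g t|) * \1_`[a, a + 1] t) =
    \int[mu]_t (`|f t| * \1_`[a, a + 1] t + B * \1_`[a, a + 1] t).
  rewrite intD; [|exact: iaf|exact/L1Z/L1_indic_itv].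
  rewrite intZ ?int_indic_itv1 ?mulr1; last exact: L1_indic_itv.
  under eq_Rintegral do rewrite mulrDl.
  by rewrite intD.
apply: int_le; [exact/L1Z/L1_indic_itv| |].
  by apply: L1D; [exact: iaf|exact/L1Z/L1_indic_itv].
move=> t; rewrite -mulrDl indicE mem_setE in_itv/=.
by case: (boolP (a <= t <= a + 1)) => /= [/hx|_]; rewrite ?mulr1 ?mulr0.
Qed.

(** Dominated convergence on the sets |t| >= n. One threshold serves all remote sets at once, in
    particular unit intervals travelling to infinity. *)
Lemma L1_tail g (e : R) : L1 g -> (forall t, 0 <= g t) -> 0 < e ->
  exists N : R, forall A : set R, measurable A -> (forall t, A t -> N <= `|t|) ->
    \int[mu]_t (g t * \1_A t) <= e.
Proof.
move=> g1 g0 e0; have mg := L1_measurable g1.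
pose B n : set R := [set t | n%:R <= `|t|].
have mB n : measurable (B n).
  have := @measurable_fun_ler _ (measurableTypeR R) R setT (fun=> n%:R) (fun t => `|t|)
    (measurable_cst _) (@normr_measurable R setT) measurableT [set true] I.
  by rewrite setTI.
have iA (A : set R) : measurable A -> L1 (fun t => g t * \1_A t).
  move=> mA; apply: (@L1_bddMr _ _ _ 1) => //.
  by move=> x; exact: indic_norm_le1.
have [] := @dct R (fun n t => g t * \1_(B n) t) (fun=> 0) g.
- by move=> n; apply: measurable_funM => //; exact: measurable_indic.
- exact: measurable_cst.
- exact: g1.
- move=> n t; rewrite normrM (ger0_norm (g0 t)) -[leRHS]mulr1 ler_wpM2l//.
  exact: indic_norm_le1.
- move=> t; rewrite -(mulr0 (g t)); apply: cvgM; first exact: cvg_cst.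
  apply/cvgrPdist_le => d d0; near=> n.
  rewrite indicE memNset ?subrr ?normr0 ?ltW//= => h.
  suff : `|t| < n%:R by rewrite ltNge h.
  by near: n; exact: nbhs_infty_gtr.
move=> _; rewrite int0 => /cvgrPdist_le /(_ _ e0) [N _ hN].
exists N%:R => A mA hA; have := hN N (leqnn _); rewrite /= sub0r normrN.
apply: le_trans; apply: le_trans (ler_norm _).
apply: ge0_int_indic_le => //; [exact: iA|exact: iA].
Unshelve. all: by end_near. Qed.

Lemma prim_bounded f g : prim f g -> L1 f -> L1 g ->
  forall x, `|f x| <= \int[mu]_t (`|f t| + `|g t|).
Proof.
move=> pf f1 g1 x.
have h : x <= x <= x + 1 by rewrite lexx lerDl ler01.
apply: le_trans (prim_norm_le pf h) _.
have fg : L1 (fun t => `|f t| + `|g t|) by apply: L1D; exact: L1_norm.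
apply: int_le => //; first by apply: (locint_L1 fg).2.
by move=> t; rewrite -[leRHS]mulr1 ler_wpM2l ?addr_ge0.
Qed.

Lemma prim_cvg0 f g : prim f g -> L1 f -> L1 g ->
  (f x @[x --> +oo] --> 0) /\ (f x @[x --> -oo] --> 0).
Proof.
move=> pf f1 g1.
have fg : L1 (fun t => `|f t| + `|g t|) by apply: L1D; exact: L1_norm.
have fg0 t : 0 <= `|f t| + `|g t| by rewrite addr_ge0.
split; apply/cvgrPdist_le => e e0; have [N hN] := L1_tail fg fg0 e0; near=> x;
  rewrite sub0r normrN.
  have h : x <= x <= x + 1 by rewrite lexx lerDl ler01.
  apply: le_trans (prim_norm_le pf h) _; apply: hN => // t /=.
  rewrite in_itv/= => /andP[xt _]; apply: le_trans (ler_norm t); apply: le_trans xt.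
  by near: x; apply: nbhs_pinfty_ge; rewrite num_real.
(* Towards -oo the unit interval is taken to the left of x, so that it moves away from the
   origin. *)
have h : x - 1 <= x <= x - 1 + 1 by rewrite subrK lexx gerBl ler01.
apply: le_trans (prim_norm_le pf h) _; apply: hN => // t /=.
rewrite in_itv/= subrK => /andP[_ xt]; rewrite -normrN; apply: le_trans (ler_norm _).
rewrite lerNr; apply: (le_trans xt).
by near: x; apply: nbhs_ninfty_le; rewrite num_real.
Unshelve. all: by end_near. Qed.

(** The integral over [-n, n] is f(n) - f(-n), which tends to 0. Applied to products, this is
    integration by parts without boundary terms. *)
Lemma prim_int0 f g : prim f g -> L1 f -> L1 g -> \int[mu]_x g x = 0.
Proof.
move=> pf f1 g1; have [fp fm] := prim_cvg0 pf f1 g1.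
have [] := @dct R (fun n t => g t * \1_`[- n%:R, n%:R] t) g (fun t => `|g t|).
- by move=> n; apply: measurable_funM; [exact: L1_measurable|exact: measurable_itv_indic].
- exact: L1_measurable.
- exact: L1_norm.
- by move=> n t; rewrite normrM -[leRHS]mulr1 ler_wpM2l// indic_norm_le1.
- move=> t; rewrite -[X in _ --> X]mulr1; apply: cvgM; first exact: cvg_cst.
  apply/cvgrPdist_le => d d0; near=> n.
  rewrite indicE mem_set ?subrr ?normr0 ?ltW//= in_itv/= -ler_norml.
  by near: n; exact: nbhs_infty_ger.
move=> _ h1.
have h2 : (fun n => \int[mu]_t (g t * \1_`[- n%:R, n%:R] t)) = (fun n => f n%:R - f (- n%:R)).
  by apply/funext => n; rewrite pf.2//; have := ler0n R n; lra.
rewrite h2 in h1.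
have h3 : (f n%:R - f (- n%:R)) @[n --> \oo] --> (0 - 0 : R).
  apply: cvgB.
    by apply: cvg_comp fp; exact: cvgr_idn.
  by apply: cvg_comp fm; apply/cvgNrNy; exact: cvgr_idn.
by have := cvg_unique _ h1 h3; rewrite subrr; apply.
Unshelve. all: by end_near. Qed.

End tails.

(** * Real form of the Fourier transform of integrable functions *)

Section transforms.
Context {R : realType}.
Local Notation mu := (@lebesgue_measure R).
Implicit Types (f g h : R -> R) (x y xi : R).

(* The Fourier transform of f is Ct f - i St f. *)
Definition Ct f xi := \int[mu]_x (f x * cos (x * xi)).
Definition St f xi := \int[mu]_x (f x * sin (x * xi)).

Lemma continuous_cosM xi : continuous (fun x : R => cos (x * xi)).
Proof.
move=> x; apply: (@continuous_comp _ _ _ (fun x => x * xi) cos); last exact: continuous_cos.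
by apply: cvgM; [exact: cvg_id|exact: cvg_cst].
Qed.

Lemma continuous_sinM xi : continuous (fun x : R => sin (x * xi)).
Proof.
move=> x; apply: (@continuous_comp _ _ _ (fun x => x * xi) sin); last exact: continuous_sin.
by apply: cvgM; [exact: cvg_id|exact: cvg_cst].
Qed.

Lemma measurable_cosM xi : measurable_fun [set: R] (fun x : R => cos (x * xi)).
Proof. by apply: measurable_of_continuous; exact: continuous_cosM. Qed.

Lemma measurable_sinM xi : measurable_fun [set: R] (fun x : R => sin (x * xi)).
Proof. by apply: measurable_of_continuous; exact: continuous_sinM. Qed.

Lemma L1_cos f xi : L1 f -> L1 (fun x => f x * cos (x * xi)).
Proof.
move=> f1; apply: (@L1_bddMr _ _ _ 1) => //; first exact: measurable_cosM.
by move=> x; exact: cos_max.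
Qed.

Lemma L1_sin f xi : L1 f -> L1 (fun x => f x * sin (x * xi)).
Proof.
move=> f1; apply: (@L1_bddMr _ _ _ 1) => //; first exact: measurable_sinM.
by move=> x; exact: sin_max.
Qed.

Lemma measurable_cos2 : measurable_fun [set: R * R] (fun z : R * R => cos (z.1 * z.2)).
Proof.
apply: (@measurableT_comp _ _ _ _ _ _ (@cos R)).
  by apply: measurable_of_continuous; exact: continuous_cos.
by apply: measurable_funM.
Qed.

Lemma measurable_sin2 : measurable_fun [set: R * R] (fun z : R * R => sin (z.1 * z.2)).
Proof.
apply: (@measurableT_comp _ _ _ _ _ _ (@sin R)).
  by apply: measurable_of_continuous; exact: continuous_sin.
by apply: measurable_funM.
Qed.

Lemma Ct_bounded f xi : L1 f -> `|Ct f xi| <= \int[mu]_x `|f x|.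
Proof.
move=> f1; apply: (le_trans (int_norm (L1_cos xi f1))).
apply: int_le; [exact/L1_norm/L1_cos|exact: L1_norm|].
by move=> x; rewrite normrM -[leRHS]mulr1 ler_wpM2l// cos_max.
Qed.

Lemma St_bounded f xi : L1 f -> `|St f xi| <= \int[mu]_x `|f x|.
Proof.
move=> f1; apply: (le_trans (int_norm (L1_sin xi f1))).
apply: int_le; [exact/L1_norm/L1_sin|exact: L1_norm|].
by move=> x; rewrite normrM -[leRHS]mulr1 ler_wpM2l// sin_max.
Qed.

Lemma int_Ct f g : L1 f -> L1 g ->
  \int[mu]_x (f x * Ct g x) = \int[mu]_x (Ct f x * g x).
Proof.
move=> f1 g1.
have := fubini_kernel f1 g1 measurable_cos2 (fun z => cos_max (z.1 * z.2)).
rewrite /=.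
rewrite (int_eq (g := fun x => f x * Ct g x)); last first.
  by move=> x; congr (_ * _); apply: int_eq => y; rewrite mulrC [y * x]mulrC mulrC.
by move=> ->; apply: int_eq => y; rewrite mulrC.
Qed.

Lemma int_St f g : L1 f -> L1 g ->
  \int[mu]_x (f x * St g x) = \int[mu]_x (St f x * g x).
Proof.
move=> f1 g1.
have := fubini_kernel f1 g1 measurable_sin2 (fun z => sin_max (z.1 * z.2)).
rewrite /=.
rewrite (int_eq (g := fun x => f x * St g x)); last first.
  by move=> x; congr (_ * _); apply: int_eq => y; rewrite mulrC [y * x]mulrC mulrC.
by move=> ->; apply: int_eq => y; rewrite mulrC.
Qed.

Lemma Ct_continuous f : L1 f -> continuous (Ct f).
Proof.
move=> f1 x.
have := @continuity_under_integral R _ (measurableTypeR R) mu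
  (fun xi y => f y * cos (y * xi)) setT measurableT (x - 1) (x + 1) _ _ (fun y => `|f y|).
move=> /(_ (fun xi _ => L1_cos xi f1)) h.
apply: h.
- apply: aeW => y _ z _; apply: cvgM; first exact: cvg_cst.
  by rewrite mulrC; under eq_fun do rewrite mulrC; exact: continuous_cosM.
- exact: L1_norm.
- move=> z _; apply: aeW => y _.
  by rewrite normrM -[leRHS]mulr1 ler_wpM2l// cos_max.
- by rewrite inE/= in_itv/=; apply/andP; split; lra.
Qed.

Lemma St_continuous f : L1 f -> continuous (St f).
Proof.
move=> f1 x.
have := @continuity_under_integral R _ (measurableTypeR R) mu
  (fun xi y => f y * sin (y * xi)) setT measurableT (x - 1) (x + 1) _ _ (fun y => `|f y|).
move=> /(_ (fun xi _ => L1_sin xi f1)) h.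
apply: h.
- apply: aeW => y _ z _; apply: cvgM; first exact: cvg_cst.
  by rewrite mulrC; under eq_fun do rewrite mulrC; exact: continuous_sinM.
- exact: L1_norm.
- move=> z _; apply: aeW => y _.
  by rewrite normrM -[leRHS]mulr1 ler_wpM2l// sin_max.
- by rewrite inE/= in_itv/=; apply/andP; split; lra.
Qed.

Lemma is_derive_cosM (a : R) x : is_derive x 1 (fun x : R => cos (a * x)) (- (a * sin (a * x))).
Proof.
have := @is_derive_comp_affine R a 0 cos (fun x => - sin x) (@is_derive_cos R) x.
by under eq_fun do rewrite addr0; rewrite addr0 mulrN.
Qed.

Lemma is_derive_sinM (a : R) x : is_derive x 1 (fun x : R => sin (a * x)) (a * cos (a * x)).
Proof.
have := @is_derive_comp_affine R a 0 sin cos (@is_derive_sin R) x.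
by under eq_fun do rewrite addr0; rewrite addr0.
Qed.

Lemma is_derive_int (F dF : R -> R -> R) (G : R -> R) :
  (forall x, L1 (F x)) -> L1 G ->
  (forall x y, is_derive x 1 (F ^~ y) (dF x y)) ->
  (forall x y, `|dF x y| <= G y) ->
  forall x, is_derive x 1 (fun x => \int[mu]_y F x y) (\int[mu]_y dF x y).
Proof.
move=> F1 G1 dFE FG x.
have G0 y : 0 <= G y by exact: le_trans (normr_ge0 _) (FG 0 y).
have xI : `]x - 1, x + 1[%classic x by rewrite /= in_itv/=; apply/andP; split; lra.
have dE y z : partial1of2 F y z = dF y z.
  by rewrite partial1of2E; have [_ ->] := dFE y z.
have dfI z y : `]x - 1, x + 1[%classic z -> [set: R] y -> derivable (F ^~ y) z 1.
  by move=> _ _; have [] := dFE z y.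
have ub z y : `]x - 1, x + 1[%classic z -> [set: R] y -> `|partial1of2 F z y| <= G y.
  by move=> _ _; rewrite dE.
have h1 := @derivable_under_integral R _ (measurableTypeR R) mu F setT measurableT x (x - 1) (x + 1)
  xI (fun x _ => F1 x) dfI G G0 G1 ub.
have h2 := @differentiation_under_integral R _ (measurableTypeR R) mu F setT measurableT x (x - 1) (x + 1)
  xI (fun x _ => F1 x) dfI G G0 G1 ub.
apply: DeriveDef => //.
rewrite -derive1E h2; apply: int_eq => y; exact: dE.
Qed.

Lemma is_derive_Ct f : L1 f -> L1 (fun x => x * f x) ->
  forall xi, is_derive xi 1 (Ct f) (- St (fun x => x * f x) xi).
Proof.
move=> f1 xf1 xi.
have := @is_derive_int (fun xi x => f x * cos (x * xi))
  (fun xi x => - (x * f x * sin (x * xi))) (fun x => `|x * f x|).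
rewrite /St -intN; last exact: L1_sin.
apply.
- by move=> x; exact: L1_cos.
- exact: L1_norm.
- move=> x y; have := is_deriveM_fun (is_derive_cst (f y) x 1) (is_derive_cosM y x).
  by rewrite mul0r add0r /cst; congr (is_derive _ _ _ _); ring.
- by move=> x y; rewrite normrN normrM -[leRHS]mulr1 ler_wpM2l// sin_max.
Qed.

Lemma is_derive_St f : L1 f -> L1 (fun x => x * f x) ->
  forall xi, is_derive xi 1 (St f) (Ct (fun x => x * f x) xi).
Proof.
move=> f1 xf1 xi.
have := @is_derive_int (fun xi x => f x * sin (x * xi))
  (fun xi x => x * f x * cos (x * xi)) (fun x => `|x * f x|).
apply.
- by move=> x; exact: L1_sin.
- exact: L1_norm.
- move=> x y; have := is_deriveM_fun (is_derive_cst (f y) x 1) (is_derive_sinM y x).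
  by rewrite mul0r add0r /cst; congr (is_derive _ _ _ _); ring.
- by move=> x y; rewrite normrM -[leRHS]mulr1 ler_wpM2l// cos_max.
Qed.

Lemma prim_cosM xi : prim (fun x => cos (x * xi)) (fun x => - (xi * sin (x * xi))).
Proof.
apply: derive_prim.
  move=> x; have := is_derive_cosM xi x.
  by under eq_fun do rewrite mulrC; rewrite [xi * x]mulrC.
move=> x; apply: cvgN; apply: cvgM; first exact: cvg_cst.
exact: continuous_sinM.
Qed.

Lemma prim_sinM xi : prim (fun x => sin (x * xi)) (fun x => xi * cos (x * xi)).
Proof.
apply: derive_prim.
  move=> x; have := is_derive_sinM xi x.
  by under eq_fun do rewrite mulrC; rewrite [xi * x]mulrC.
move=> x; apply: cvgM; first exact: cvg_cst.
exact: continuous_cosM.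
Qed.

Lemma Ct_prim f g xi : prim f g -> L1 f -> L1 g -> Ct g xi = xi * St f xi.
Proof.
move=> pf f1 g1.
have L : L1 (fun x => xi * (f x * sin (x * xi))) by apply: L1Z; exact: L1_sin.
have := prim_int0 (primM pf (prim_cosM xi)) (L1_cos xi f1).
rewrite (_ : (fun x => _ + _) = fun x => g x * cos (x * xi) - xi * (f x * sin (x * xi))); last first.
  by apply/funext => x; ring.
move=> /(_ (L1B (L1_cos xi g1) L)); rewrite intB//; last exact: L1_cos.
by rewrite intZ; [rewrite /Ct /St; lra|exact: L1_sin].
Qed.

Lemma St_prim f g xi : prim f g -> L1 f -> L1 g -> St g xi = - (xi * Ct f xi).
Proof.
move=> pf f1 g1.
have L : L1 (fun x => xi * (f x * cos (x * xi))) by apply: L1Z; exact: L1_cos.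
have := prim_int0 (primM pf (prim_sinM xi)) (L1_sin xi f1).
rewrite (_ : (fun x => _ + _) = fun x => g x * sin (x * xi) + xi * (f x * cos (x * xi))); last first.
  by apply/funext => x; ring.
move=> /(_ (L1D (L1_sin xi g1) L)); rewrite intD//; last exact: L1_sin.
by rewrite intZ; [rewrite /Ct /St; lra|exact: L1_cos].
Qed.

End transforms.

(** * Abel summation with the Poisson kernel: Bessel inequality and Fourier inversion *)

Section explicit_integrals.
Context {R : realType}.
Local Notation mu := (@lebesgue_measure R).
Implicit Types (f g : R -> R) (x t : R).

(** Evenness reduces the integral to x > 0. The primitive is required only there, and may ignore the
    absolute values in [f]. *)
Lemma even_integral f F (l : R) : (forall x, 0 <= f x) -> continuous f ->
  (forall x, f (- x) = f x) -> (forall x, 0 < x -> is_derive x 1 F (f x)) ->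
  {for 0, continuous F} -> F x @[x --> +oo] --> l ->
  L1 f /\ \int[mu]_x f x = 2 * (l - F 0).
Proof.
move=> f0 cf fN dF cF Fl.
have E : (\int[mu]_x (f x)%:E = (2 * (l - F 0))%:E)%E.
  rewrite ge0_symfun_integralT//; last by move=> x /=; rewrite fN.
  rewrite -set_itvcy (@ge0_continuous_FTC2y R f F 0 l)//.
  - exact: continuous_subspaceT.
  - by move=> x /dF [].
  - by apply: cvg_at_right_filter; exact: cF.
  - by move=> x; rewrite in_itv/= andbT => /dF[_ <-]; rewrite derive1E.
have f1 : L1 f.
  apply: L1P; first exact: measurable_of_continuous.
  have -> : (\int[mu]_x `|f x|%:E = \int[mu]_x (f x)%:E)%E.
    by apply: eq_integral => x _; rewrite ger0_norm.
  by rewrite E ltry.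
by split => //; apply: EFin_inj; rewrite -E L1_EFin.
Qed.

Lemma atan_scale_cvg (d : R) : 0 < d -> atan (d^-1 * x + 0) @[x --> +oo] --> (pi / 2 : R).
Proof.
move=> d0; apply: (@cvg_comp _ _ _ (fun x => d^-1 * x + 0) atan _ +oo); last exact: cvgy_atan.
apply/cvgryPge => A; near=> x.
rewrite addr0 ler_pdivlMl; last exact: d0.
by near: x; apply: nbhs_pinfty_ge; rewrite num_real.
Unshelve. all: by end_near. Qed.

(** The Poisson kernel of the half-plane at height d, times 2 pi; it is the cosine transform of
    exp(-d |x|). *)
Definition poisson (d t : R) : R := 2 * d / (d ^+ 2 + t ^+ 2).

Lemma poisson_den (d t : R) : 0 < d -> 0 < d ^+ 2 + t ^+ 2.
Proof. by move=> d0; rewrite ltr_pwDl ?exprn_gt0// sqr_ge0. Qed.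

Lemma poisson_ge0 (d t : R) : 0 < d -> 0 <= poisson d t.
Proof.
move=> d0; rewrite /poisson divr_ge0//; first by rewrite mulr_ge0// ltW.
exact/ltW/poisson_den.
Qed.

Lemma continuous_sqr : continuous (fun x : R => x ^+ 2).
Proof. by move=> x; apply: (@exprn_continuous R 2). Qed.

Lemma poisson_continuous (d : R) : 0 < d -> continuous (poisson d).
Proof.
move=> d0 t; apply: cvgM; first exact: cvg_cst.
apply: cvgV; first by rewrite gt_eqF// poisson_den.
by apply: cvgD; [exact: cvg_cst|exact: continuous_sqr].
Qed.

Lemma poisson_integral (d : R) : 0 < d ->
  L1 (poisson d) /\ \int[mu]_t poisson d t = 2 * pi.
Proof.
move=> d0.
have [||||||p1 p2] := @even_integral (poisson d) (fun x => 2 * atan (d^-1 * x + 0)) (2 * (pi / 2)).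
- by move=> x; exact: poisson_ge0.
- exact: poisson_continuous.
- by move=> x; rewrite /poisson sqrrN.
- move=> x _.
  have h := @is_derive_comp_affine R d^-1 0 atan _ (@is_derive1_atan R) x.
  have := is_deriveM_fun (is_derive_cst (2 : R) x 1) h.
  rewrite mul0r add0r /cst addr0; congr (is_derive _ _ _ _).
  have dn0 : d != 0 by rewrite gt_eqF.
  have Dn0 : d ^+ 2 + x ^+ 2 != 0 by rewrite gt_eqF// poisson_den.
  by rewrite /poisson; field; rewrite dn0 Dn0.
- apply: cvgM; first exact: cvg_cst.
  apply: (@continuous_comp _ _ _ (fun x => d^-1 * x + 0) atan); last exact: continuous_atan.
  by apply: cvgD; [apply: cvgM; [exact: cvg_cst|exact: cvg_id]|exact: cvg_cst].
- by apply: cvgM; [exact: cvg_cst|exact: atan_scale_cvg].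
split => //; rewrite p2 mulr0 addr0 atan0; by field.
Qed.

(** The Japanese bracket to the power -2, which measures the decay of transforms of test
    functions. *)
Definition japanese x : R := (1 + x ^+ 2)^-1.

Lemma japanese_gt0 x : 0 < japanese x.
Proof. by rewrite invr_gt0 ltr_pwDl// sqr_ge0. Qed.

Lemma japanese_le1 x : japanese x <= 1.
Proof. by rewrite invf_le1 ?lerDl ?sqr_ge0// ltr_pwDl// sqr_ge0. Qed.

Lemma japanese_continuous : continuous japanese.
Proof.
move=> t; apply: cvgV; first by rewrite gt_eqF// ltr_pwDl// sqr_ge0.
by apply: cvgD; [exact: cvg_cst|exact: continuous_sqr].
Qed.

Lemma L1_japanese : L1 japanese.
Proof.
have [+ _] := poisson_integral (@ltr01 R) => /(L1Z (2^-1)).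
suff -> : (fun x => 2^-1 * poisson 1 x) = japanese by [].
apply/funext => x; rewrite /poisson /japanese expr1n mulr1 mulrA mulVf ?mul1r//.
Qed.

Definition expw (d x : R) : R := expR (- (d * `|x|)).

Lemma expw_gt0 d x : 0 < expw d x. Proof. exact: expR_gt0. Qed.

Lemma expw_le1 d x : 0 <= d -> expw d x <= 1.
Proof. by move=> d0; rewrite expR_le1 oppr_le0 mulr_ge0. Qed.

Lemma expw_continuous d : continuous (expw d).
Proof.
move=> x; apply: (@continuous_comp _ _ _ (fun x => - (d * `|x|)) expR); last exact: continuous_expR.
by apply: cvgN; apply: cvgM; [exact: cvg_cst|exact: norm_continuous].
Qed.

Lemma expRN_cvg0 (d : R) : 0 < d -> expR (- d * x + 0) @[x --> +oo] --> (0 : R).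
Proof.
move=> d0; have -> : (fun x : R => expR (- d * x + 0)) = (fun x => expR (- (d * x))).
  by apply/funext => x; rewrite addr0 mulNr.
apply: (@cvg_comp _ _ _ (fun x => d * x) (fun y => expR (- y)) _ +oo); last exact: cvgr_expR.
apply/cvgryPge => A; near=> x.
rewrite -ler_pdivrMl; last exact: d0.
by near: x; apply: nbhs_pinfty_ge; rewrite num_real.
Unshelve. all: by end_near. Qed.

Lemma is_derive_expRN (d : R) x :
  is_derive x 1 (fun x => expR (- d * x + 0)) (- d * expR (- d * x + 0)).
Proof. exact: (is_derive_comp_affine (- d) 0 (@is_derive_expR R)). Qed.

Lemma continuous_expRN (d : R) : continuous (fun x => expR (- d * x + 0)).
Proof. exact: (is_derive_continuous (is_derive_expRN d)). Qed.

Lemma expw_integral (d : R) : 0 < d -> L1 (expw d) /\ \int[mu]_x expw d x = 2 / d.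
Proof.
move=> d0.
have dn0 : d != 0 by rewrite gt_eqF.
have [||||||p1 p2] := @even_integral (expw d) (fun x => - d^-1 * expR (- d * x + 0)) (- d^-1 * 0).
- by move=> x; exact/ltW/expw_gt0.
- exact: expw_continuous.
- by move=> x; rewrite /expw normrN.
- move=> x x0.
  have := is_deriveM_fun (is_derive_cst (- d^-1) x 1) (is_derive_expRN d x).
  rewrite mul0r add0r /cst; congr (is_derive _ _ _ _).
  by rewrite /expw (gtr0_norm x0) addr0 mulrA mulrNN mulVf// mul1r mulNr.
- by apply: cvgM; [exact: cvg_cst|exact: continuous_expRN].
- by apply: cvgM; [exact: cvg_cst|exact: expRN_cvg0].
by split => //; rewrite p2 !mulr0 addr0 expR0; field.
Qed.

(** The rule for even integrals asks for a nonnegative integrand, so 1 + cos replaces cos, and the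
    integral 2 / d of exp(-d |x|) is subtracted at the end. *)
Lemma expw_cos (d t : R) : 0 < d ->
  \int[mu]_x (expw d x * cos (x * t)) = poisson d t.
Proof.
move=> d0; have [w1 w2] := expw_integral d0.
have dn0 : d != 0 by rewrite gt_eqF.
have Dn0 : d ^+ 2 + t ^+ 2 != 0 by rewrite gt_eqF// poisson_den.
pose G x := - d * cos (t * x) + t * sin (t * x).
pose F x := expR (- d * x + 0) * (- d^-1 + (d ^+ 2 + t ^+ 2)^-1 * G x).
have dG x : is_derive x 1 G (- d * (- (t * sin (t * x))) + t * (t * cos (t * x))).
  apply: is_deriveD.
    by have := is_deriveM_fun (is_derive_cst (- d) x 1) (is_derive_cosM t x); rewrite mul0r add0r.
  by have := is_deriveM_fun (is_derive_cst t x 1) (is_derive_sinM t x); rewrite mul0r add0r.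
have dF x : is_derive x 1 F (expR (- d * x + 0) * (1 + cos (x * t))).
  have h := is_deriveM_fun (is_derive_cst ((d ^+ 2 + t ^+ 2)^-1) x 1) (dG x).
  have H : is_derive x 1 F (- d * expR (- d * x + 0) * (- d^-1 + (d ^+ 2 + t ^+ 2)^-1 * G x) +
      expR (- d * x + 0) * (0 + (0 * G x + (d ^+ 2 + t ^+ 2)^-1 *
        (- d * (- (t * sin (t * x))) + t * (t * cos (t * x)))))).
    exact: is_deriveM_fun (is_derive_expRN d x) (is_deriveD (is_derive_cst (- d^-1) x 1) h).
  apply: (@is_derive_eq _ _ _ F x 1 _ _ H); rewrite mul0r add0r add0r /G [x * t]mulrC; field.
  by rewrite dn0 Dn0.
have GB x : `|G x| <= d + `|t|.
  apply: (le_trans (ler_normD _ _)); apply: lerD.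
    by rewrite mulNr normrN normrM (gtr0_norm d0) -[leRHS]mulr1 ler_wpM2l ?cos_max// ltW.
  by rewrite normrM -[leRHS]mulr1 ler_wpM2l ?sin_max.
have [||||||p1 p2] := @even_integral (fun x => expw d x * (1 + cos (x * t))) F 0.
- move=> x; apply: mulr_ge0; first exact/ltW/expw_gt0.
  by have := cos_geN1 (x * t); lra.
- move=> x; apply: cvgM; first exact: expw_continuous.
  by apply: cvgD; [exact: cvg_cst|exact: continuous_cosM].
- by move=> x; rewrite /expw normrN mulNr cosN.
- move=> x x0; have := dF x; congr (is_derive _ _ _ _).
  by rewrite /expw (gtr0_norm x0) addr0 mulNr.
- exact: (is_derive_continuous dF).
- have hB x : `|F x| <= expR (- d * x + 0) * (d^-1 + (d ^+ 2 + t ^+ 2)^-1 * (d + `|t|)).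
    rewrite normrM (ger0_norm (expR_ge0 _)) ler_wpM2l ?expR_ge0//.
    apply: (le_trans (ler_normD _ _)); rewrite normrN gtr0_norm ?invr_gt0// lerD2l.
    have D0 : 0 < (d ^+ 2 + t ^+ 2)^-1 by rewrite invr_gt0 poisson_den.
    by rewrite normrM (gtr0_norm D0) ler_wpM2l// ltW.
  apply/norm_cvg0P.
  apply: (@squeeze_cvgr _ _ _ _ (fun=> 0) (fun x => expR (- d * x + 0) * (d^-1 + (d ^+ 2 + t ^+ 2)^-1 * (d + `|t|)))).
  + by apply: nearW => x; rewrite normr_ge0 hB.
  + exact: cvg_cst.
  + rewrite [X in _ --> X](_ : 0 = 0 * (d^-1 + (d ^+ 2 + t ^+ 2)^-1 * (d + `|t|))); last by rewrite mul0r.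
    by apply: cvgM; [exact: expRN_cvg0|exact: cvg_cst].
rewrite (int_eq (g := fun x => expw d x * (1 + cos (x * t)) - expw d x)); last by move=> x; ring.
rewrite intB// p2 w2 /F /G !mulr0 addr0 expR0 cos0 sin0 /poisson; field.
by rewrite dn0 Dn0.
Qed.

(** Fubini with the kernel cos(x (t - s)): the Abel means of the inversion integral are a
    convolution with the Poisson kernel. *)
Lemma poisson_kernel (d s : R) G : 0 < d -> L1 G ->
  \int[mu]_x (expw d x * (Ct G x * cos (x * s) + St G x * sin (x * s))) =
  \int[mu]_t (G t * poisson d (t - s)).
Proof.
move=> d0 G1; have [w1 w2] := expw_integral d0.
pose k (z : R * R) : R := cos (z.1 * (z.2 - s)).
have mk : measurable_fun [set: R * R] k.
  apply: (@measurableT_comp _ _ _ _ _ _ (@cos R)).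
    by apply: measurable_of_continuous; exact: continuous_cos.
  by apply: measurable_funM => //; exact: measurable_funB.
have := fubini_kernel w1 G1 mk (fun z => cos_max _); rewrite /k /=.
rewrite (int_eq (g := fun x => expw d x * (Ct G x * cos (x * s) + St G x * sin (x * s)))); last first.
  move=> x; congr (_ * _); rewrite /Ct /St -![_ * cos (x * s)]mulrC -![_ * sin (x * s)]mulrC.
  rewrite -!intZ; [|exact: L1_sin|exact: L1_cos].
  rewrite -intD; [|exact/L1Z/L1_cos|exact/L1Z/L1_sin].
  by apply: int_eq => t; rewrite mulrBr cosB [x * t]mulrC; ring.
move=> ->; apply: int_eq => t; congr (_ * _).
exact: expw_cos.
Qed.

Definition expwn (n : nat) : R -> R := expw n.+1%:R^-1.

Lemma expwn_cvg x : expwn n x @[n --> \oo] --> (1 : R).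
Proof.
rewrite /expwn /expw -[X in _ --> X](@expR0 R) -[0 in X in _ --> expR X]oppr0 -[0 in X in _ --> X](mul0r `|x|).
apply: (@cvg_comp _ _ _ (fun n => - (n.+1%:R^-1 * `|x|)) expR _ (nbhs (- (0 * `|x|)))); last exact: continuous_expR.
by apply: cvgN; apply: cvgM; [exact: cvg_harmonic|exact: cvg_cst].
Qed.

Lemma expwn_nd x : nondecreasing_seq (expwn ^~ x).
Proof.
move=> m n mn; rewrite ler_expR lerN2 ler_wpM2r// lef_pV2 ?posrE ?ltr0n//.
by rewrite ler_nat.
Qed.

(** The product |G(s) G(t)| is at most (G(s)^2 + G(t)^2) / 2, and each square is integrated first in
    the variable that it does not contain. *)
Lemma schur_test (k : R * R -> R) (K : R) (G : R -> R) :
  measurable_fun [set: R * R] k -> (forall z, 0 <= k z) ->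
  (forall s, (\int[mu]_t (k (s, t))%:E = K%:E)%E) ->
  (forall t, (\int[mu]_s (k (s, t))%:E = K%:E)%E) ->
  measurable_fun [set: R] G -> L1 (fun x => G x ^+ 2) ->
  (\int[mu]_s \int[mu]_t (`|G s| * `|G t| * k (s, t))%:E <=
   (K * \int[mu]_x (G x ^+ 2))%:E)%E.
Proof.
move=> mk k0 k1 k2 mG G2.
have mG2 : measurable_fun [set: R] (fun x => G x ^+ 2) by exact: L1_measurable.
pose h1 (z : R * R) : R := 2^-1 * (G z.1 ^+ 2) * k z.
pose h2 (z : R * R) : R := 2^-1 * (G z.2 ^+ 2) * k z.
have mh1 : measurable_fun [set: R * R] h1.
  apply: measurable_funM => //; apply: measurable_funM => //.
  exact: (measurable_fst_comp mG2).
have mh2 : measurable_fun [set: R * R] h2.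
  apply: measurable_funM => //; apply: measurable_funM => //.
  exact: (measurable_snd_comp mG2).
have mabs : measurable_fun [set: R * R] (fun z => `|G z.1| * `|G z.2| * k z).
  apply: measurable_funM => //; apply: measurable_funM.
    by apply: measurableT_comp => //; exact: (measurable_fst_comp mG).
  by apply: measurableT_comp => //; exact: (measurable_snd_comp mG).
have h10 z : 0 <= h1 z by rewrite mulr_ge0// mulr_ge0 ?sqr_ge0// invr_ge0.
have h20 z : 0 <= h2 z by rewrite mulr_ge0// mulr_ge0 ?sqr_ge0// invr_ge0.
have mF (h : R * R -> R) : measurable_fun [set: R * R] h -> (forall z, 0 <= h z) ->
    measurable_fun [set: R] (fun s => \int[mu]_t (h (s, t))%:E)%E.
  move=> mh h0; apply: (@measurable_fun_fubini_tonelli_F _ _ (measurableTypeR R)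
        (measurableTypeR R) R mu (EFin \o h)) => //.
  exact/measurable_EFinP.
have int_half : (\int[mu]_x (2^-1 * G x ^+ 2 * K)%:E = (2^-1 * K * \int[mu]_x (G x ^+ 2))%:E)%E.
  rewrite L1_EFin; last by apply: L1Zr; exact: L1Z.
  congr EFin; rewrite (int_eq (g := fun x => (2^-1 * K) * G x ^+ 2)); last by move=> x; ring.
  exact: intZ.
have E1 s : (\int[mu]_t (h1 (s, t))%:E = (2^-1 * G s ^+ 2 * K)%:E)%E.
  rewrite /h1 /=; under eq_integral do rewrite EFinM.
  rewrite ge0_integralZl_EFin ?k1//.
  - by move=> t _; rewrite lee_fin.
  - by apply/measurable_EFinP; exact: (measurable_fun_pair2 s mk).
  - by rewrite mulr_ge0 ?sqr_ge0// invr_ge0.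
have E2 t : (\int[mu]_s (h2 (s, t))%:E = (2^-1 * G t ^+ 2 * K)%:E)%E.
  rewrite /h2 /=; under eq_integral do rewrite EFinM.
  rewrite ge0_integralZl_EFin ?k2//.
  - by move=> s _; rewrite lee_fin.
  - by apply/measurable_EFinP; exact: (measurable_fun_pair1 t mk).
  - by rewrite mulr_ge0 ?sqr_ge0// invr_ge0.
apply: (@le_trans _ _ (\int[mu]_s (\int[mu]_t (h1 (s, t))%:E + \int[mu]_t (h2 (s, t))%:E))%E).
  apply: ge0_le_integral => //.
  - by move=> s _; apply: integral_ge0 => t _; rewrite lee_fin !mulr_ge0.
  - by apply: (mF (fun z => `|G z.1| * `|G z.2| * k z)) => // z; rewrite !mulr_ge0.
  - by apply: emeasurable_funD; exact: mF.
  - move=> s _; rewrite -ge0_integralD//.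
    + apply: ge0_le_integral => //.
      * by move=> t _; rewrite lee_fin !mulr_ge0.
      * by apply/measurable_EFinP; exact: (measurable_fun_pair2 s mabs).
      * by apply: emeasurable_funD; apply/measurable_EFinP; [exact: (measurable_fun_pair2 s mh1)|exact: (measurable_fun_pair2 s mh2)].
      * move=> t _; rewrite -EFinD lee_fin /h1 /h2 /= -mulrDl ler_wpM2r//.
        have := sqr_ge0 (`|G s| - `|G t|); rewrite sqrrB !real_normK ?num_real//.
        by set a := `|G s| * `|G t|; rewrite -mulr_natl; lra.
    + by move=> t _; rewrite lee_fin.
    + by apply/measurable_EFinP; exact: (measurable_fun_pair2 s mh1).
    + by move=> t _; rewrite lee_fin.
    + by apply/measurable_EFinP; exact: (measurable_fun_pair2 s mh2).
rewrite ge0_integralD//; last 4 first.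
- by move=> s _; apply: integral_ge0 => t _; rewrite lee_fin.
- exact: mF.
- by move=> s _; apply: integral_ge0 => t _; rewrite lee_fin.
- exact: mF.
rewrite (tonelli mh2)//.
under eq_integral do rewrite E1.
under [X in (_ + X)%E]eq_integral do rewrite E2.
rewrite int_half -EFinD lee_fin le_eqVlt; apply/orP; left; apply/eqP.
set J := \int[mu]_x _.
by field.
Qed.

Lemma poisson_shift (d s : R) : 0 < d ->
  (\int[mu]_t (poisson d (t - s))%:E = (2 * pi)%:E)%E /\
  (\int[mu]_t (poisson d (s - t))%:E = (2 * pi)%:E)%E.
Proof.
move=> d0; have [p1 p2] := poisson_integral d0.
have mp : measurable_fun [set: R] (poisson d) by exact: L1_measurable.
have h : (\int[mu]_t (poisson d (t - s))%:E = (2 * pi)%:E)%E.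
  by rewrite (ge0_integral_shift (- s) mp)// ?L1_EFin ?p2// => x; exact: poisson_ge0.
split => //; rewrite -h; apply: eq_integral => t _.
by rewrite -opprB /poisson sqrrN.
Qed.

(** A factor exp(-d |x|) makes all integrals absolutely convergent. Transposing the transforms turns
    the weighted norm into the quadratic form of the Poisson kernel, which the Schur test bounds by
    2 pi times the squared norm of [G]. Monotone convergence removes the factor, with no density
    argument. *)
Lemma bessel G : L1 G -> L1 (fun x => G x ^+ 2) ->
  L1 (fun x => Ct G x ^+ 2) /\ L1 (fun x => St G x ^+ 2).
Proof.
move=> G1 G2; have mG := L1_measurable G1.
have cC := Ct_continuous G1; have cS := St_continuous G1.
have mC : measurable_fun [set: R] (Ct G) by exact: measurable_of_continuous.
have mS : measurable_fun [set: R] (St G) by exact: measurable_of_continuous.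
suff h : L1 (fun x => Ct G x ^+ 2 + St G x ^+ 2).
  split; apply: (L1_leP _ h).
  - exact: measurable_funX.
  - by move=> x; rewrite ger0_norm ?sqr_ge0// lerDl sqr_ge0.
  - exact: measurable_funX.
  - by move=> x; rewrite ger0_norm ?sqr_ge0// lerDr sqr_ge0.
pose B := \int[mu]_x `|G x|.
have CB x : `|Ct G x| <= B by exact: Ct_bounded.
have SB x : `|St G x| <= B by exact: St_bounded.
have wL n : L1 (expwn n).
  by have [] := @expw_integral n.+1%:R^-1; rewrite ?invr_gt0.
have wC n : L1 (fun x => expwn n x * Ct G x) by exact: (L1_bddMr mC (wL n) CB).
have wS n : L1 (fun x => expwn n x * St G x) by exact: (L1_bddMr mS (wL n) SB).
have wCC n : L1 (fun x => expwn n x * Ct G x * Ct G x) by exact: (L1_bddMr mC (wC n) CB).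
have wSS n : L1 (fun x => expwn n x * St G x * St G x) by exact: (L1_bddMr mS (wS n) SB).
apply: (@int_mono R (fun n x => expwn n x * (Ct G x ^+ 2 + St G x ^+ 2)) _ (2 * pi * \int[mu]_x (G x ^+ 2))).
- move=> n; have := L1D (wCC n) (wSS n).
  by congr L1; apply/funext => x; ring.
- by apply: measurable_funD; exact: measurable_funX.
- by move=> n x; rewrite mulr_ge0 ?addr_ge0 ?sqr_ge0// ltW// expw_gt0.
- by move=> x m n mn; rewrite ler_wpM2r ?addr_ge0 ?sqr_ge0// expwn_nd.
- move=> x; rewrite -[X in _ --> X]mul1r.
  by apply: cvgM; [exact: expwn_cvg|exact: cvg_cst].
move=> n; have d0 : 0 < n.+1%:R^-1 :> R by rewrite invr_gt0.
rewrite (int_eq (g := fun x => expwn n x * Ct G x * Ct G x + expwn n x * St G x * St G x)); last by move=> x; ring.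
rewrite intD// int_Ct// int_St//.
rewrite -intD; last 2 first.
- apply: (L1_bddM _ G1); first by apply: measurable_of_continuous; exact: Ct_continuous.
  by move=> x; exact: Ct_bounded.
- apply: (L1_bddM _ G1); first by apply: measurable_of_continuous; exact: St_continuous.
  by move=> x; exact: St_bounded.
pose H s := Ct (fun x => expwn n x * Ct G x) s + St (fun x => expwn n x * St G x) s.
have HE s : H s = \int[mu]_t (G t * poisson n.+1%:R^-1 (t - s)).
  rewrite -poisson_kernel// /H /Ct /St -intD; [|exact: L1_cos|exact: L1_sin].
  by apply: int_eq => x; rewrite /expwn; ring.
have HG : L1 (fun x => H x * G x).
  apply: (L1_bddM _ G1); first apply: measurable_of_continuous.
    by move=> x; apply: cvgD; [exact: Ct_continuous|exact: St_continuous].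
  by move=> x; apply: (le_trans (ler_normD _ _)); apply: lerD; [exact: Ct_bounded|exact: St_bounded].
rewrite (int_eq (g := fun x => H x * G x)); last by move=> x; rewrite mulrDl.
apply: (le_trans (ler_norm _)); apply: (le_trans (int_norm HG)).
rewrite -lee_fin -L1_EFin; last exact: L1_norm.
pose k (z : R * R) := poisson n.+1%:R^-1 (z.2 - z.1).
have mp : measurable_fun [set: R] (poisson n.+1%:R^-1).
  by apply: measurable_of_continuous; exact: poisson_continuous.
have mk : measurable_fun [set: R * R] k.
  by apply: (measurableT_comp mp); exact: measurable_funB.
have k0 z : 0 <= k z by exact: poisson_ge0.
apply: le_trans (schur_test mk k0 _ _ mG G2); last 2 first.
- by move=> s; exact: (poisson_shift s d0).1.
- by move=> s; exact: (poisson_shift s d0).2.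
apply: ge0_le_integral => //.
- by apply: L1_EFin_measurable; exact: L1_norm.
- have mabs : measurable_fun [set: R * R] (fun z => `|G z.1| * `|G z.2| * k z).
    apply: measurable_funM => //; apply: measurable_funM.
      by apply: measurableT_comp => //; exact: (measurable_fst_comp mG).
    by apply: measurableT_comp => //; exact: (measurable_snd_comp mG).
  apply: (@measurable_fun_fubini_tonelli_F _ _ (measurableTypeR R)
        (measurableTypeR R) R mu (fun z => (`|G z.1| * `|G z.2| * k z)%:E)) => //.
    exact/measurable_EFinP.
  move=> z; rewrite lee_fin; apply: mulr_ge0; last exact: k0.
  exact: mulr_ge0.
move=> s _.
have [p1 p2] := poisson_integral d0.
have pB t : `|poisson n.+1%:R^-1 t| <= 2 / n.+1%:R^-1.
  rewrite ger0_norm ?poisson_ge0// /poisson ler_pdivrMr ?poisson_den//.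
  rewrite mulrDr -[leLHS]addr0; apply: lerD.
    by rewrite le_eqVlt; apply/orP; left; apply/eqP; field; rewrite gt_eqF ?ltr0n// gt_eqF.
  by rewrite mulr_ge0 ?sqr_ge0// divr_ge0// ltW.
have Gp : L1 (fun t => G t * poisson n.+1%:R^-1 (t - s)).
  apply: (L1_bddMr _ G1) (fun t => pB (t - s)).
  by apply: (measurableT_comp mp); exact: measurable_funB.
under eq_integral do rewrite -mulrA EFinM.
rewrite ge0_integralZl_EFin//; last 2 first.
- by move=> t _; rewrite lee_fin mulr_ge0.
- apply/measurable_EFinP; apply: measurable_funM; first exact: measurableT_comp.
  exact: (measurable_fun_pair2 s mk).
rewrite normrM mulrC EFinM lee_wpmul2l// HE.
have E t : `|G t| * k (s, t) = `|G t * poisson n.+1%:R^-1 (t - s)|.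
  by rewrite normrM /k /= [`|poisson _ _|]ger0_norm// poisson_ge0.
under eq_integral do rewrite E.
rewrite L1_EFin; last exact: L1_norm.
by rewrite lee_fin; exact: int_norm.
Qed.

(** Each Abel mean of the inversion integral is 2 pi psi(s) plus the integral of psi(t) - psi(s)
    against the Poisson kernel. The Lipschitz bound near s and the uniform bound far from s dominate
    that integrand independently of n. *)
Lemma fourier_inversion psi (L M : R) : L1 psi -> L1 (Ct psi) -> L1 (St psi) ->
  (forall s t, `|psi t - psi s| <= L * `|t - s|) -> (forall t, `|psi t| <= M) ->
  forall s, Ct (Ct psi) s + St (St psi) s = 2 * pi * psi s.
Proof.
move=> p1 C1 S1 hL hM s; have mp := L1_measurable p1.
have L0 : 0 <= L by have := le_trans (normr_ge0 _) (hL 0 1); rewrite subr0 normr1 mulr1.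
have M0 : 0 <= M by exact: le_trans (normr_ge0 _) (hM 0).
pose D x := Ct psi x * cos (x * s) + St psi x * sin (x * s).
have D1 : L1 D by apply: L1D; [exact: L1_cos|exact: L1_sin].
rewrite /Ct /St -intD; [|exact: L1_cos|exact: L1_sin].
rewrite -/(Ct psi) -/(St psi).
pose P n := poisson n.+1%:R^-1.
have d0 n : 0 < n.+1%:R^-1 :> R by rewrite invr_gt0.
have h1 : \int[mu]_x (expwn n x * D x) @[n --> \oo] --> \int[mu]_x D x.
  apply: (@dct R _ _ (fun x => `|D x|) _ _ _ _ _).2.
  - move=> n; apply: measurable_funM; last exact: L1_measurable.
    by apply: measurable_of_continuous; exact: expw_continuous.
  - exact: L1_measurable.
  - exact: L1_norm.
  - move=> n x; rewrite normrM -[leRHS]mul1r ler_wpM2r// ger0_norm; last exact/ltW/expw_gt0.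
    exact/expw_le1/ltW.
  - move=> x; rewrite -[X in _ --> X]mul1r.
    by apply: cvgM; [exact: expwn_cvg|exact: cvg_cst].
have PL n : L1 (fun t => P n (t - s)).
  apply: L1P.
    apply: measurable_of_continuous => t; apply: (@continuous_comp _ _ _ (fun t => t - s) (P n)).
      by apply: cvgB; [exact: cvg_id|exact: cvg_cst].
    exact: poisson_continuous.
  have -> : (\int[mu]_t `|P n (t - s)|%:E = \int[mu]_t (P n (t - s))%:E)%E.
    by apply: eq_integral => t _; rewrite ger0_norm// poisson_ge0.
  by rewrite (poisson_shift s (d0 n)).1 ltry.
have PI n : \int[mu]_t P n (t - s) = 2 * pi.
  by apply: EFin_inj; rewrite -L1_EFin// (poisson_shift s (d0 n)).1.
pose J x := japanese (x - s).
have J1 : L1 J.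
  apply: L1P.
    apply: measurable_of_continuous => t; apply: (@continuous_comp _ _ _ (fun t => t - s) japanese).
      by apply: cvgB; [exact: cvg_id|exact: cvg_cst].
    exact: japanese_continuous.
  have -> : (\int[mu]_t `|J t|%:E = \int[mu]_t (japanese (t - s))%:E)%E.
    by apply: eq_integral => t _; rewrite ger0_norm// ltW// japanese_gt0.
  rewrite (ge0_integral_shift (- s) (L1_measurable L1_japanese)).
    by rewrite L1_EFin ?ltry//; exact: L1_japanese.
  by move=> x; exact/ltW/japanese_gt0.
(* Put a = |t - s| and d <= 1. If a <= 1, then 2 a d <= a^2 + d^2 bounds the product by L, and 1 +
   a^2 <= 2 gives 2 L. If a > 1, the numerator is at most 4 M, and 1 + a^2 <= 2 a^2 gives 8 M. *)
have Pbound n t : `|(psi t - psi s) * P n (t - s)| <= (2 * L + 8 * M) * J t.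
  rewrite normrM (ger0_norm (poisson_ge0 _ (d0 n))).
  have dle1 : n.+1%:R^-1 <= 1 :> R by rewrite invf_le1 ?ler1n.
  move: (d0 n) dle1; rewrite /P; set d : R := n.+1%:R^-1 => dd dle1.
  have hLt := hL s t.
  have hMt : `|psi t - psi s| <= 2 * M.
    by apply: (le_trans (ler_normB _ _)); have := hM t; have := hM s; lra.
  rewrite /J /japanese; set u := t - s in hLt *.
  have u2 : `|u| ^+ 2 = u ^+ 2 by rewrite real_normK// num_real.
  have D0 := poisson_den u dd.
  rewrite /poisson mulrA ler_pdivrMr// [X in _ <= X]mulrAC ler_pdivlMr; last by rewrite ltr_pwDl// sqr_ge0.
  rewrite -u2; move: (normr_ge0 u) (normr_ge0 (psi t - psi s)) hLt hMt; set a := `|u|; set b := `|_ - _|.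
  move=> a0 b0 hLt hMt.
  have [a1|a1] := leP a 1.
    have q1 : b * (2 * d) <= L * (d ^+ 2 + a ^+ 2).
      apply: (@le_trans _ _ (L * a * (2 * d))); first by rewrite ler_wpM2r// mulr_ge0// ltW.
      by rewrite -mulrA ler_wpM2l//; have := sqr_ge0 (d - a); nra.
    apply: (@le_trans _ _ (L * (d ^+ 2 + a ^+ 2) * (1 + a ^+ 2))).
      by rewrite ler_wpM2r// addr_ge0// sqr_ge0.
    have e0 : 0 <= L * (d ^+ 2 + a ^+ 2) by rewrite mulr_ge0// addr_ge0 ?sqr_ge0.
    apply: (@le_trans _ _ (L * (d ^+ 2 + a ^+ 2) * 2)).
      by rewrite ler_wpM2l//; have := exprn_ile1 2 a0 a1; lra.
    have e1 : 0 <= M * (d ^+ 2 + a ^+ 2) by rewrite mulr_ge0// addr_ge0 ?sqr_ge0.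
    by lra.
  have aa : 1 <= a ^+ 2 by rewrite exprn_ege1// ltW.
  have q1 : b * (2 * d) <= 4 * M.
    apply: (@le_trans _ _ (2 * M * (2 * d))); first by rewrite ler_wpM2r// mulr_ge0// ltW.
    by nra.
  apply: (@le_trans _ _ (4 * M * (1 + a ^+ 2))).
    by rewrite ler_wpM2r// addr_ge0// sqr_ge0.
  apply: (@le_trans _ _ (8 * M * (d ^+ 2 + a ^+ 2))).
    have d2 := sqr_ge0 d; nra.
  by rewrite ler_wpM2r ?addr_ge0 ?sqr_ge0// lerDr mulr_ge0.
have h2 : \int[mu]_t ((psi t - psi s) * P n (t - s)) @[n --> \oo] --> (0 : R).
  rewrite -[X in _ --> X](@int0 R).
  apply: (@dct R _ _ (fun t => (2 * L + 8 * M) * J t) _ _ _ Pbound _).2.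
  - move=> n; apply: measurable_funM; last exact: L1_measurable.
    by apply: measurable_funB => //.
  - exact: measurable_cst.
  - exact: L1Z.
  - move=> t; have [->|ts] := eqVneq t s.
      by under eq_fun do rewrite subrr mul0r; exact: cvg_cst.
    rewrite -[X in _ --> X](mulr0 (psi t - psi s)); apply: cvgM; first exact: cvg_cst.
    have u0 : 0 < (t - s) ^+ 2 by rewrite lt_neqAle sqr_ge0 eq_sym sqrf_eq0 subr_eq0 ts.
    apply: (@squeeze_cvgr _ _ _ _ (fun=> 0) (fun n => 2 / (t - s) ^+ 2 * n.+1%:R^-1)).
    + apply: nearW => n; rewrite poisson_ge0//= /P /poisson ler_pdivrMr ?poisson_den//.
      have dd := d0 n; move: dd; set d : R := n.+1%:R^-1 => dd.
      rewrite mulrDr -[leLHS]add0r; apply: lerD.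
        by rewrite !mulr_ge0// ?sqr_ge0 ?invr_ge0// ltW.
      by rewrite le_eqVlt; apply/orP; left; apply/eqP; field; rewrite subr_eq0.
    + exact: cvg_cst.
    + rewrite -[X in _ --> X](mulr0 (2 / (t - s) ^+ 2)); apply: cvgM; first exact: cvg_cst.
      exact: cvg_harmonic.
have h3 n : \int[mu]_x (expwn n x * D x) =
    \int[mu]_t ((psi t - psi s) * P n (t - s)) + 2 * pi * psi s.
  rewrite /D poisson_kernel//.
  have I1 : L1 (fun t => psi t * P n (t - s)) by exact: (L1_bddM mp (PL n) hM).
  rewrite [X in _ = X + _](int_eq (g := fun t => psi t * P n (t - s) - psi s * P n (t - s))); last by move=> t; ring.
  rewrite intB//; last exact: L1Z.
  by rewrite intZ// PI; ring.
have h4 : \int[mu]_x (expwn n x * D x) @[n --> \oo] --> 0 + 2 * pi * psi s.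
  by under eq_fun do rewrite h3; apply: cvgD => //; exact: cvg_cst.
by have := cvg_unique _ h1 h4; rewrite add0r; apply.
Qed.

End explicit_integrals.

(** * Transforms of tempered functions *)

Section transforms_of_test_functions.
Context {R : realType}.
Local Notation mu := (@lebesgue_measure R).
Implicit Types (f g psi phi theta : R -> R) (x xi : R).

Lemma testfun_prim phi : testfun phi -> prim phi phi^`()%classic.
Proof.
move=> tp; apply: derive_prim; first by move=> x; exact: testfun_is_derive.
exact/testfun_continuous/testfun_derive.
Qed.

Lemma testfun_Xmul phi : testfun phi -> testfun (fun x => x * phi x).
Proof. by move=> tp; apply: testfunM tp; exact: smooth_id. Qed.

Lemma testfunN phi : testfun phi -> testfun (fun x => - phi x).
Proof. by move=> tp; under eq_fun do rewrite -mulN1r; exact: testfunZ. Qed.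

Lemma testfun0 : testfun (fun _ : R => 0 : R).
Proof. by split; [exact: smooth_cst|exists 0]. Qed.

Lemma CtZ (k : R) f xi : L1 f -> Ct (fun x => k * f x) xi = k * Ct f xi.
Proof.
move=> f1; rewrite /Ct -intZ; last exact: L1_cos.
by apply: int_eq => x; rewrite mulrA.
Qed.

Lemma StZ (k : R) f xi : L1 f -> St (fun x => k * f x) xi = k * St f xi.
Proof.
move=> f1; rewrite /St -intZ; last exact: L1_sin.
by apply: int_eq => x; rewrite mulrA.
Qed.

Lemma CtN f xi : L1 f -> Ct (fun x => - f x) xi = - Ct f xi.
Proof.
move=> f1; rewrite -mulN1r -CtZ//; apply: int_eq => x; by rewrite mulN1r.
Qed.

Lemma StN f xi : L1 f -> St (fun x => - f x) xi = - St f xi.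
Proof.
move=> f1; rewrite -mulN1r -StZ//; apply: int_eq => x; by rewrite mulN1r.
Qed.

Lemma Ct_opp f xi : L1 f -> Ct (fun x => f (- x)) xi = Ct f xi.
Proof.
move=> f1; rewrite /Ct -(int_opp (L1_cos xi f1)); apply: int_eq => x.
by rewrite mulNr cosN.
Qed.

Lemma St_opp f xi : L1 f -> St (fun x => f (- x)) xi = - St f xi.
Proof.
move=> f1; rewrite /St -intN; last exact: L1_sin.
rewrite -(int_opp (L1N (L1_sin xi f1))); apply: int_eq => x.
by rewrite mulNr sinN; ring.
Qed.

Definition ctst theta1 theta2 : R -> R := fun x => Ct theta1 x + St theta2 x.

(** Differentiation and multiplication by the variable act on [theta1] and [theta2] as
    multiplication and differentiation. The class is therefore stable under both, and consists of
    functions with rapid decay. *)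
Definition transfun f := exists theta1 theta2,
  [/\ testfun theta1, testfun theta2 & f = ctst theta1 theta2].

Lemma transfun_Ct theta : testfun theta -> transfun (Ct theta).
Proof.
move=> t; exists theta, (fun=> 0); split => //; first exact: testfun0.
apply/funext => x; rewrite /ctst /St; under [X in _ + X]eq_Rintegral do rewrite mul0r.
by rewrite int0 addr0.
Qed.

Lemma transfun_St theta : testfun theta -> transfun (St theta).
Proof.
move=> t; exists (fun=> 0), theta; split => //; first exact: testfun0.
apply/funext => x; rewrite /ctst /Ct; under [X in X + _]eq_Rintegral do rewrite mul0r.
by rewrite int0 add0r.
Qed.

Lemma transfun_derive f : transfun f -> exists f', (forall x, is_derive x 1 f (f' x)) /\ transfun f'.
Proof.
move=> [t1 [t2 [h1 h2 ->]]].
exists (ctst (fun x => x * t2 x) (fun x => - (x * t1 x))); split; last first.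
  exists (fun x => x * t2 x), (fun x => - (x * t1 x)); split => //.
    exact: testfun_Xmul.
  by apply: testfunN; exact: testfun_Xmul.
move=> x; have H := is_deriveD
  (is_derive_Ct (testfun_L1 h1) (testfun_L1 (testfun_Xmul h1)) x)
  (is_derive_St (testfun_L1 h2) (testfun_L1 (testfun_Xmul h2)) x).
apply: (is_derive_eq H); rewrite /ctst StN; first by rewrite addrC.
exact/testfun_L1/testfun_Xmul.
Qed.

Lemma transfun_smooth f : transfun f -> smooth f.
Proof. by apply: smooth_ind; exact: transfun_derive. Qed.

Lemma transfun_derive1 f : transfun f -> transfun f^`()%classic.
Proof. by move=> /transfun_derive[f' [/is_derive_derive1 -> ]]. Qed.

Lemma Ct_derive theta xi : testfun theta -> Ct theta^`()%classic xi = xi * St theta xi.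
Proof.
move=> t; apply: Ct_prim; [exact: testfun_prim|exact: testfun_L1|].
exact/testfun_L1/testfun_derive.
Qed.

Lemma St_derive theta xi : testfun theta -> St theta^`()%classic xi = - (xi * Ct theta xi).
Proof.
move=> t; apply: St_prim; [exact: testfun_prim|exact: testfun_L1|].
exact/testfun_L1/testfun_derive.
Qed.

Lemma transfun_Xmul f : transfun f -> transfun (fun x => x * f x).
Proof.
move=> [t1 [t2 [h1 h2 ->]]].
exists t2^`()%classic, (fun x => - t1^`()%classic x); split.
- exact: testfun_derive.
- by apply: testfunN; exact: testfun_derive.
apply/funext => x; rewrite /ctst Ct_derive// StN ?St_derive//; first by ring.
exact/testfun_L1/testfun_derive.
Qed.

Lemma transfun_bounded f : transfun f -> exists C, forall x, `|f x| <= C.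
Proof.
move=> [t1 [t2 [h1 h2 ->]]]; exists (\int[mu]_x `|t1 x| + \int[mu]_x `|t2 x|) => x.
apply: (le_trans (ler_normD _ _)); apply: lerD.
  by apply: Ct_bounded; exact: testfun_L1.
by apply: St_bounded; exact: testfun_L1.
Qed.

Lemma transfun_moment f (j : nat) : transfun f -> exists C, forall x, `|x| ^+ j * `|f x| <= C.
Proof.
elim: j f => [|j IH] f tf.
  by have [C hC] := transfun_bounded tf; exists C => x; rewrite expr0 mul1r.
have [C hC] := IH _ (transfun_Xmul tf); exists C => x.
by rewrite exprSr -mulrA -normrM.
Qed.

Lemma transfun_decay f : transfun f -> exists C, forall x, `|f x| <= C * japanese x.
Proof.
move=> tf; have [C hC] := transfun_bounded tf; have [D hD] := transfun_moment 2 tf.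
exists (C + D) => x; rewrite /japanese ler_pdivlMr; last by rewrite ltr_pwDl// sqr_ge0.
rewrite -[x ^+ 2]real_normK ?num_real// mulrDr mulr1 lerD// mulrC//.
Qed.

Lemma transfun_continuous f : transfun f -> continuous f.
Proof. by move=> tf; apply: smooth_continuous; exact: transfun_smooth. Qed.

Lemma L1_decay f (C : R) : measurable_fun [set: R] f -> (forall x, `|f x| <= C * japanese x) -> L1 f.
Proof. by move=> mf; apply: L1_leP => //; apply: L1Z; exact: L1_japanese. Qed.

Lemma transfun_L1 f : transfun f -> L1 f.
Proof.
move=> tf; have [C hC] := transfun_decay tf; apply: L1_decay hC.
by apply: measurable_of_continuous; exact: transfun_continuous.
Qed.

(* Growth for which pairing with the transform of a test function, which is
   O(1 / (1 + x^2)), is integrable. *)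
Definition slow f := measurable_fun [set: R] f /\ L1 (fun x => f x * japanese x).

Lemma measurable_japanese : measurable_fun [set: R] (@japanese R).
Proof. by apply: measurable_of_continuous; exact: japanese_continuous. Qed.

Lemma slow_mulL1 f psi (C : R) : slow f -> measurable_fun [set: R] psi ->
  (forall x, `|psi x| <= C * japanese x) -> L1 (fun x => f x * psi x).
Proof.
move=> [mf jf] mp hC; apply: (@L1_leP _ _ (fun x => C * `|f x * japanese x|)).
- exact: measurable_funM.
- by apply: L1Z; exact: L1_norm.
- move=> x; rewrite !normrM [`|japanese x|]gtr0_norm ?japanese_gt0// mulrCA.
  by rewrite ler_wpM2l.
Qed.

Lemma slow_transfun f psi : slow f -> transfun psi -> L1 (fun x => f x * psi x).
Proof.
move=> sf tp; have [C hC] := transfun_decay tp; apply: (slow_mulL1 sf _ hC).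
by apply: measurable_of_continuous; exact: transfun_continuous.
Qed.

Lemma slowD f g : slow f -> slow g -> slow (fun x => f x + g x).
Proof.
move=> [mf jf] [mg jg]; split; first exact: measurable_funD.
by under eq_fun do rewrite mulrDl; exact: L1D.
Qed.

Lemma slowZ (k : R) f : slow f -> slow (fun x => k * f x).
Proof.
move=> [mf jf]; split; first exact: measurable_funM.
by under eq_fun do rewrite -mulrA; exact: L1Z.
Qed.

Lemma slowN f : slow f -> slow (fun x => - f x).
Proof. by move=> h; under eq_fun do rewrite -mulN1r; exact: slowZ. Qed.

Lemma slowB f g : slow f -> slow g -> slow (fun x => f x - g x).
Proof. by move=> hf hg; apply: slowD => //; exact: slowN. Qed.

Lemma slow_L1 f : L1 f -> slow f.
Proof.
move=> f1; split; first exact: L1_measurable.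
apply: (@L1_bddMr _ _ _ 1) => //; first exact: measurable_japanese.
by move=> x; rewrite gtr0_norm ?japanese_gt0// japanese_le1.
Qed.

(** From a j <= a^2 + j for 0 <= j <= 1. *)
Lemma slow_sqr f : measurable_fun [set: R] f -> L1 (fun x => f x ^+ 2) -> slow f.
Proof.
move=> mf f2; split => //; apply: (@L1_leP _ _ (fun x => f x ^+ 2 + japanese x)).
- by apply: measurable_funM => //; exact: measurable_japanese.
- by apply: L1D => //; exact: L1_japanese.
move=> x; rewrite normrM [`|japanese x|]gtr0_norm ?japanese_gt0//.
rewrite -[f x ^+ 2]real_normK ?num_real//.
have j0 := japanese_gt0 x; have j1 := japanese_le1 x.
have := normr_ge0 (f x); set a := `|f x| => a0; set j := japanese x in j0 j1 *.
by have := sqr_ge0 (a - j); nra.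
Qed.

Lemma slow_locint f : slow f -> locint f.
Proof.
move=> [mf jf].
have := locintM_cont (k := fun x => 1 + x ^+ 2) _ (locint_L1 jf).
have -> : (fun x => (1 + x ^+ 2) * (f x * japanese x)) = f.
  by apply/funext => x; rewrite /japanese mulrCA mulfV ?mulr1// gt_eqF// ltr_pwDl// sqr_ge0.
apply; move=> x; apply: cvgD; first exact: cvg_cst.
exact: continuous_sqr.
Qed.

Lemma slow_ibp f f1 psi : prim f f1 -> slow f -> slow f1 -> transfun psi ->
  \int[mu]_x (f1 x * psi x) = - \int[mu]_x (f x * psi^`()%classic x).
Proof.
move=> pf sf sf1 tp; have tp' := transfun_derive1 tp.
have pp : prim psi psi^`()%classic.
  apply: derive_prim; last exact: transfun_continuous.
  by move=> x; apply: smooth_is_derive; exact: transfun_smooth.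
have I1 := slow_transfun sf tp; have I2 := slow_transfun sf1 tp.
have I3 := slow_transfun sf tp'.
have := prim_int0 (primM pf pp) I1 (L1D I2 I3).
by rewrite intD//; lra.
Qed.

Lemma testfun_lipschitz psi : testfun psi -> exists L, forall s t, `|psi t - psi s| <= L * `|t - s|.
Proof.
move=> tp; have [L hL] := testfun_bounded (testfun_derive tp); exists L => s t.
wlog st : s t / s <= t => [hw|].
  have [/hw//|/ltW /hw] := leP s t.
  by rewrite distrC [X in _ <= _ * X]distrC.
move: st; rewrite le_eqVlt => /predU1P[->|st].
  by rewrite !subrr !normr0 mulr0.
have [z _ ->] := @MVT_segment R psi psi^`()%classic s t (ltW st)
  (fun x _ => testfun_is_derive x tp) (continuous_subspaceT (testfun_continuous tp)).
by rewrite normrM ler_wpM2r.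
Qed.

Lemma testfun_inversion psi s : testfun psi ->
  Ct (Ct psi) s + St (St psi) s = 2 * pi * psi s.
Proof.
move=> tp; have [L hL] := testfun_lipschitz tp; have [M hM] := testfun_bounded tp.
apply: fourier_inversion hL hM s; first exact: testfun_L1.
  exact/transfun_L1/transfun_Ct.
exact/transfun_L1/transfun_St.
Qed.

Lemma exists_cutoff : exists chi : R -> R, testfun chi /\ chi 0 = 1.
Proof.
have b0 : bump (-1) 1 0 (0 : R) != 0.
  by rewrite /bump !flat1E sub0r opprK subr0 !mulr1 ltr01 mulf_neq0// gt_eqF// expR_gt0.
exists (fun x => (bump (-1) 1 0 0)^-1 * bump (-1) 1 0 x); split; last by rewrite mulVf.
by apply: testfunZ; exact: testfun_bump.
Qed.

(** Two integrations by parts. The constant is made explicit because it has to be uniform along a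
    sequence of cut-offs. *)
Lemma trans_decay_Ct theta x : testfun theta ->
  `|Ct theta x| <= (\int[mu]_t `|theta t| + \int[mu]_t `|theta^`()^`()%classic t|) * japanese x.
Proof.
move=> tt; have t1 := testfun_derive tt; have t2 := testfun_derive t1.
rewrite /japanese ler_pdivlMr; last by rewrite ltr_pwDl// sqr_ge0.
rewrite mulrDr mulr1; apply: lerD; first by apply: Ct_bounded; exact: testfun_L1.
have -> : `|Ct theta x| * x ^+ 2 = `|Ct theta^`()^`()%classic x|.
  rewrite Ct_derive// St_derive// mulrN normrN !normrM mulrA -expr2.
  by rewrite real_normK ?num_real// mulrC.
by apply: Ct_bounded; exact: testfun_L1.
Qed.

Lemma trans_decay_St theta x : testfun theta ->
  `|St theta x| <= (\int[mu]_t `|theta t| + \int[mu]_t `|theta^`()^`()%classic t|) * japanese x.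
Proof.
move=> tt; have t1 := testfun_derive tt; have t2 := testfun_derive t1.
rewrite /japanese ler_pdivlMr; last by rewrite ltr_pwDl// sqr_ge0.
rewrite mulrDr mulr1; apply: lerD; first by apply: St_bounded; exact: testfun_L1.
have -> : `|St theta x| * x ^+ 2 = `|St theta^`()^`()%classic x|.
  rewrite St_derive// Ct_derive// normrN !normrM mulrA -expr2.
  by rewrite real_normK ?num_real// mulrC.
by apply: St_bounded; exact: testfun_L1.
Qed.

(** The summand 0 gives the dilation the affine form for which derivation and stability of test
    functions are established. *)
Definition cut (chi f : R -> R) (n : nat) x := chi (n.+1%:R^-1 * x + 0) * f x.

Lemma testfun_cut chi f n : testfun chi -> smooth f -> testfun (cut chi f n).
Proof.
move=> tc sf; have := testfunM sf (testfun_affine (a := n.+1%:R^-1) 0 _ tc).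
rewrite invr_eq0 pnatr_eq0 => /(_ isT).
by congr testfun; apply/funext => x; rewrite /cut mulrC.
Qed.

Lemma cut_cvg chi f x : testfun chi -> chi 0 = 1 -> cut chi f n x @[n --> \oo] --> f x.
Proof.
move=> tc c0; rewrite -[X in _ --> X]mul1r -c0.
apply: cvgM; last exact: cvg_cst.
rewrite -[0 in X in _ --> X]addr0 -[X in _ --> chi (X + _)](mul0r x).
apply: (@cvg_comp _ _ _ (fun n => n.+1%:R^-1 * x + 0) chi _ (nbhs (0 * x + 0))).
  by apply: cvgD; [apply: cvgM; [exact: cvg_harmonic|exact: cvg_cst]|exact: cvg_cst].
exact: testfun_continuous.
Qed.

Lemma cut_derive2 chi f n x : testfun chi -> smooth f ->
  (cut chi f n)^`()^`()%classic x =
  n.+1%:R^-1 ^+ 2 * chi^`()^`()%classic (n.+1%:R^-1 * x + 0) * f x +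
  2 * (n.+1%:R^-1 * chi^`()%classic (n.+1%:R^-1 * x + 0) * f^`()%classic x) +
  chi (n.+1%:R^-1 * x + 0) * f^`()^`()%classic x.
Proof.
move=> tc sf; set a : R := n.+1%:R^-1.
have sf1 := smooth_derive sf; have tc1 := testfun_derive tc.
have d0 (y : R) : is_derive y 1 (fun y => chi (a * y + 0)) (a * chi^`()%classic (a * y + 0)).
  by apply: is_derive_comp_affine => z; exact: testfun_is_derive.
have d1 (y : R) : is_derive y 1 (fun y => chi^`()%classic (a * y + 0)) (a * chi^`()^`()%classic (a * y + 0)).
  by apply: is_derive_comp_affine => z; exact: testfun_is_derive.
have df (y : R) : is_derive y 1 f (f^`()%classic y) by exact: smooth_is_derive.
have df1 (y : R) : is_derive y 1 f^`()%classic (f^`()^`()%classic y) by exact: smooth_is_derive.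
have -> : (cut chi f n)^`()%classic =
   (fun y => a * chi^`()%classic (a * y + 0) * f y + chi (a * y + 0) * f^`()%classic y).
  by apply: is_derive_derive1 => y; exact: is_deriveM_fun.
have d2 (y : R) : is_derive y 1 (fun y => a * chi^`()%classic (a * y + 0)) (a * (a * chi^`()^`()%classic (a * y + 0))).
  have := is_deriveM_fun (is_derive_cst a y 1) (d1 y).
  by rewrite mul0r add0r.
have H (y : R) := is_deriveD (is_deriveM_fun (d2 y) (df y)) (is_deriveM_fun (d0 y) (df1 y)).
rewrite (is_derive_derive1 H).
move: (chi (a * x + 0)) (chi^`()%classic (a * x + 0)) (chi^`()^`()%classic (a * x + 0)).
move: (f x) (f^`()%classic x) (f^`()^`()%classic x) => u0 u1 u2 v0 v1 v2.
by ring.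
Qed.

(** Every derivative falling on the dilated cut-off brings a factor 1 / (n + 1) <= 1. *)
Lemma cut_norms chi f : testfun chi -> transfun f -> exists C, forall n,
  \int[mu]_t `|cut chi f n t| + \int[mu]_t `|(cut chi f n)^`()^`()%classic t| <= C.
Proof.
move=> tc tf; have sf := transfun_smooth tf.
have tf1 := transfun_derive1 tf; have tf2 := transfun_derive1 tf1.
have tc1 := testfun_derive tc; have tc2 := testfun_derive tc1.
have [C0 h0] := testfun_bounded tc; have [C1 h1] := testfun_bounded tc1.
have [C2 h2] := testfun_bounded tc2.
pose g0 t := C0 * `|f t|.
pose g2 t := C2 * `|f t| + 2 * (C1 * `|f^`()%classic t|) + C0 * `|f^`()^`()%classic t|.
have g01 : L1 g0 by apply: L1Z; apply: L1_norm; exact: transfun_L1.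
have g21 : L1 g2.
  apply: L1D; first apply: L1D.
  - by apply: L1Z; apply: L1_norm; exact: transfun_L1.
  - by apply: L1Z; apply: L1Z; apply: L1_norm; exact: transfun_L1.
  - by apply: L1Z; apply: L1_norm; exact: transfun_L1.
exists (\int[mu]_t g0 t + \int[mu]_t g2 t) => n.
have tcut := testfun_cut n tc sf.
apply: lerD; apply: int_le => //.
- by apply: L1_norm; exact: testfun_L1.
- by move=> t; rewrite normrM ler_wpM2r.
- by apply: L1_norm; apply: testfun_L1; do 2 apply: testfun_derive.
move=> t; rewrite cut_derive2//.
have a0 : 0 <= n.+1%:R^-1 :> R by rewrite invr_ge0.
have a1 : n.+1%:R^-1 <= 1 :> R by rewrite invf_le1 ?ler1n.
move: a0 a1; set a : R := n.+1%:R^-1 => a0 a1.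
apply: (le_trans (ler_normD _ _)); apply: lerD; last by rewrite normrM ler_wpM2r.
apply: (le_trans (ler_normD _ _)); apply: lerD.
  rewrite normrM ler_wpM2r// normrM -[C2]mul1r ler_pM// ger0_norm ?sqr_ge0//.
  by rewrite exprn_ile1.
rewrite normrM ger0_norm// ler_wpM2l// !normrM ler_wpM2r// -[C1]mul1r ler_pM//.
by rewrite ger0_norm.
Qed.

Lemma cut_transform_cvg chi f g x : testfun chi -> chi 0 = 1 -> transfun f -> transfun g ->
  Ct (cut chi f n) x + St (cut chi g n) x @[n --> \oo] --> Ct f x + St g x.
Proof.
move=> tc c0 tf tg; have [C0 h0] := testfun_bounded tc.
have mcut h n : transfun h -> measurable_fun [set: R] (cut chi h n).
  move=> th; apply: measurable_of_continuous; apply: testfun_continuous.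
  by apply: testfun_cut => //; exact: transfun_smooth.
apply: cvgD.
  apply: (@dct R (fun n t => cut chi f n t * cos (t * x)) _ (fun t => C0 * `|f t|) _ _ _ _ _).2.
  - by move=> n; apply: measurable_funM; [exact: mcut|exact: measurable_cosM].
  - by apply: L1_measurable; apply: L1_cos; exact: transfun_L1.
  - by apply: L1Z; apply: L1_norm; exact: transfun_L1.
  - move=> n t; rewrite normrM -[leRHS]mulr1 ler_pM// ?cos_max//.
    by rewrite normrM ler_wpM2r.
  - by move=> t; apply: cvgM; [exact: cut_cvg|exact: cvg_cst].
apply: (@dct R (fun n t => cut chi g n t * sin (t * x)) _ (fun t => C0 * `|g t|) _ _ _ _ _).2.
- by move=> n; apply: measurable_funM; [exact: mcut|exact: measurable_sinM].
- by apply: L1_measurable; apply: L1_sin; exact: transfun_L1.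
- by apply: L1Z; apply: L1_norm; exact: transfun_L1.
- move=> n t; rewrite normrM -[leRHS]mulr1 ler_pM// ?sin_max//.
  by rewrite normrM ler_wpM2r.
- by move=> t; apply: cvgM; [exact: cut_cvg|exact: cvg_cst].
Qed.

(* The Fourier transform of f, as a distribution, is A - i B. *)
Definition transform_pair f (A B : R -> R) := forall phi, testfun phi ->
  \int[mu]_x (f x * Ct phi x) = \int[mu]_x (A x * phi x) /\
  \int[mu]_x (f x * St phi x) = \int[mu]_x (B x * phi x).

(** The real part of the inverse Fourier transform of A - i B, for real A and B. *)
Definition inverse_transform (A B : R -> R) x := (2 * pi)^-1 * (Ct A x + St B x).

Lemma inverse_transform_continuous (A B : R -> R) : L1 A -> L1 B -> continuous (inverse_transform A B).
Proof.
move=> A1 B1 x; apply: cvgM; first exact: cvg_cst.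
by apply: cvgD; [exact: Ct_continuous|exact: St_continuous].
Qed.

(** Inversion writes 2 pi psi as a combination of transforms of Ct psi and St psi. These lack
    compact support, so the pair relation is applied to their cut-offs. On the side of [f] the limit
    is justified by a bound O(1 / (1 + x^2)) uniform in n, and on the other side by the
    integrability of [A] and [B]. *)
Lemma transform_pair_inversion f (A B : R -> R) : slow f -> L1 A -> L1 B ->
  transform_pair f A B -> {ae mu, forall x, f x = inverse_transform A B x}.
Proof.
move=> sf A1 B1 fAB; have [mf _] := sf.
have pi2 : 2 * pi != 0 :> R by rewrite mulf_neq0// gt_eqF// pi_gt0.
suff : {ae mu, forall x, f x - inverse_transform A B x = 0}.
  by apply: ae_imp => x /eqP; rewrite subr_eq0 => /eqP.
have li : locint (inverse_transform A B) by apply: locint_cont; exact: inverse_transform_continuous.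
have lf := slow_locint sf.
apply: dubois_reymond; first exact: locintB.
move=> psi tp; have [chi [tc c0]] := exists_cutoff.
have tC := transfun_Ct tp; have tS := transfun_St tp.
have [K1 hK1] := cut_norms tc tC; have [K2 hK2] := cut_norms tc tS.
have [C0 h0] := testfun_bounded tc.
have tcC n : testfun (cut chi (Ct psi) n) by apply: testfun_cut => //; exact: transfun_smooth.
have tcS n : testfun (cut chi (St psi) n) by apply: testfun_cut => //; exact: transfun_smooth.
pose U n x := Ct (cut chi (Ct psi) n) x + St (cut chi (St psi) n) x.
have mU n : measurable_fun [set: R] (U n).
  apply: measurable_of_continuous => x; apply: cvgD.
    by apply: Ct_continuous; exact: testfun_L1.
  by apply: St_continuous; exact: testfun_L1.
have UB n x : `|U n x| <= (K1 + K2) * japanese x.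
  apply: (le_trans (ler_normD _ _)); rewrite mulrDl; apply: lerD.
    apply: (le_trans (trans_decay_Ct x (tcC n))); rewrite ler_wpM2r//.
    exact/ltW/japanese_gt0.
  apply: (le_trans (trans_decay_St x (tcS n))); rewrite ler_wpM2r//.
  exact/ltW/japanese_gt0.
have fU n : L1 (fun x => f x * U n x) by exact: slow_mulL1 sf (mU n) (UB n).
have fp : L1 (fun x => f x * psi x) by exact: testfun_mulL1.
have c1 : \int[mu]_x (f x * U n x) @[n --> \oo] --> \int[mu]_x (f x * (2 * pi * psi x)).
  apply: (@dct R _ _ (fun x => (K1 + K2) * `|f x * japanese x|) _ _ _ _ _).2.
  - by move=> n; apply: measurable_funM.
  - apply: measurable_funM => //; apply: measurable_funM => //.
    by apply: measurable_of_continuous; exact: testfun_continuous.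
  - by apply: L1Z; apply: L1_norm; exact: sf.2.
  - move=> n x; rewrite !normrM [`|japanese x|]gtr0_norm ?japanese_gt0// mulrCA.
    by rewrite ler_wpM2l.
  - move=> x; apply: cvgM; first exact: cvg_cst.
    by rewrite -testfun_inversion//; exact: cut_transform_cvg.
have c2 : \int[mu]_x (A x * cut chi (Ct psi) n x) @[n --> \oo] --> \int[mu]_x (A x * Ct psi x).
  have [M hM] := transfun_bounded tC.
  apply: (@dct R _ _ (fun x => C0 * M * `|A x|) _ _ _ _ _).2.
  - move=> n; apply: measurable_funM; first exact: L1_measurable.
    by apply: measurable_of_continuous; exact: testfun_continuous.
  - apply: measurable_funM; first exact: L1_measurable.
    by apply: measurable_of_continuous; exact: transfun_continuous.
  - by apply: L1Z; exact: L1_norm.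
  - by move=> n x; rewrite normrM mulrC ler_wpM2r// normrM ler_pM.
  - by move=> x; apply: cvgM; [exact: cvg_cst|exact: cut_cvg].
have c3 : \int[mu]_x (B x * cut chi (St psi) n x) @[n --> \oo] --> \int[mu]_x (B x * St psi x).
  have [M hM] := transfun_bounded tS.
  apply: (@dct R _ _ (fun x => C0 * M * `|B x|) _ _ _ _ _).2.
  - move=> n; apply: measurable_funM; first exact: L1_measurable.
    by apply: measurable_of_continuous; exact: testfun_continuous.
  - apply: measurable_funM; first exact: L1_measurable.
    by apply: measurable_of_continuous; exact: transfun_continuous.
  - by apply: L1Z; exact: L1_norm.
  - by move=> n x; rewrite normrM mulrC ler_wpM2r// normrM ler_pM.
  - by move=> x; apply: cvgM; [exact: cvg_cst|exact: cut_cvg].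
have EU n : \int[mu]_x (f x * U n x) =
    \int[mu]_x (A x * cut chi (Ct psi) n x) + \int[mu]_x (B x * cut chi (St psi) n x).
  rewrite -(fAB _ (tcC n)).1 -(fAB _ (tcS n)).2 -intD; last 2 first.
  - by apply: slow_transfun => //; exact: transfun_Ct.
  - by apply: slow_transfun => //; exact: transfun_St.
  by apply: int_eq => x; rewrite mulrDr.
have c4 : \int[mu]_x (f x * U n x) @[n --> \oo] -->
    \int[mu]_x (A x * Ct psi x) + \int[mu]_x (B x * St psi x).
  rewrite (_ : (fun n => \int[mu]_x (f x * U n x)) = (fun n =>
    \int[mu]_x (A x * cut chi (Ct psi) n x) + \int[mu]_x (B x * cut chi (St psi) n x))).
    exact: cvgD.
  by apply/funext => n; exact: EU.
have := cvg_unique (@Rhausdorff R) c1 c4.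
have p1 := testfun_L1 tp.
rewrite int_Ct// int_St//.
have CAp : L1 (fun x => Ct A x * psi x).
  by apply: testfun_mulL1 => //; apply: locint_cont; exact: Ct_continuous.
have SBp : L1 (fun x => St B x * psi x).
  by apply: testfun_mulL1 => //; apply: locint_cont; exact: St_continuous.
rewrite -intD//.
rewrite (int_eq (g := fun x => 2 * pi * (f x * psi x))); last by move=> x; ring.
rewrite intZ// => E.
rewrite (int_eq (g := fun x => f x * psi x - (2 * pi)^-1 * (Ct A x * psi x + St B x * psi x))); last first.
  by move=> x; rewrite /inverse_transform; ring.
rewrite intB//; last by apply: L1Z; exact: L1D.
by rewrite intZ; [rewrite -E mulKf// subrr|exact: L1D].
Qed.

Lemma transform_pair_L1 f : L1 f -> transform_pair f (Ct f) (St f).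
Proof.
move=> f1 phi tp; have p1 := testfun_L1 tp.
by rewrite int_Ct// int_St.
Qed.

End transforms_of_test_functions.

(** * Functions that are square integrable together with their derivative *)

Section square_integrable.
Context {R : realType}.
Local Notation mu := (@lebesgue_measure R).
Implicit Types (f g h : R -> R) (x y : R).

Lemma L1_mul2 f g : measurable_fun [set: R] f -> measurable_fun [set: R] g ->
  L1 (fun x => f x ^+ 2) -> L1 (fun x => g x ^+ 2) -> L1 (fun x => f x * g x).
Proof.
move=> mf mg f2 g2; apply: (L1_leP _ (L1D f2 g2)); first exact: measurable_funM.
move=> x; rewrite normrM -[f x ^+ 2]real_normK ?num_real// -[g x ^+ 2]real_normK ?num_real//.
by have := sqr_ge0 (`|f x| - `|g x|); have := normr_ge0 (f x); have := normr_ge0 (g x); nra.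
Qed.

Lemma sqr_L1D f g : measurable_fun [set: R] f -> measurable_fun [set: R] g ->
  L1 (fun x => f x ^+ 2) -> L1 (fun x => g x ^+ 2) -> L1 (fun x => (f x + g x) ^+ 2).
Proof.
move=> mf mg f2 g2; have := L1D (L1D f2 g2) (L1Z 2 (L1_mul2 mf mg f2 g2)).
by congr L1; apply/funext => x; ring.
Qed.

Lemma sqr_L1Z (k : R) f : L1 (fun x => f x ^+ 2) -> L1 (fun x => (k * f x) ^+ 2).
Proof. by move=> f2; under eq_fun do rewrite exprMn; exact: L1Z. Qed.

Lemma sqr_L1_bddM (k : R -> R) f (C : R) : measurable_fun [set: R] k -> (forall x, `|k x| <= C) ->
  L1 (fun x => f x ^+ 2) -> L1 (fun x => (k x * f x) ^+ 2).
Proof.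
move=> mk kC f2; under eq_fun do rewrite exprMn.
apply: (L1_bddM (M := C ^+ 2) _ f2); first exact: measurable_funX.
by move=> x; rewrite normrX lerXn2r ?nnegrE// (le_trans (normr_ge0 _) (kC x)).
Qed.

Lemma prim_bounded_sqr f g : prim f g -> measurable_fun [set: R] g ->
  L1 (fun x => f x ^+ 2) -> L1 (fun x => g x ^+ 2) -> exists C, forall x, `|f x| <= C.
Proof.
(* The 2 comes from |f| <= 1 + f^2 and |g| <= 1 + g^2 on an interval of length 1. *)
move=> pf mg f2 g2; exists (2 + (\int[mu]_x (f x ^+ 2) + \int[mu]_x (g x ^+ 2))) => x.
have h : x <= x <= x + 1 by rewrite lexx lerDl ler01.
apply: le_trans (prim_norm_le pf h) _.
have I1 := L1_indic_itv x (x + 1).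
have I2 := L1D f2 g2.
rewrite -intD//.
have -> : 2 = \int[mu]_t (2 * \1_`[x, x + 1] t).
  by rewrite intZ ?int_indic_itv1 ?mulr1.
rewrite -intD//; last exact: L1Z.
apply: int_le.
- have cf := prim_continuous pf; have [[_ ig] _] := pf.
  have lf : locint (fun t => `|f t|).
    by apply: locint_cont => z; apply: continuous_comp; [exact: cf|exact: norm_continuous].
  have lg : locint (fun t => `|g t|).
    apply: locint_sqr; first exact: measurableT_comp.
    by under eq_fun do rewrite real_normK ?num_real//; exact: locint_L1.
  exact: (locintD lf lg).2.
- by apply: L1D => //; exact: L1Z.
move=> t; rewrite -[f t ^+ 2]real_normK ?num_real// -[g t ^+ 2]real_normK ?num_real//.
have := indicE01 `[x, x + 1] t; set i := \1_ _ _ => /andP[i0 i1].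
have := normr_ge0 (f t); have := normr_ge0 (g t); set u := `|f t|; set v := `|g t| => v0 u0.
apply: (@le_trans _ _ (2 * i + (u ^+ 2 + v ^+ 2) * i)).
  rewrite -mulrDl ler_wpM2r//; have := sqr_ge0 (u - 1); have := sqr_ge0 (v - 1); nra.
by rewrite lerD2l -[leRHS]mulr1 ler_wpM2l// addr_ge0// sqr_ge0.
Qed.

(** The square of [f] is integrable with integrable derivative 2 f g, so it tends to 0. *)
Lemma prim_cvg0_sqr f g : prim f g -> measurable_fun [set: R] g ->
  L1 (fun x => f x ^+ 2) -> L1 (fun x => g x ^+ 2) ->
  (f x @[x --> +oo] --> 0) /\ (f x @[x --> -oo] --> 0).
Proof.
move=> pf mg f2 g2; have cf := prim_continuous pf.
have mf : measurable_fun [set: R] f by exact: measurable_of_continuous.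
have fg := L1_mul2 mf mg f2 g2.
have p2 : prim (fun x => f x ^+ 2) (fun x => 2 * (f x * g x)).
  have := primM pf pf; rewrite (_ : (fun x => g x * f x + _) = (fun x => 2 * (f x * g x)))//.
  by apply/funext => x; ring.
have [hp hm] := prim_cvg0 p2 f2 (L1Z 2 fg).
have aux (Fl : set_system R) : Filter Fl -> f x ^+ 2 @[x --> Fl] --> (0 : R) -> f x @[x --> Fl] --> (0 : R).
  move=> FF h; apply/cvgrPdist_le => e e0.
  move/cvgrPdist_le : h => /(_ _ (exprn_gt0 2 e0)); apply: filterS => x.
  rewrite !sub0r !normrN normrX => h; rewrite -(@ler_pXn2r _ 2)// nnegrE//; exact: ltW.
by split; apply: aux.
Qed.

Lemma prim_const f : prim f (fun=> 0) -> forall x, f x = f 0.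
Proof.
move=> [_ pf] x; have h0 u v : u <= v -> f v - f u = 0.
  by move=> uv; rewrite pf//; under eq_Rintegral do rewrite mul0r; exact: int0.
have [x0|/ltW x0] := leP 0 x; first by have := h0 _ _ x0; lra.
by have := h0 _ _ x0; lra.
Qed.

Lemma L1_0 : L1 (fun _ : R => 0 : R).
Proof. exact: (@integrable0 _ _ R mu setT). Qed.

Lemma L1_cst_eq0 (k : R) : L1 (fun _ : R => k) -> k = 0.
Proof.
move=> k1; have [h _] := prim_cvg0 (prim_cst k) k1 L1_0.
exact: (cvg_unique (@Rhausdorff R) (cvg_cst k) h).
Qed.

(** A primitive of [f] is constant, its derivative being zero almost everywhere; by continuity [f]
    is its derivative at every point. *)
Lemma continuous_ae_eq0 f : continuous f -> {ae mu, forall x, f x = 0} -> forall x, f x = 0.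
Proof.
move=> cf f0 x; have [P0 pP] := prim_exists (locint_cont cf).
have p0 : prim P0 (fun=> 0) by apply: (eq_ae_prim pP) => //; exact: measurable_cst.
have P0c : P0 = fun=> P0 0 by apply/funext => y; exact: prim_const.
have [_ <-] := prim_derivable pP (cf x).
by rewrite P0c derive_cst.
Qed.

Lemma continuous_ae_eq f g : continuous f -> continuous g ->
  {ae mu, forall x, f x = g x} -> forall x, f x = g x.
Proof.
move=> cf cg fg x; apply/eqP; rewrite -subr_eq0; apply/eqP.
apply: (@continuous_ae_eq0 (fun x => f x - g x)).
  by move=> y; apply: cvgB; [exact: cf|exact: cg].
by apply: ae_imp fg => y ->; rewrite subrr.
Qed.

(** The case of equality, applied to |g - f| and g - f. *)
Lemma continuous_ae_le f g : continuous f -> continuous g ->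
  {ae mu, forall x, f x <= g x} -> forall x, f x <= g x.
Proof.
move=> cf cg fg x; rewrite -subr_ge0; apply/normr_idP/eqP; rewrite -subr_eq0; apply/eqP.
apply: (@continuous_ae_eq0 (fun x => `|g x - f x| - (g x - f x))).
  have cgf y : {for y, continuous (fun x => g x - f x)} by apply: cvgB; [exact: cg|exact: cf].
  move=> y; apply: cvgB; last exact: cgf.
  exact: (continuous_comp (cgf y) (@norm_continuous _ _ _)).
by apply: ae_imp fg => y h; rewrite ger0_norm ?subrr// subr_ge0.
Qed.

Lemma Ct_derive2 (theta : R -> R) : testfun theta ->
  (Ct theta)^`()^`()%classic = Ct (fun x => - (x ^+ 2 * theta x)).
Proof.
move=> tt; have t1 := testfun_Xmul tt; have t2 := testfun_Xmul t1.
rewrite (is_derive_derive1 (is_derive_Ct (testfun_L1 tt) (testfun_L1 t1))).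
have H x := is_deriveN (is_derive_St (testfun_L1 t1) (testfun_L1 t2) x).
rewrite (is_derive_derive1 H); apply/funext => x.
rewrite -CtN; last exact: testfun_L1.
by apply: int_eq => y; rewrite expr2 mulrA.
Qed.

Lemma St_derive2 (theta : R -> R) : testfun theta ->
  (St theta)^`()^`()%classic = St (fun x => - (x ^+ 2 * theta x)).
Proof.
move=> tt; have t1 := testfun_Xmul tt; have t2 := testfun_Xmul t1.
rewrite (is_derive_derive1 (is_derive_St (testfun_L1 tt) (testfun_L1 t1))).
rewrite (is_derive_derive1 (is_derive_Ct (testfun_L1 t1) (testfun_L1 t2))).
apply/funext => x; rewrite -StN; last exact: testfun_L1.
by apply: int_eq => y; rewrite expr2 mulrA.
Qed.

End square_integrable.

(** * The equation for eta *)

(* u = a + i b, u' = a1 + i b1 and g = W * (1 - |u|^2). *)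
Record wave {R : realType} (c : R) (a b a1 b1 g : R -> R) : Prop := Wave {
  wave_a : prim a a1;
  wave_b : prim b b1;
  wave_a1 : prim a1 (fun x => c * b1 x - a x * g x);
  wave_b1 : prim b1 (fun x => - (c * a1 x) - b x * g x);
  wave_mg : measurable_fun [set: R] g;
  wave_eta_sqr : L1 (fun x => (1 - (a x ^+ 2 + b x ^+ 2)) ^+ 2);
  wave_a1_sqr : L1 (fun x => a1 x ^+ 2);
  wave_b1_sqr : L1 (fun x => b1 x ^+ 2);
  wave_g_sqr : L1 (fun x => g x ^+ 2) }.

Section traveling_waves.
Context {R : realType}.
Local Notation mu := (@lebesgue_measure R).
Context (c : R) (a b a1 b1 g : R -> R) (W : wave c a b a1 b1 g).

(* eta, eta' and the source F of the linear equation satisfied by eta *)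
Definition weta (a b : R -> R) x := 1 - (a x ^+ 2 + b x ^+ 2).
Definition weta1 (a b a1 b1 : R -> R) x := -2 * (a x * a1 x + b x * b1 x).
Definition wforce (a b a1 b1 g : R -> R) x :=
  2 * (a1 x ^+ 2 + b1 x ^+ 2) + 2 * (weta a b x * g x).

Local Notation eta := (weta a b).
Local Notation eta1 := (weta1 a b a1 b1).
Local Notation F := (wforce a b a1 b1 g).

Let ca : continuous a := prim_continuous (wave_a W).
Let cb : continuous b := prim_continuous (wave_b W).
Let ca1 : continuous a1 := prim_continuous (wave_a1 W).
Let cb1 : continuous b1 := prim_continuous (wave_b1 W).
Let ma := measurable_of_continuous ca.
Let mb := measurable_of_continuous cb.
Let ma1 := measurable_of_continuous ca1.
Let mb1 := measurable_of_continuous cb1.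
Let mg := wave_mg W.

Lemma weta_continuous : continuous eta.
Proof.
move=> x; apply: cvgB; first exact: cvg_cst.
by under eq_fun do rewrite !expr2; apply: cvgD; apply: cvgM;
  [exact: ca|exact: ca|exact: cb|exact: cb].
Qed.

Lemma weta1_continuous : continuous eta1.
Proof.
move=> x; apply: cvgM; first exact: cvg_cst.
by apply: cvgD; apply: cvgM; [exact: ca|exact: ca1|exact: cb|exact: cb1].
Qed.

Let meta := measurable_of_continuous weta_continuous.
Let meta1 := measurable_of_continuous weta1_continuous.

(** Since |u| is close to 1 at infinity, the components of u are not both square integrable, and eta
    has to be used instead: |f| <= 1 + f^2 <= 2 - eta <= 3 + eta^2. Together with |f1| <= 1 + f1^2
    this shows that 4 suffices. *)
Lemma wave_bounded_comp (f f1 : R -> R) : prim f f1 -> measurable_fun [set: R] f1 ->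
  L1 (fun x => f1 x ^+ 2) -> (forall x, f x ^+ 2 <= 1 - eta x) ->
  exists C, forall x, `|f x| <= C.
Proof.
move=> pf mf1 f12 fe; exists (4 + (\int[mu]_x (eta x ^+ 2) + \int[mu]_x (f1 x ^+ 2))) => x.
have h : x <= x <= x + 1 by rewrite lexx lerDl ler01.
apply: le_trans (prim_norm_le pf h) _.
have I1 := L1_indic_itv x (x + 1).
have e2 : L1 (fun x => eta x ^+ 2) := wave_eta_sqr W.
have I2 := L1D e2 f12.
rewrite -intD//.
have -> : 4 = \int[mu]_t (4 * \1_`[x, x + 1] t).
  by rewrite intZ ?int_indic_itv1 ?mulr1.
rewrite -intD//; last exact: L1Z.
apply: int_le.
- have cf := prim_continuous pf; have [[_ ig] _] := pf.
  have lf : locint (fun t => `|f t|).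
    by apply: locint_cont => z; apply: continuous_comp; [exact: cf|exact: norm_continuous].
  have lg : locint (fun t => `|f1 t|).
    apply: locint_sqr; first exact: measurableT_comp.
    by under eq_fun do rewrite real_normK ?num_real//; exact: locint_L1.
  exact: (locintD lf lg).2.
- by apply: L1D => //; exact: L1Z.
move=> t; have := fe t; rewrite -[f t ^+ 2]real_normK ?num_real// -[f1 t ^+ 2]real_normK ?num_real//.
have := indicE01 `[x, x + 1] t; set i := \1_ _ _ => /andP[i0 i1].
have := normr_ge0 (f t); have := normr_ge0 (f1 t); set u := `|f t|; set v := `|f1 t|; set e := eta t => v0 u0 ue.
apply: (@le_trans _ _ (4 * i + (e ^+ 2 + v ^+ 2) * i)).
  rewrite -mulrDl ler_wpM2r//.
  by have := sqr_ge0 (u - 2^-1); have := sqr_ge0 (v - 2^-1); have := sqr_ge0 (e + 2^-1); nra.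
by rewrite lerD2l -[leRHS]mulr1 ler_wpM2l// addr_ge0// sqr_ge0.
Qed.

Lemma wave_a_bounded : exists C, forall x, `|a x| <= C.
Proof.
apply: (wave_bounded_comp (wave_a W)) => //; first exact: (wave_a1_sqr W).
by move=> x; rewrite /weta; have := sqr_ge0 (b x); lra.
Qed.

Lemma wave_b_bounded : exists C, forall x, `|b x| <= C.
Proof.
apply: (wave_bounded_comp (wave_b W)) => //; first exact: (wave_b1_sqr W).
by move=> x; rewrite /weta; have := sqr_ge0 (a x); lra.
Qed.

Lemma wave_a1_bounded : exists C, forall x, `|a1 x| <= C.
Proof.
have [C hC] := wave_a_bounded.
have mag : measurable_fun [set: R] (fun x => - (a x * g x)).
  by apply: measurableT_comp => //; exact: measurable_funM.
have mcb : measurable_fun [set: R] (fun x => c * b1 x) by exact: measurable_funM.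
apply: (prim_bounded_sqr (wave_a1 W)); [exact: measurable_funD|exact: (wave_a1_sqr W)|].
apply: sqr_L1D => //; first by apply: sqr_L1Z; exact: (wave_b1_sqr W).
under eq_fun do rewrite sqrrN; apply: (sqr_L1_bddM _ hC) => //; exact: (wave_g_sqr W).
Qed.

Lemma wave_b1_bounded : exists C, forall x, `|b1 x| <= C.
Proof.
have [C hC] := wave_b_bounded.
have mag : measurable_fun [set: R] (fun x => - (b x * g x)).
  by apply: measurableT_comp => //; exact: measurable_funM.
have mcb : measurable_fun [set: R] (fun x => - (c * a1 x)).
  by apply: measurableT_comp => //; exact: measurable_funM.
apply: (prim_bounded_sqr (wave_b1 W)); [exact: measurable_funD|exact: (wave_b1_sqr W)|].
apply: sqr_L1D => //; under eq_fun do rewrite sqrrN.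
  by apply: sqr_L1Z; exact: (wave_a1_sqr W).
apply: (sqr_L1_bddM _ hC) => //; exact: (wave_g_sqr W).
Qed.

Lemma weta_bounded : exists C, forall x, `|eta x| <= C.
Proof.
have [C hC] := wave_a_bounded; have [D hD] := wave_b_bounded.
exists (1 + (C ^+ 2 + D ^+ 2)) => x.
apply: (le_trans (ler_normB _ _)); rewrite normr1 lerD2l.
apply: (le_trans (ler_normD _ _)); rewrite !normrX.
by apply: lerD; rewrite lerXn2r ?nnegrE// (le_trans (normr_ge0 _) (hC x), le_trans (normr_ge0 _) (hD x)).
Qed.

Lemma weta1_sqr : L1 (fun x => eta1 x ^+ 2).
Proof.
have [C hC] := wave_a_bounded; have [D hD] := wave_b_bounded.
apply: sqr_L1Z; apply: sqr_L1D; [exact: measurable_funM|exact: measurable_funM| |].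
  by apply: (sqr_L1_bddM _ hC) => //; exact: (wave_a1_sqr W).
by apply: (sqr_L1_bddM _ hD) => //; exact: (wave_b1_sqr W).
Qed.

Lemma weta_prim : prim eta eta1.
Proof.
have h := primD (primM (wave_a W) (wave_a W)) (primM (wave_b W) (wave_b W)).
have := primD (prim_cst 1) (primZ (-1) h).
rewrite (_ : (fun x => 1 + -1 * _) = eta); last first.
  by apply/funext => x; rewrite /weta; ring.
by rewrite (_ : (fun x => 0 + _) = eta1)//; apply/funext => x; rewrite /weta1; ring.
Qed.

(* a b1 - b a1 - c eta / 2 is conserved and square integrable. *)
Lemma wave_momentum x : a x * b1 x - b x * a1 x = c / 2 * eta x.
Proof.
pose J x := a x * b1 x + -1 * (b x * a1 x) + - (c / 2) * eta x.
have pJ : prim J (fun=> 0).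
  have h1 := primM (wave_a W) (wave_b1 W); have h2 := primM (wave_b W) (wave_a1 W).
  have := primD (primD h1 (primZ (-1) h2)) (primZ (- (c / 2)) weta_prim).
  rewrite (_ : (fun x => _ + - (c / 2) * eta1 x) = fun=> 0)//.
  by apply/funext => y; rewrite /weta1; field.
have JE := prim_const pJ.
have [C hC] := wave_a_bounded; have [D hD] := wave_b_bounded.
have m1 : measurable_fun [set: R] (fun x => a x * b1 x) by exact: measurable_funM.
have m2 : measurable_fun [set: R] (fun x => b x * a1 x) by exact: measurable_funM.
have m3 : measurable_fun [set: R] (fun x => -1 * (b x * a1 x)) by exact: measurable_funM.
have J2 : L1 (fun x => J x ^+ 2).
  apply: sqr_L1D; [exact: measurable_funD|exact: measurable_funM| |]; last first.
    by apply: sqr_L1Z; exact: (wave_eta_sqr W).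
  apply: sqr_L1D => //; first by apply: (sqr_L1_bddM _ hC) => //; exact: (wave_b1_sqr W).
  by apply: sqr_L1Z; apply: (sqr_L1_bddM _ hD) => //; exact: (wave_a1_sqr W).
have /L1_cst_eq0/eqP : L1 (fun _ : R => J 0 ^+ 2).
  by move: J2; congr L1; apply/funext => y; rewrite JE.
rewrite sqrf_eq0 => /eqP J0; have := JE x; rewrite J0 /J; lra.
Qed.

(** The momentum identity turns -2 c (a b1 - b a1) into -c^2 eta, and |u|^2 = 1 - eta splits 2 |u|^2
    g into the linear part 2 g and a part of F. *)
Lemma weta1_prim : prim eta1 (fun x => 2 * g x - c ^+ 2 * eta x - F x).
Proof.
have := primZ (-2) (primD (primM (wave_a W) (wave_a1 W)) (primM (wave_b W) (wave_b1 W))).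
rewrite (_ : (fun x => -2 * (_ + _ + _)) = (fun x => 2 * g x - c ^+ 2 * eta x - F x))//.
apply/funext => x.
have E : c ^+ 2 * eta x = 2 * c * (a x * b1 x - b x * a1 x).
  by rewrite wave_momentum; field.
by rewrite E /wforce /weta; ring.
Qed.

Lemma wforce_L1 : L1 F.
Proof.
apply: L1D; first by apply: L1Z; apply: L1D; [exact: (wave_a1_sqr W)|exact: (wave_b1_sqr W)].
by apply: L1Z; apply: L1_mul2 => //; [exact: (wave_eta_sqr W)|exact: (wave_g_sqr W)].
Qed.

Lemma wforce_sqr : L1 (fun x => F x ^+ 2).
Proof.
have [C1 hC1] := wave_a1_bounded; have [D1 hD1] := wave_b1_bounded; have [E hE] := weta_bounded.
apply: sqr_L1D.
- by apply: measurable_funM => //; apply: measurable_funD; exact: measurable_funX.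
- by apply: measurable_funM => //; exact: measurable_funM.
- apply: sqr_L1Z; apply: sqr_L1D; [exact: measurable_funX|exact: measurable_funX| |].
    by apply: (sqr_L1_bddM ma1 hC1); exact: (wave_a1_sqr W).
  by apply: (sqr_L1_bddM mb1 hD1); exact: (wave_b1_sqr W).
- by apply: sqr_L1Z; apply: (sqr_L1_bddM meta hE); exact: (wave_g_sqr W).
Qed.

Let seta : slow eta.
Proof. by apply: slow_sqr => //; exact: (wave_eta_sqr W). Qed.

Let seta1 : slow eta1.
Proof. by apply: slow_sqr => //; exact: weta1_sqr. Qed.

Let sg : slow g.
Proof. by apply: slow_sqr => //; exact: (wave_g_sqr W). Qed.

Let seta2 : slow (fun x => 2 * g x - c ^+ 2 * eta x - F x).
Proof.
apply: slowB; last by apply: slow_L1; exact: wforce_L1.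
by apply: slowB; exact: slowZ.
Qed.

(** The equation for eta'' in weak form. It is tested on transforms because eta and [g] are related
    only through their own transforms. *)
Lemma wave_identity psi : transfun psi ->
  \int[mu]_x (F x * psi x) = 2 * \int[mu]_x (g x * psi x)
    - c ^+ 2 * \int[mu]_x (eta x * psi x)
    - \int[mu]_x (eta x * psi^`()^`()%classic x).
Proof.
move=> tp; have tp1 := transfun_derive1 tp; have tp2 := transfun_derive1 tp1.
have := slow_ibp weta1_prim seta1 seta2 tp.
rewrite (slow_ibp weta_prim seta seta1 tp1) opprK.
have I1 := slow_transfun sg tp; have I2 := slow_transfun seta tp.
have I3 := slow_transfun (slow_L1 wforce_L1) tp.
rewrite (int_eq (g := fun x => 2 * (g x * psi x) - c ^+ 2 * (eta x * psi x) - F x * psi x)); last by move=> x; ring.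
have I4 := L1Z 2 I1; have I5 := L1Z (c ^+ 2) I2.
rewrite intB//; last exact: L1B.
by rewrite intB// !intZ//; lra.
Qed.

Context (A B m : R -> R) (lA : locint A) (lB : locint B) (mm : measurable_fun [set: R] m).
Context (K : R) (mK : forall x, `|m x| <= K).
Context (tpeta : transform_pair eta A B).
Context (tpg : transform_pair g (fun x => m x * A x) (fun x => m x * B x)).

Local Notation M := (fun x => x ^+ 2 + 2 * m x - c ^+ 2).

Let testfun_sqr (phi : R -> R) : testfun phi -> testfun (fun x => - (x ^+ 2 * phi x)).
Proof.
move=> tp; apply: testfunN; have := testfun_Xmul (testfun_Xmul tp).
by congr testfun; apply/funext => x; rewrite expr2 mulrA.
Qed.

Let locint_symbol (f : R -> R) : locint f -> locint (fun x => M x * f x).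
Proof.
move=> lf; have l1 := locint_bddM mm mK lf; have l2 := locintM_cont continuous_sqr lf.
have := locintD (locintB l2 (locintZ (c ^+ 2) lf)) (locintZ 2 l1).
by congr locint; apply/funext => x; ring.
Qed.

Let symbol_int (f phi : R -> R) (F0 : R) : locint f -> testfun phi ->
  F0 = 2 * \int[mu]_x (m x * f x * phi x) - c ^+ 2 * \int[mu]_x (f x * phi x)
    - \int[mu]_x (f x * (- (x ^+ 2 * phi x))) ->
  F0 = \int[mu]_x (M x * f x * phi x).
Proof.
move=> lf tp ->; have l1 := locint_bddM mm mK lf.
have I1 := testfun_mulL1 l1 tp; have I2 := testfun_mulL1 lf tp.
have I3 := testfun_mulL1 lf (testfun_sqr tp).
rewrite -!intZ//; rewrite -intB; [|exact: L1Z|exact: L1Z].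
rewrite -intB//; first by apply: int_eq => x; ring.
by apply: L1B; exact: L1Z.
Qed.

(** Two derivatives of Ct phi amount to multiplying phi by -x^2. The weak identity tested on Ct phi
    therefore becomes multiplication by the symbol M_c, tested on phi. *)
Lemma wave_symbol_Ct : {ae mu, forall x, Ct F x = M x * A x}.
Proof.
suff : {ae mu, forall x, Ct F x - M x * A x = 0}.
  by apply: ae_imp => x /eqP; rewrite subr_eq0 => /eqP.
have lM := locint_symbol lA.
have lC : locint (Ct F) by apply: locint_cont; apply: Ct_continuous; exact: wforce_L1.
apply: dubois_reymond => [|phi tp]; first exact: locintB.
have tC := transfun_Ct tp.
have := wave_identity tC; rewrite Ct_derive2//.
rewrite (tpeta tp).1 (tpg tp).1 (tpeta (testfun_sqr tp)).1.
move=> /(symbol_int lA tp).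
rewrite int_Ct; [|exact: wforce_L1|exact: testfun_L1] => E.
have I1 := testfun_mulL1 lC tp; have I2 := testfun_mulL1 lM tp.
rewrite (int_eq (g := fun x => Ct F x * phi x - M x * A x * phi x)); last by move=> x; ring.
by rewrite intB// E subrr.
Qed.

Lemma wave_symbol_St : {ae mu, forall x, St F x = M x * B x}.
Proof.
suff : {ae mu, forall x, St F x - M x * B x = 0}.
  by apply: ae_imp => x /eqP; rewrite subr_eq0 => /eqP.
have lM := locint_symbol lB.
have lC : locint (St F) by apply: locint_cont; apply: St_continuous; exact: wforce_L1.
apply: dubois_reymond => [|phi tp]; first exact: locintB.
have tC := transfun_St tp.
have := wave_identity tC; rewrite St_derive2//.
rewrite (tpeta tp).2 (tpg tp).2 (tpeta (testfun_sqr tp)).2.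
move=> /(symbol_int lB tp).
rewrite int_St; [|exact: wforce_L1|exact: testfun_L1] => E.
have I1 := testfun_mulL1 lC tp; have I2 := testfun_mulL1 lM tp.
rewrite (int_eq (g := fun x => St F x * phi x - M x * B x * phi x)); last by move=> x; ring.
by rewrite intB// E subrr.
Qed.

End traveling_waves.

(** * Bootstrap *)

Section jets.
Context {R : realType}.
Local Notation mu := (@lebesgue_measure R).
Implicit Types (f g h : R -> R) (x y : R) (P Q S : (R -> R) -> Prop).

(** Parametrised by a predicate, so that a single Leibniz rule serves for integrability, for
    vanishing at infinity and for smallness relative to eta. *)
Fixpoint jet P k f : Prop := P f /\
  (if k is k'.+1 then exists f', (forall x, is_derive x 1 f (f' x)) /\ jet P k' f' else True).

Lemma jet_head P k f : jet P k f -> P f.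
Proof. by case: k => [|k] []. Qed.

Lemma jet_pred P k f : jet P k.+1 f -> jet P k f.
Proof.
elim: k f => [|k IH] f [Pf [f' [df h]]]; first by split.
by split => //; exists f'; split => //; exact: IH.
Qed.

Lemma jet_le P j k f : (j <= k)%N -> jet P k f -> jet P j f.
Proof.
elim: k => [|k IH]; first by rewrite leqn0 => /eqP ->.
rewrite leq_eqVlt => /predU1P[->//|jk] /jet_pred; exact: IH.
Qed.

Lemma jet_step P k f f' : (forall x, is_derive x 1 f (f' x)) -> jet P k.+1 f -> jet P k f'.
Proof.
by move=> /is_derive_derive1 E [_ [f1 [/is_derive_derive1 <-]]]; rewrite E.
Qed.

Lemma jetD P k f g : (forall f g, P f -> P g -> P (fun x => f x + g x)) ->
  jet P k f -> jet P k g -> jet P k (fun x => f x + g x).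
Proof.
move=> PD; elim: k f g => [|k IH] f g [Pf hf] [Pg hg]; split => //; try exact: PD.
have [f' [df jf]] := hf; have [g' [dg jg]] := hg.
exists (fun x => f' x + g' x); split; last exact: IH.
by move=> x; exact: is_deriveD.
Qed.

Lemma jetM P Q S k f g : (forall f g, P f -> Q g -> S (fun x => f x * g x)) ->
  (forall f g, S f -> S g -> S (fun x => f x + g x)) ->
  jet P k f -> jet Q k g -> jet S k (fun x => f x * g x).
Proof.
move=> PQ SD; elim: k f g => [|k IH] f g jf jg.
  by split => //; apply: PQ; [exact: jet_head jf|exact: jet_head jg].
split; first by apply: PQ; [exact: jet_head jf|exact: jet_head jg].
have [_ [f' [df jf']]] := jf; have [_ [g' [dg jg']]] := jg.
exists (fun x => f' x * g x + f x * g' x); split.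
  by move=> x; exact: is_deriveM_fun.
by apply: jetD => //; apply: IH => //; exact: jet_pred.
Qed.

Lemma jetZ P k (a : R) f : (forall f, P f -> P (fun x => a * f x)) ->
  jet P k f -> jet P k (fun x => a * f x).
Proof.
move=> PZ; elim: k f => [|k IH] f [Pf hf]; split => //; try exact: PZ.
have [f' [df jf]] := hf; exists (fun x => a * f' x); split; last exact: IH.
move=> x; have := is_deriveM_fun (is_derive_cst a x 1) (df x).
by rewrite mul0r add0r.
Qed.

Lemma jet_smooth P f : (forall k, jet P k f) -> smooth f.
Proof.
move=> h; apply/smoothP => n; move: (h n.+1); elim: n f {h} => [|n IH] f [_ [f' [df jf]]].
  by exists f'.
by exists f'; split => //; exact: IH.
Qed.

Lemma jet_derive1n P k f : jet P k f -> P f^`(k)%classic.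
Proof.
elim: k f => [|k IH] f [Pf hf] //.
by have [f' [/is_derive_derive1 df jf]] := hf; rewrite derive1Sn df; exact: IH.
Qed.

(** The class for eta and [g]; the class [regular1] is the one for F. A product of two bounded
    square integrable functions is moreover integrable. *)
Definition regular2 f := [/\ continuous f, exists C, forall x, `|f x| <= C & L1 (fun x => f x ^+ 2)].
Definition regular1 f := [/\ continuous f, L1 f & L1 (fun x => f x ^+ 2)].

Lemma regular1D f g : regular1 f -> regular1 g -> regular1 (fun x => f x + g x).
Proof.
move=> [cf f1 f2] [cg g1 g2]; split; last first.
- by apply: sqr_L1D => //; exact: L1_measurable.
- exact: L1D.
- by move=> x; apply: cvgD; [exact: cf|exact: cg].
Qed.

Lemma regular1Z (a : R) f : regular1 f -> regular1 (fun x => a * f x).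
Proof.
move=> [cf f1 f2]; split; last first.
- exact: sqr_L1Z.
- exact: L1Z.
- by move=> x; apply: cvgM; [exact: cvg_cst|exact: cf].
Qed.

Lemma regular2M f g : regular2 f -> regular2 g -> regular1 (fun x => f x * g x).
Proof.
move=> [cf [C hC] f2] [cg [D hD] g2].
have mf := measurable_of_continuous cf; have mg := measurable_of_continuous cg.
split; last first.
- exact: (sqr_L1_bddM mf hC).
- exact: L1_mul2.
- by move=> x; apply: cvgM; [exact: cf|exact: cg].
Qed.

Definition L12 f := L1 f /\ L1 (fun x => f x ^+ 2).

Lemma regular2_inverse (A B : R -> R) : L12 A -> L12 B -> regular2 (inverse_transform A B).
Proof.
move=> [A1 A2] [B1 B2]; split.
- exact: inverse_transform_continuous.
- exists ((2 * pi)^-1 * (\int[mu]_x `|A x| + \int[mu]_x `|B x|)) => x.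
  rewrite normrM ger0_norm ?invr_ge0 ?mulr_ge0 ?pi_ge0//.
  rewrite ler_wpM2l ?invr_ge0 ?mulr_ge0 ?pi_ge0//.
  by apply: (le_trans (ler_normD _ _)); apply: lerD; [exact: Ct_bounded|exact: St_bounded].
- apply: sqr_L1Z; apply: sqr_L1D.
  + by apply: measurable_of_continuous; exact: Ct_continuous.
  + by apply: measurable_of_continuous; exact: St_continuous.
  + by have [] := bessel A1 A2.
  + by have [] := bessel B1 B2.
Qed.

Lemma is_derive_inverse (A B : R -> R) x : L1 A -> L1 B -> L1 (fun x => x * A x) ->
  L1 (fun x => x * B x) ->
  is_derive x 1 (inverse_transform A B) (inverse_transform (fun x => x * B x) (fun x => - (x * A x)) x).
Proof.
move=> A1 B1 xA xB.
have H := is_deriveM_fun (is_derive_cst ((2 * pi)^-1 : R) x 1)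
  (is_deriveD (is_derive_Ct A1 xA x) (is_derive_St B1 xB x)).
apply: (is_derive_eq H); rewrite /inverse_transform mul0r add0r /cst StN//.
by congr (_ * _); rewrite addrC.
Qed.

(** Powers of the variable on the transform count derivatives of the inverse transform. *)
Definition moments12 k f := forall i, (i <= k)%N -> L12 (fun x => x ^+ i * f x).

Lemma moments12_head k f : moments12 k f -> L12 f.
Proof. by move=> /(_ 0%N (leq0n _)); under eq_fun do rewrite expr0 mul1r. Qed.

Lemma moments12_Xmul k f : moments12 k.+1 f -> moments12 k (fun x => x * f x).
Proof.
move=> h i ik; have := h i.+1 ik.
by under [X in L12 X -> _]eq_fun do rewrite exprSr -mulrA.
Qed.

Lemma L12N f : L12 f -> L12 (fun x => - f x).
Proof.
move=> [f1 f2]; split; first exact: L1N.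
by under eq_fun do rewrite sqrrN.
Qed.

Lemma moments12N k f : moments12 k f -> moments12 k (fun x => - f x).
Proof. by move=> h i ik; under eq_fun do rewrite mulrN; apply: L12N; exact: h. Qed.

Lemma jet_inverse k (A B : R -> R) : moments12 k A -> moments12 k B ->
  jet regular2 k (inverse_transform A B).
Proof.
elim: k A B => [|k IH] A B hA hB; have A0 := moments12_head hA; have B0 := moments12_head hB.
  by split => //; exact: regular2_inverse.
split; first exact: regular2_inverse.
exists (inverse_transform (fun x => x * B x) (fun x => - (x * A x))).
have xA := moments12_Xmul hA; have xB := moments12_Xmul hB; split.
  move=> x; apply: is_derive_inverse; [exact: A0.1|exact: B0.1| |].
    exact: (moments12_head xA).1.
  exact: (moments12_head xB).1.
by apply: IH => //; exact: moments12N.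
Qed.

Definition bounded_sqr f := [/\ measurable_fun [set: R] f, exists C, forall x, `|f x| <= C &
  L1 (fun x => f x ^+ 2)].

(** Integration by parts trades each derivative of [f] for a power of the variable, and the Bessel
    inequality gives the square integrability. *)
Lemma jet_transform j k f : (j <= k)%N -> jet regular1 k f ->
  bounded_sqr (fun x => x ^+ j * Ct f x) /\ bounded_sqr (fun x => x ^+ j * St f x).
Proof.
elim: j k f => [|j IH] k f.
  move=> _ /jet_head[cf f1 f2]; have [h1 h2] := bessel f1 f2.
  split; under eq_fun do rewrite expr0 mul1r; split => //.
  - by apply: measurable_of_continuous; exact: Ct_continuous.
  - by eexists => x; exact: Ct_bounded.
  - by apply: measurable_of_continuous; exact: St_continuous.
  - by eexists => x; exact: St_bounded.
case: k => [//|k]; rewrite ltnS => jk jf.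
have [cf f1 f2] := jet_head jf; have [_ [f' [df jf']]] := jf.
have [cf' f1' f2'] := jet_head jf'.
have pf := derive_prim df cf'.
have [h1 h2] := IH k f' jk jf'.
split.
  rewrite (_ : (fun x => x ^+ j.+1 * Ct f x) = (fun x => - (x ^+ j * St f' x))).
    have [m2 [C hC] s2] := h2; split; first exact: measurableT_comp.
      by exists C => x; rewrite normrN.
    by under eq_fun do rewrite sqrrN.
  by apply/funext => x; rewrite (St_prim _ pf f1 f1') exprSr; ring.
rewrite (_ : (fun x => x ^+ j.+1 * St f x) = (fun x => x ^+ j * Ct f' x))//.
by apply/funext => x; rewrite (Ct_prim _ pf f1 f1') exprSr; ring.
Qed.

(** At infinity x N(x) is only O(1 / |x|), a rate that gives square integrability but not
    integrability. This is why moments are estimated as products of two square integrable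
    factors. *)
Lemma japanese_Xmul (N : R -> R) (K : R) : continuous N -> (forall x, `|N x| <= K * japanese x) ->
  bounded_sqr N /\ bounded_sqr (fun x => x * N x).
Proof.
move=> cN hN.
have K0 : 0 <= K.
  by have := le_trans (normr_ge0 _) (hN 0); rewrite pmulr_lge0// japanese_gt0.
have NK x : `|N x| <= K.
  by apply: (le_trans (hN x)); rewrite -[leRHS]mulr1 ler_wpM2l// japanese_le1.
have jx x : x ^+ 2 * japanese x <= 1.
  by rewrite /japanese ler_pdivrMr ?mul1r ?lerDr// ltr_pwDl// sqr_ge0.
have mN := measurable_of_continuous cN.
have mxN : measurable_fun [set: R] (fun x => x * N x) by exact: measurable_funM.
have hs x : (x * N x) ^+ 2 <= K ^+ 2 * japanese x.
  rewrite exprMn -[N x ^+ 2]real_normK ?num_real//.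
  apply: (@le_trans _ _ (x ^+ 2 * (K * japanese x) ^+ 2)).
    by rewrite ler_wpM2l ?sqr_ge0// lerXn2r// nnegrE// (le_trans _ (hN x)).
  rewrite exprMn mulrCA ler_wpM2l ?sqr_ge0// [japanese x ^+ 2]expr2 mulrA -[leRHS]mul1r.
  by rewrite ler_wpM2r// ltW// japanese_gt0.
split; split => //.
- by exists K.
- apply: (L1_leP _ (L1Z (K ^+ 2) L1_japanese)); first exact: measurable_funX.
  move=> x; rewrite ger0_norm ?sqr_ge0// -[N x ^+ 2]real_normK ?num_real//.
  apply: (@le_trans _ _ ((K * japanese x) ^+ 2)); first by rewrite lerXn2r// nnegrE// (le_trans _ (hN x)).
  rewrite exprMn ler_wpM2l ?sqr_ge0// expr2 -[leRHS]mul1r ler_wpM2r ?japanese_le1//.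
  exact/ltW/japanese_gt0.
- exists K => x; rewrite -(@ler_pXn2r _ 2)// ?nnegrE// real_normK ?num_real//.
  by apply: (le_trans (hs x)); rewrite -[leRHS]mulr1 ler_wpM2l ?sqr_ge0// japanese_le1.
- apply: (L1_leP _ (L1Z (K ^+ 2) L1_japanese)); first exact: measurable_funX.
  by move=> x; rewrite ger0_norm ?sqr_ge0.
Qed.

Lemma bounded_sqrM f g : bounded_sqr f -> bounded_sqr g -> L12 (fun x => f x * g x).
Proof.
move=> [mf [C hC] f2] [mg _ g2]; split; first exact: L1_mul2.
exact: (sqr_L1_bddM mf hC).
Qed.

Lemma L12_bddM (k : R -> R) (C : R) f : measurable_fun [set: R] k -> (forall x, `|k x| <= C) ->
  L12 f -> L12 (fun x => k x * f x).
Proof.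
move=> mk kC [f1 f2]; split; first exact: (L1_bddM mk f1 kC).
exact: (sqr_L1_bddM mk kC).
Qed.

Lemma moments12_bddM (k : R -> R) (C : R) n f : measurable_fun [set: R] k -> (forall x, `|k x| <= C) ->
  moments12 n f -> moments12 n (fun x => k x * f x).
Proof.
move=> mk kC h i ik; under eq_fun do rewrite mulrCA.
by apply: (L12_bddM mk kC); exact: h.
Qed.

(** The multiplier gains one power: x^(i+1) N f is the product of x N and x^i f, both bounded and
    square integrable. *)
Lemma moments12_multiplier (N : R -> R) (K : R) k f : continuous N ->
  (forall x, `|N x| <= K * japanese x) ->
  (forall j, (j <= k)%N -> bounded_sqr (fun x => x ^+ j * f x)) ->
  moments12 k.+1 (fun x => N x * f x).
Proof.
move=> cN hN hf [|i] ik; have [N0 N1] := japanese_Xmul cN hN.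
  under eq_fun do rewrite expr0 mul1r; apply: bounded_sqrM => //.
  by have := hf 0%N isT; under eq_fun do rewrite expr0 mul1r.
have -> : (fun x => x ^+ i.+1 * (N x * f x)) = (fun x => x * N x * (x ^+ i * f x)).
  by apply/funext => x; rewrite exprS; ring.
by apply: bounded_sqrM => //; exact: hf.
Qed.

End jets.

(** * Gain of regularity for the travelling wave *)

Section bootstrap.
Context {R : realType}.
Local Notation mu := (@lebesgue_measure R).
Context (c : R) (a b a1 b1 : R -> R).
Context (m : R -> R) (mm : measurable_fun [set: R] m) (Km : R) (mK : forall x, `|m x| <= Km).
Context (N : R -> R) (cN : continuous N) (KN : R) (NK : forall x, `|N x| <= KN * japanese x).

Local Notation eta := (weta a b).
Local Notation eta1 := (weta1 a b a1 b1).
Local Notation F := (wforce a b a1 b1).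

Lemma wforce_ae g h : measurable_fun [set: R] h -> wave c a b a1 b1 g -> {ae mu, forall x, g x = h x} ->
  Ct (F g) = Ct (F h) /\ St (F g) = St (F h).
Proof.
move=> mh W gh.
have E : {ae mu, forall x, F g x = F h x} by apply: ae_imp gh => x; rewrite /wforce => ->.
have mF : measurable_fun [set: R] (F g) by apply: L1_measurable; exact: (wforce_L1 W).
have mFh : measurable_fun [set: R] (F h).
  have mFg : measurable_fun [set: R] (fun x => F g x + 2 * (eta x * (h x - g x))).
    apply: measurable_funD => //; apply: measurable_funM => //; apply: measurable_funM.
      by apply: measurable_of_continuous; exact: (weta_continuous W).
    by apply: measurable_funB => //; exact: (wave_mg W).
  by move: mFg; congr measurable_fun; apply/funext => x; rewrite /wforce; ring.
split; apply/funext => x; apply: eq_ae_int.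
- by apply: measurable_funM => //; exact: measurable_cosM.
- by apply: measurable_funM => //; exact: measurable_cosM.
- by apply: ae_imp E => y ->.
- by apply: measurable_funM => //; exact: measurable_sinM.
- by apply: measurable_funM => //; exact: measurable_sinM.
- by apply: ae_imp E => y ->.
Qed.

Lemma wave_ae g h : continuous h -> wave c a b a1 b1 g -> {ae mu, forall x, g x = h x} ->
  wave c a b a1 b1 h.
Proof.
move=> ch W gh; have mh := measurable_of_continuous ch.
have [pa pb pa1 pb1 mg e2 a12 b12 g2] := W.
have ma := measurable_of_continuous (prim_continuous pa).
have mb := measurable_of_continuous (prim_continuous pb).
have ma1 := measurable_of_continuous (prim_continuous pa1).
have mb1 := measurable_of_continuous (prim_continuous pb1).
split => //.
- apply: (eq_ae_prim pa1); last by apply: ae_imp gh => x ->.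
  by apply: measurable_funB; exact: measurable_funM.
- apply: (eq_ae_prim pb1); last by apply: ae_imp gh => x ->.
  apply: measurable_funB; last exact: measurable_funM.
  by apply: measurableT_comp => //; exact: measurable_funM.
- by apply: (eq_ae_L1 _ g2); [exact: measurable_funX|apply: ae_imp gh => x ->].
Qed.

Local Notation A g := (fun x => N x * Ct (F g) x).
Local Notation B g := (fun x => N x * St (F g) x).
Local Notation mA g := (fun x => m x * (N x * Ct (F g) x)).
Local Notation mB g := (fun x => m x * (N x * St (F g) x)).

Lemma wave_moments1 g : wave c a b a1 b1 g -> moments12 1 (A g) /\ moments12 1 (B g).
Proof.
move=> W; have F1 := wforce_L1 W; have F2 := wforce_sqr W; have [h1 h2] := bessel F1 F2.
split; apply: (moments12_multiplier cN NK) => j; rewrite leqn0 => /eqP ->;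
  under eq_fun do rewrite expr0 mul1r; split => //.
- by apply: measurable_of_continuous; exact: Ct_continuous.
- by eexists => x; exact: Ct_bounded.
- by apply: measurable_of_continuous; exact: St_continuous.
- by eexists => x; exact: St_bounded.
Qed.

(** Known up to a null set, [g] is replaced by the inverse of its transform, which is continuous.
    The source F changes on a null set only, so its transforms, and the formulas built on them, are
    unaffected. *)
Lemma wave_regularize g : wave c a b a1 b1 g ->
  transform_pair eta (A g) (B g) -> transform_pair g (mA g) (mB g) ->
  exists h, [/\ wave c a b a1 b1 h, {ae mu, forall x, g x = h x},
    forall x, h x = inverse_transform (mA h) (mB h) x &
    forall x, eta x = inverse_transform (A h) (B h) x].
Proof.
move=> W te tg; have [hA hB] := wave_moments1 W.
have [A1 _] := moments12_head hA; have [B1 _] := moments12_head hB.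
have [mA1 _] := moments12_head (moments12_bddM mm mK hA).
have [mB1 _] := moments12_head (moments12_bddM mm mK hB).
pose h := inverse_transform (mA g) (mB g).
have ch : continuous h by exact: inverse_transform_continuous.
have sg : slow g by apply: slow_sqr; [exact: (wave_mg W)|exact: (wave_g_sqr W)].
have gh : {ae mu, forall x, g x = h x} by exact: transform_pair_inversion.
have se : slow eta.
  apply: slow_sqr; last exact: (wave_eta_sqr W).
  by apply: measurable_of_continuous; exact: (weta_continuous W).
have eh := transform_pair_inversion se A1 B1 te.
have [EC ES] := wforce_ae (measurable_of_continuous ch) W gh.
exists h; split.
- exact: (wave_ae ch W gh).
- exact: gh.
- by move=> x; rewrite -EC -ES.
- move=> x; rewrite -EC -ES; apply: (continuous_ae_eq (weta_continuous W) _ eh).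
  exact: inverse_transform_continuous.
Qed.

Context (g : R -> R) (W : wave c a b a1 b1 g).
Context (hg : forall x, g x = inverse_transform (mA g) (mB g) x).
Context (he : forall x, eta x = inverse_transform (A g) (B g) x).

Let jets_of_moments k : moments12 k (A g) -> moments12 k (B g) ->
  jet regular2 k eta /\ jet regular2 k g.
Proof.
move=> hA hB; have Ee : eta = inverse_transform (A g) (B g) := funext he.
have Eg : g = inverse_transform (mA g) (mB g) := funext hg.
have je := jet_inverse hA hB; rewrite -Ee in je.
have jg := jet_inverse (moments12_bddM mm mK hA) (moments12_bddM mm mK hB).
by rewrite -Eg in jg; split.
Qed.

Lemma wave_g_continuous : continuous g.
Proof.
have [hA hB] := wave_moments1 W; have [_ /jet_head[]] := jets_of_moments hA hB.
by [].
Qed.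

Let cg := wave_g_continuous.
Let ca := prim_continuous (wave_a W).
Let cb := prim_continuous (wave_b W).
Let ca1 := prim_continuous (wave_a1 W).
Let cb1 := prim_continuous (wave_b1 W).

Lemma is_derive_wave_a (x : R) : is_derive x 1 a (a1 x).
Proof. by apply: (prim_derivable (wave_a W)); exact: ca1. Qed.

Lemma is_derive_wave_b (x : R) : is_derive x 1 b (b1 x).
Proof. by apply: (prim_derivable (wave_b W)); exact: cb1. Qed.

Lemma is_derive_wave_a1 (x : R) : is_derive x 1 a1 (c * b1 x - a x * g x).
Proof.
apply: (prim_derivable (wave_a1 W)); apply: cvgB; apply: cvgM.
- exact: cvg_cst.
- exact: cb1.
- exact: ca.
- exact: cg.
Qed.

Lemma is_derive_wave_b1 (x : R) : is_derive x 1 b1 (- (c * a1 x) - b x * g x).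
Proof.
apply: (prim_derivable (wave_b1 W)); apply: cvgB.
  by apply: cvgN; apply: cvgM; [exact: cvg_cst|exact: ca1].
by apply: cvgM; [exact: cb|exact: cg].
Qed.

Lemma is_derive_weta (x : R) : is_derive x 1 eta (eta1 x).
Proof. by apply: (prim_derivable (weta_prim W)); exact: (weta1_continuous W). Qed.

(** In the derivative of |u'|^2 the terms with c cancel and eta' g remains. Thus u' disappears from
    the derivatives of F, and each of their terms has a factor eta or eta' to be differentiated. *)
Lemma is_derive_wforce g' (x : R) : is_derive x 1 g g' ->
  is_derive x 1 (F g) (4 * (eta1 x * g x) + 2 * (eta x * g')).
Proof.
move=> dg; have da1 := is_derive_wave_a1 x; have db1 := is_derive_wave_b1 x.
have h1 := is_deriveD (is_deriveM_fun da1 da1) (is_deriveM_fun db1 db1).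
have h2 := is_deriveM_fun (is_derive_weta x) dg.
have H := is_deriveD (is_deriveM_fun (is_derive_cst (2 : R) x 1) h1) (is_deriveM_fun (is_derive_cst (2 : R) x 1) h2).
apply: (@is_derive_eq _ _ _ (F g) x 1 _ _ H).
rewrite !mul0r !add0r /cst /weta1 /=.
ring.
Qed.

Lemma wforce_continuous : continuous (F g).
Proof.
move=> x; apply: cvgD.
  apply: cvgM; first exact: cvg_cst.
  by under eq_fun do rewrite !expr2; apply: cvgD; apply: cvgM;
    [exact: ca1|exact: ca1|exact: cb1|exact: cb1].
apply: cvgM; first exact: cvg_cst.
by apply: cvgM; [exact: (weta_continuous W)|exact: cg].
Qed.

Let jet_wforce k : jet regular2 k eta -> jet regular2 k g -> jet regular1 k (F g).
Proof.
have rF : regular1 (F g).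
  by split; [exact: wforce_continuous|exact: (wforce_L1 W)|exact: (wforce_sqr W)].
case: k => [|k] je jg; first by split.
split => //; have [_ [g' [dg jg']]] := jg.
exists (fun x => 4 * (eta1 x * g x) + 2 * (eta x * g' x)); split.
  by move=> x; exact: is_derive_wforce.
have je1 := jet_step is_derive_weta je.
apply: jetD; first exact: regular1D.
  apply: jetZ; first by move=> f; exact: regular1Z.
  apply: (jetM regular2M regular1D) => //; exact: jet_pred.
apply: jetZ; first by move=> f; exact: regular1Z.
apply: (jetM regular2M regular1D) => //; exact: jet_pred.
Qed.

(** One turn of the loop: k + 1 moments of the transforms give k + 1 derivatives of eta and [g],
    hence of F. These give k + 1 powers of decay for the transforms of F, and the multiplier adds
    one more. *)
Lemma wave_jets k : [/\ jet regular2 k eta, jet regular2 k g & jet regular1 k (F g)].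
Proof.
suff [h1 h2] : moments12 k.+1 (A g) /\ moments12 k.+1 (B g).
  have [je jg] := jets_of_moments h1 h2.
  have je0 := jet_pred je; have jg0 := jet_pred jg.
  by split => //; exact: jet_wforce.
elim: k => [|k [IHA IHB]]; first exact: wave_moments1.
have [je jg] := jets_of_moments IHA IHB.
have jF := jet_wforce je jg.
by split; apply: (moments12_multiplier cN NK) => j jk; have [] := jet_transform jk jF.
Qed.

Lemma wave_smooth : [/\ smooth a, smooth b, smooth eta, smooth g & smooth (F g)].
Proof.
have sg : smooth g by apply: (@jet_smooth _ regular2) => k; have [] := wave_jets k.
have se : smooth eta by apply: (@jet_smooth _ regular2) => k; have [] := wave_jets k.
have sF : smooth (F g) by apply: (@jet_smooth _ regular1) => k; have [] := wave_jets k.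
(* With [g] smooth, the second order system for a and b is closed and their regularity follows by
   induction. *)
suff h : forall n, [/\ Cn n a, Cn n b, Cn n a1 & Cn n b1].
  split; [| |exact: se|exact: sg|exact: sF].
  - by apply/smoothP => n; have [] := h n.
  - by apply/smoothP => n; have [] := h n.
elim=> [|n [ha hb ha1 hb1]].
  split; eexists; (split; last exact: I).
  - exact: is_derive_wave_a.
  - exact: is_derive_wave_b.
  - exact: is_derive_wave_a1.
  - exact: is_derive_wave_b1.
have Ccst (k : R) : Cn n (fun=> k) by move: n {ha hb ha1 hb1}; apply/smoothP; exact: smooth_cst.
have hgn : Cn n g by move: n {ha hb ha1 hb1 Ccst}; apply/smoothP.
split.
- by exists a1; split => // x; exact: is_derive_wave_a.
- by exists b1; split => // x; exact: is_derive_wave_b.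
- exists (fun x => c * b1 x - a x * g x); split => [x|]; first exact: is_derive_wave_a1.
  rewrite (_ : (fun x => _) = (fun x => c * b1 x + (- a x) * g x)).
    apply: CnD; apply: CnM => //.
    by under eq_fun do rewrite -mulN1r; apply: CnM.
  by apply/funext => x; ring.
- exists (fun x => - (c * a1 x) - b x * g x); split => [x|]; first exact: is_derive_wave_b1.
  rewrite (_ : (fun x => _) = (fun x => (- c) * a1 x + (- b x) * g x)).
    apply: CnD; apply: CnM => //.
    by under eq_fun do rewrite -mulN1r; apply: CnM.
  by apply/funext => x; ring.
Qed.

End bootstrap.

(** * Algebraic decay *)

Section weights.
Context {R : realType}.
Local Notation mu := (@lebesgue_measure R).
Implicit Types (f g : R -> R) (x y l r : R).

Definition weight l x : R := (1 + `|x|) `^ l.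

Lemma weight_base_gt0 x : 0 < 1 + `|x|.
Proof. by rewrite ltr_pwDl. Qed.

Lemma weight_base_ge1 x : 1 <= 1 + `|x|.
Proof. by rewrite lerDl. Qed.

Lemma weightE l x : weight l x = expR (l * ln (1 + `|x|)).
Proof. by rewrite /weight /powR gt_eqF// weight_base_gt0. Qed.

Lemma weight_gt0 l x : 0 < weight l x.
Proof. exact/powR_gt0/weight_base_gt0. Qed.

Lemma weight_ge0 l x : 0 <= weight l x. Proof. exact/ltW/weight_gt0. Qed.

Lemma powR_le_weight l x y : 0 <= l -> `|y| <= 1 + `|x| -> `|y| `^ l <= weight l x.
Proof. by move=> l0 yx; apply: ge0_ler_powR; rewrite ?nnegrE// ltW// weight_base_gt0. Qed.

Lemma norm_le_near x y : `|x - y| <= 1 -> `|y| <= 1 + `|x|.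
Proof. by have := ler_normB x (x - y); rewrite opprB addrC subrK; lra. Qed.

Lemma weightD l r x : weight (l + r) x = weight l x * weight r x.
Proof. by rewrite !weightE mulrDl expRD. Qed.

Lemma weight_continuous l : continuous (weight l).
Proof.
rewrite (funext (weightE l)) => x.
apply: (@continuous_comp _ _ _ (fun x => l * ln (1 + `|x|)) expR); last exact: continuous_expR.
apply: cvgM; first exact: cvg_cst.
apply: (@continuous_comp _ _ _ (fun x => 1 + `|x|) (@ln R)).
  by apply: cvgD; [exact: cvg_cst|exact: norm_continuous].
exact/continuous_ln/weight_base_gt0.
Qed.

Lemma is_derive_expln (r : R) x : 0 < 1 + x ->
  is_derive x 1 (fun x => expR (r * ln (1 + x))) (r * (1 + x)^-1 * expR (r * ln (1 + x))).
Proof.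
move=> x1.
have h1 : is_derive x 1 (fun x => 1 + x : R) 1.
  by have := is_deriveD (is_derive_cst (1 : R) x 1) (is_derive_id x (1 : R)); rewrite add0r.
have h2 : is_derive x 1 (fun x => ln (1 + x) : R) ((1 + x)^-1).
  have := @is_derive1_comp _ (@ln R) (fun x => 1 + x) x _ _ (is_derive1_ln x1) h1.
  by rewrite mulr1.
have h3 : is_derive x 1 (fun x => r * ln (1 + x)) (r * (1 + x)^-1).
  by have := is_deriveM_fun (is_derive_cst r x 1) h2; rewrite mul0r add0r.
have := @is_derive1_comp _ (@expR R) (fun x => r * ln (1 + x)) x _ _ (is_derive_expR _) h3.
by rewrite mulrC.
Qed.

Lemma L1_weight (r : R) : 1 < r -> L1 (weight (- r)).
Proof.
move=> r1; have r0 : 1 - r != 0 by rewrite subr_eq0 lt_eqF.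
have [||||||p1 _] := @even_integral R (weight (- r)) (fun x => (1 - r)^-1 * expR ((1 - r) * ln (1 + x))) ((1 - r)^-1 * 0).
- by move=> x; exact: weight_ge0.
- exact: weight_continuous.
- by move=> x; rewrite /weight normrN.
- move=> x x0; have x1 : 0 < 1 + x by rewrite addr_gt0.
  have := is_deriveM_fun (is_derive_cst ((1 - r)^-1) x 1) (is_derive_expln (1 - r) x1).
  rewrite mul0r add0r /cst; congr (is_derive _ _ _ _).
  have -> : weight (- r) x = (1 + x)^-1 * expR ((1 - r) * ln (1 + x)).
    rewrite weightE (gtr0_norm x0) mulrBl mul1r expRD lnK ?posrE// mulrA mulVf ?mul1r ?gt_eqF//.
    by rewrite mulNr.
  by rewrite mulrA mulrA mulVf// mul1r.
- apply: cvgM; first exact: cvg_cst.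
  have h0 : (0 : R) < 1 + 0 by rewrite addr0.
  have h1 := is_derive_expln (1 - r) h0.
  have /derivable1_diffP : derivable (fun x => expR ((1 - r) * ln (1 + x))) (0 : R) 1 by have [] := h1.
  by move=> /differentiable_continuous.
- apply: cvgM; first exact: cvg_cst.
  have -> : (fun x : R => expR ((1 - r) * ln (1 + x))) = (fun x => expR (- ((r - 1) * ln (1 + x)))).
    by apply/funext => x; congr expR; ring.
  apply: (@cvg_comp _ _ _ (fun x => (r - 1) * ln (1 + x)) (fun y => expR (- y)) _ +oo); last exact: cvgr_expR.
  apply/cvgryPge => A; near=> x.
  rewrite -ler_pdivrMl ?subr_gt0// -[leLHS]expRK ler_ln ?posrE ?expR_gt0//.
    rewrite -lerBlDl.
    by near: x; apply: nbhs_pinfty_ge; rewrite num_real.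
  apply: ltr_pwDl; first exact: ltr01.
  by near: x; apply: nbhs_pinfty_ge; rewrite num_real.
  exact: p1.
Unshelve. all: by end_near. Qed.

(* Truncated at level n, the weight is bounded, so that the weighted integrals
   are known to be finite before they are estimated. *)
Definition tweight l (n : nat) x : R := (Num.min (1 + `|x|) n.+1%:R) `^ l.

Lemma tweight_base_ge1 n x : 1 <= Num.min (1 + `|x|) (n.+1%:R : R).
Proof. by rewrite le_min weight_base_ge1 ler1n. Qed.

Lemma tweightE l n x : tweight l n x = expR (l * ln (Num.min (1 + `|x|) n.+1%:R)).
Proof. by rewrite /tweight /powR gt_eqF// (lt_le_trans _ (tweight_base_ge1 n x)). Qed.

Lemma tweight_base_ge0 n x : 0 <= Num.min (1 + `|x|) (n.+1%:R : R).
Proof. exact: le_trans ler01 (tweight_base_ge1 n x). Qed.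

Lemma tweight_ge0 l n x : 0 <= tweight l n x.
Proof. exact: powR_ge0. Qed.

Lemma tweight_le l n x : 0 <= l -> tweight l n x <= weight l x.
Proof.
move=> l0; apply: ge0_ler_powR => //; rewrite ?nnegrE ?tweight_base_ge0 ?(ltW (weight_base_gt0 x))//.
by rewrite ge_min lexx.
Qed.

Lemma tweight_bounded l n x : 0 <= l -> tweight l n x <= n.+1%:R `^ l.
Proof.
move=> l0; apply: ge0_ler_powR => //; rewrite ?nnegrE ?tweight_base_ge0//.
by rewrite ge_min lexx orbT.
Qed.

Lemma tweight_mono l x : 0 <= l -> nondecreasing_seq (fun n => tweight l n x).
Proof.
move=> l0 m n mn; apply: ge0_ler_powR => //; rewrite ?nnegrE ?tweight_base_ge0//.
rewrite le_min !ge_min lexx/=; apply/orP; right.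
by rewrite ler_nat ltnS.
Qed.

Lemma tweight_cvg l x : tweight l n x @[n --> \oo] --> weight l x.
Proof.
apply: cvg_near_cst; near=> n; rewrite /tweight /weight; congr (_ `^ _).
apply/min_idPl; apply: (@le_trans _ _ n%:R); last by rewrite ler_nat.
by near: n; exact: nbhs_infty_ger.
Unshelve. all: by end_near. Qed.

Lemma tweight_continuous l n : continuous (tweight l n).
Proof.
rewrite (funext (tweightE l n)) => x.
apply: (@continuous_comp _ _ _ (fun x => l * ln (Num.min (1 + `|x|) n.+1%:R)) expR); last exact: continuous_expR.
apply: cvgM; first exact: cvg_cst.
apply: (@continuous_comp _ _ _ (fun x => Num.min (1 + `|x|) n.+1%:R) (@ln R)).
  apply: continuous_min; last exact: cvg_cst.
  by apply: cvgD; [exact: cvg_cst|exact: norm_continuous].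
by apply: continuous_ln; rewrite (lt_le_trans _ (tweight_base_ge1 n x)).
Qed.

(** On bases this is 1 + |x| <= (1 + |z|) (1 + |x - z|). Truncating x and x - z preserves it because
    1 + |z| >= 1; the weight in z, which will fall on the kernel, stays complete. *)
Lemma tweight_submult l n x z : 0 <= l -> tweight l n x <= weight l z * tweight l n (x - z).
Proof.
move=> l0; rewrite /weight /tweight -powRM; last 2 first.
- exact/ltW/weight_base_gt0.
- exact: tweight_base_ge0.
have z1 := weight_base_ge1 z; have xz1 := weight_base_ge1 (x - z).
have n1 : (1 : R) <= n.+1%:R by rewrite ler1n.
have tri : `|x| <= `|z| + `|x - z| by have := ler_normD z (x - z); rewrite addrC subrK addrC.
apply: ge0_ler_powR => //; rewrite ?nnegrE.
- exact: tweight_base_ge0.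
- by rewrite mulr_ge0 ?tweight_base_ge0// ltW// weight_base_gt0.
have [h1|h1] := leP (1 + `|x - z|) n.+1%:R.
  rewrite ge_min; apply/orP; left; nra.
rewrite ge_min; apply/orP; right; nra.
Qed.

End weights.

(** * Convolutions and weights *)

Section convolution.
Context {R : realType}.
Local Notation mu := (@lebesgue_measure R).
Implicit Types (l f h e v w : R -> R).

Definition convol l h (x : R) := \int[mu]_y (l y * h (x - y)).

Lemma continuous_reflect h (x : R) : continuous h -> continuous (fun y => h (x - y)).
Proof.
move=> ch y; apply: (@continuous_comp _ _ _ (fun y => x - y) h); last exact: ch.
by apply: cvgB; [exact: cvg_cst|exact: cvg_id].
Qed.

Lemma convol_L1 l h (C x : R) : L1 l -> continuous h -> (forall y, `|h y| <= C) ->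
  L1 (fun y => l y * h (x - y)).
Proof.
move=> l1 ch hC; apply: (@L1_bddMr _ _ _ C) => //.
by apply: measurable_of_continuous; exact: continuous_reflect.
Qed.

Lemma is_derive_convol l h h' (C D : R) : L1 l -> (forall x : R, is_derive x 1 h (h' x)) ->
  (forall y, `|h y| <= C) -> (forall y, `|h' y| <= D) ->
  forall x : R, is_derive x 1 (convol l h) (convol l h' x).
Proof.
move=> l1 dh hC hD; apply: (@is_derive_int R (fun x y => l y * h (x - y)) (fun x y => l y * h' (x - y)) (fun y => D * `|l y|)).
- by move=> x; apply: (convol_L1 x l1 _ hC); exact: is_derive_continuous dh.
- by apply: L1Z; exact: L1_norm.
- move=> x y.
  have h1 := is_derive_comp_affine 1 (- y) dh x.
  have := is_deriveM_fun (is_derive_cst (l y) x 1) h1.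
  rewrite mul0r add0r mul1r /cst mul1r.
  by under eq_fun do rewrite mul1r.
- by move=> x y; rewrite normrM mulrC ler_wpM2r.
Qed.

(** Weighted Young inequality, by Tonelli. Two weights are allowed because the kernel carries the
    full weight and the unknown a truncated one. *)
Lemma convol_weight l h e v w (C : R) : L1 (fun y => v y * l y) -> measurable_fun [set: R] l ->
  continuous h -> measurable_fun [set: R] e -> continuous v -> continuous w ->
  (forall x, 0 <= v x) -> (forall x, 0 <= w x) ->
  (forall x z, w x <= v z * w (x - z)) ->
  L1 l -> (forall y, `|h y| <= C) -> (forall x, e x = convol l h x) -> L1 (fun x => w x * h x) ->
  L1 (fun x => w x * e x) /\
  \int[mu]_x (w x * `|e x|) <= \int[mu]_y (v y * `|l y|) * \int[mu]_x (w x * `|h x|).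
Proof.
move=> vl ml ch me cv cw v0 w0 vw l1 hC eE wh.
have mv := measurable_of_continuous cv; have mw := measurable_of_continuous cw.
have mh := measurable_of_continuous ch.
have vl' : L1 (fun y => v y * `|l y|).
  by have := L1_norm vl; under eq_fun do rewrite normrM (ger0_norm (v0 _)).
have wh' : L1 (fun y => w y * `|h y|).
  by have := L1_norm wh; under eq_fun do rewrite normrM (ger0_norm (w0 _)).
have mwe : measurable_fun [set: R] (fun x => w x * `|e x|).
  by apply: measurable_funM => //; exact: measurableT_comp.
pose A := \int[mu]_y (v y * `|l y|); pose B := \int[mu]_x (w x * `|h x|).
pose k (z : R * R) := v z.2 * `|l z.2| * (w (z.1 - z.2) * `|h (z.1 - z.2)|).
have msub : measurable_fun [set: R * R] (fun z : R * R => z.1 - z.2).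
  by apply: measurable_funB; [exact: measurable_fst|exact: measurable_snd].
have mk : measurable_fun [set: R * R] k.
  apply: measurable_funM; first apply: (measurable_snd_comp (f := fun y => v y * `|l y|)).
    exact: L1_measurable.
  apply: (@measurableT_comp _ _ _ _ _ _ (fun y => w y * `|h y|)) => //.
  exact: L1_measurable.
have k0 z : 0 <= k z by rewrite !mulr_ge0.
have H : (\int[mu]_x (w x * `|e x|)%:E <= (A * B)%:E)%E.
  apply: (@le_trans _ _ (\int[mu]_x \int[mu]_y (k (x, y))%:E)%E).
    apply: ge0_le_integral => //.
    - by move=> x _; rewrite lee_fin mulr_ge0.
    - exact/measurable_EFinP.
    - apply: (@measurable_fun_fubini_tonelli_F _ _ (measurableTypeR R)
        (measurableTypeR R) R mu (fun z => (k z)%:E)) => //.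
      exact/measurable_EFinP.
    move=> x _.
    have lh := convol_L1 x l1 ch hC.
    apply: (@le_trans _ _ (\int[mu]_y (w x * `|l y * h (x - y)|)%:E)%E).
      rewrite L1_EFin; last by apply: L1Z; exact: L1_norm.
      rewrite intZ; last exact: L1_norm.
      by rewrite lee_fin eE ler_wpM2l// int_norm.
    apply: ge0_le_integral => //.
    - by move=> y _; rewrite lee_fin mulr_ge0.
    - by apply: L1_EFin_measurable; apply: L1Z; exact: L1_norm.
    - apply/measurable_EFinP.
      apply: measurable_funM; first exact: L1_measurable.
      apply: (@measurableT_comp _ _ _ _ _ _ (fun y => w y * `|h y|)); first exact: L1_measurable.
      have mB : measurable_fun [set: R] (fun y : R => x - y).
        by apply: measurable_of_continuous => t; apply: cvgB; [exact: cvg_cst|exact: cvg_id].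
      exact: mB.
    move=> y _; rewrite lee_fin /k /= normrM mulrA mulrA; apply: ler_wpM2r => //.
    by rewrite [leRHS]mulrAC ler_wpM2r.
  rewrite tonelli//.
  have E y : (\int[mu]_x (k (x, y))%:E = (v y * `|l y| * B)%:E)%E.
    have := @ge0_integral_shift R (- y) (fun z => v y * `|l y| * (w z * `|h z|)).
    rewrite /k /= => ->.
    - rewrite L1_EFin; last exact: L1Z.
      by rewrite intZ.
    - by apply: L1_measurable; exact: L1Z.
    - by move=> x; rewrite !mulr_ge0.
  under eq_integral do rewrite E.
  rewrite L1_EFin; last exact: L1Zr.
  under eq_Rintegral do rewrite mulrC.
  by rewrite intZ// mulrC.
have L : L1 (fun x => w x * e x).
  apply: L1P; first exact: measurable_funM.
  under eq_integral do rewrite normrM (ger0_norm (w0 _)).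
  by apply: (le_lt_trans H); rewrite ltry.
split => //.
rewrite -lee_fin -L1_EFin//.
by have := L1_norm L; under eq_fun do rewrite normrM (ger0_norm (w0 _)).
Qed.

End convolution.

(** * Convolution theorem for a kernel without sine transform *)

Section inversion_convolution.
Context {R : realType}.
Local Notation mu := (@lebesgue_measure R).
Implicit Types (l f h : R -> R).

Lemma integrable_inversion f : continuous f -> L1 f -> L1 (Ct f) -> L1 (St f) ->
  forall x, f x = inverse_transform (Ct f) (St f) x.
Proof.
move=> cf f1 C1 S1; apply: continuous_ae_eq => //; first exact: inverse_transform_continuous.
by apply: (transform_pair_inversion _ C1 S1); [exact: slow_L1|exact: transform_pair_L1].
Qed.

Lemma inverse_transform_sub (A B : R -> R) x y : L1 A -> L1 B ->
  Ct A (x - y) + St B (x - y) =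
  Ct (fun xi => A xi * cos (xi * x) + B xi * sin (xi * x)) y +
  St (fun xi => A xi * sin (xi * x) - B xi * cos (xi * x)) y.
Proof.
move=> A1 B1; rewrite /Ct /St -intD; [|exact: L1_cos|exact: L1_sin].
rewrite -intD.
- by apply: int_eq => xi; rewrite mulrBr cosB sinB; ring.
- by apply: L1_cos; apply: L1D; [exact: L1_cos|exact: L1_sin].
- by apply: L1_sin; apply: L1B; [exact: L1_sin|exact: L1_cos].
Qed.

(** The inversion formula for [f] is inserted into the convolution, and the transforms are then
    transposed onto [l]. *)
Lemma convol_inverse_transform l f : L1 l -> (forall xi, St l xi = 0) ->
  continuous f -> L1 f -> L1 (Ct f) -> L1 (St f) ->
  forall x, inverse_transform (fun xi => Ct l xi * Ct f xi) (fun xi => Ct l xi * St f xi) x =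
    convol l f x.
Proof.
move=> l1 Sl cf f1 C1 S1 x.
pose D xi := Ct f xi * cos (xi * x) + St f xi * sin (xi * x).
pose E xi := Ct f xi * sin (xi * x) - St f xi * cos (xi * x).
have D1 : L1 D by apply: L1D; [exact: L1_cos|exact: L1_sin].
have E1 : L1 E by apply: L1B; [exact: L1_sin|exact: L1_cos].
have fE y : f (x - y) = (2 * pi)^-1 * (Ct D y + St E y).
  by rewrite (integrable_inversion cf f1 C1 S1) /inverse_transform inverse_transform_sub.
have L : L1 (fun y => l y * (Ct D y + St E y)).
  apply: (@L1_bddMr _ _ _ (\int[mu]_x `|D x| + \int[mu]_x `|E x|)) => //.
    by apply: measurable_of_continuous => y; apply: cvgD; [exact: Ct_continuous|exact: St_continuous].
  by move=> y; apply: (le_trans (ler_normD _ _)); apply: lerD; [exact: Ct_bounded|exact: St_bounded].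
have lC : L1 (fun y => l y * Ct D y).
  apply: (@L1_bddMr _ _ _ (\int[mu]_x `|D x|)) => //.
    by apply: measurable_of_continuous; exact: Ct_continuous.
  by move=> y; exact: Ct_bounded.
have lS : L1 (fun y => l y * St E y).
  apply: (@L1_bddMr _ _ _ (\int[mu]_x `|E x|)) => //.
    by apply: measurable_of_continuous; exact: St_continuous.
  by move=> y; exact: St_bounded.
rewrite /convol; under [RHS]eq_Rintegral do rewrite fE mulrCA.
rewrite intZ//; congr (_ * _).
under [RHS]eq_Rintegral do rewrite mulrDr.
rewrite intD// int_Ct// int_St//.
rewrite [X in _ = _ + X](_ : _ = 0); last first.
  by rewrite (int_eq (g := fun=> 0)) ?int0// => xi; rewrite Sl mul0r.
rewrite addr0 /Ct /St -intD.
- by apply: int_eq => xi; rewrite /D /Ct /St; ring.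
- apply: L1_cos; apply: (@L1_bddM _ _ _ (\int[mu]_x `|l x|)) => //.
    by apply: measurable_of_continuous; exact: Ct_continuous.
  by move=> y; exact: Ct_bounded.
- apply: L1_sin; apply: (@L1_bddM _ _ _ (\int[mu]_x `|l x|)) => //.
    by apply: measurable_of_continuous; exact: Ct_continuous.
  by move=> y; exact: Ct_bounded.
Qed.

End inversion_convolution.

(** * Comparison of functions at infinity *)

Section smallness.
Context {R : realType}.
Implicit Types (f g h : R -> R).

Definition vanish f := forall e, 0 < e -> exists r : R, forall y, r <= `|y| -> `|f y| <= e.

Lemma cvg0_vanish f : f x @[x --> +oo] --> 0 -> f x @[x --> -oo] --> 0 -> vanish f.
Proof.
move=> fp fm e e0.
have /cvgrPdist_le/(_ _ e0)[r [_ hr]] := fp.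
have /cvgrPdist_le/(_ _ e0)[s [_ hs]] := fm.
exists (1 + (`|r| + `|s|)) => y; have r0 := ler_norm r; have s0 := ler_norm (- s).
have r1 := normr_ge0 r; have s1 := normr_ge0 s; rewrite normrN in s0.
have [y0|y0] := leP 0 y; [rewrite (ger0_norm y0)|rewrite (ltr0_norm y0)] => h.
  by have := hr y; rewrite sub0r normrN; apply => /=; lra.
by have := hs y; rewrite sub0r normrN; apply => /=; lra.
Qed.

(** Vanishing at infinity comes from square integrability of a function and of its derivative, so
    the top order is spent. *)
Lemma jet_vanish k f : jet regular2 k.+1 f -> jet vanish k f.
Proof.
have van f0 f0' : (forall x : R, is_derive x 1 f0 (f0' x)) -> regular2 f0 -> regular2 f0' -> vanish f0.
  move=> df [_ _ f2] [cf' _ f2'].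
  have [] := prim_cvg0_sqr (derive_prim df cf') (measurable_of_continuous cf') f2 f2'.
  exact: cvg0_vanish.
elim: k f => [|k IH] f [rf [f' [df jf']]].
  by split => //; exact: (van _ _ df rf jf'.1).
split; first exact: (van _ _ df rf jf'.1).
by exists f'; split => //; exact: IH.
Qed.

Context (Phi : R -> R) (Phi0 : forall x, 0 <= Phi x).

(** The relation o(Phi) at infinity; [dominated] is O(Phi) on the whole line. *)
Definition small f := forall e, 0 < e -> exists r : R, forall y, r <= `|y| -> `|f y| <= e * Phi y.
Definition dominated f := exists C : R, forall y, `|f y| <= C * Phi y.

Lemma smallD f g : small f -> small g -> small (fun x => f x + g x).
Proof.
move=> sf sg e e0; have e2 : 0 < e / 2 by rewrite divr_gt0.
have [r hr] := sf _ e2; have [s hs] := sg _ e2.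
exists (Num.max r s) => y; rewrite ge_max => /andP[/hr h1 /hs h2].
by apply: (le_trans (ler_normD _ _)); rewrite [e](splitr e) mulrDl; exact: lerD.
Qed.

Lemma smallZ (a : R) f : small f -> small (fun x => a * f x).
Proof.
move=> sf e e0; have a0 : 0 < `|a| + 1 by rewrite ltr_wpDl.
have [r hr] := sf _ (divr_gt0 e0 a0); exists r => y /hr h.
rewrite normrM; apply: (@le_trans _ _ ((`|a| + 1) * `|f y|)).
  by rewrite ler_wpM2r// lerDl.
rewrite -ler_pdivlMl//; apply: (le_trans h).
by rewrite le_eqVlt; apply/orP; left; apply/eqP; ring.
Qed.

Lemma small_mul f g : dominated f -> vanish g -> small (fun x => f x * g x).
Proof.
move=> [C hC] vg e e0; have C0 : 0 < `|C| + 1 by rewrite ltr_wpDl.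
have [r hr] := vg _ (divr_gt0 e0 C0); exists r => y /hr h.
rewrite normrM; apply: (@le_trans _ _ (((`|C| + 1) * Phi y) * (e / (`|C| + 1)))).
  apply: ler_pM => //; apply: (le_trans (hC y)); rewrite ler_wpM2r//.
  by have := ler_norm C; lra.
by rewrite le_eqVlt; apply/orP; left; apply/eqP; field; rewrite gt_eqF.
Qed.

Lemma small_le f g (r : R) : (forall y, r <= `|y| -> `|f y| <= `|g y|) -> small g -> small f.
Proof.
move=> fg sg e e0; have [s hs] := sg _ e0.
by exists (Num.max r s) => y; rewrite ge_max => /andP[/fg h1 /hs h2]; exact: le_trans h2.
Qed.

(** The bounded region costs only an indicator, whose weighted integral stays bounded however the
    weight is truncated. *)
Lemma small_split f (C e : R) : continuous f -> small f -> 0 < e -> (forall y, `|f y| <= C) ->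
  exists r : R, forall y, `|f y| <= e * Phi y + C * \1_`[- r, r] y.
Proof.
move=> cf sf e0 hC; have [r hr] := sf _ e0; exists r => y.
have C0 : 0 <= C by exact: le_trans (hC 0).
have /andP[i0 _] := indicE01 `[- r, r] y.
have [ry|ry] := leP r `|y|.
  by apply: (le_trans (hr _ ry)); rewrite lerDl mulr_ge0.
have -> : (\1_`[- r, r] y : R) = 1.
  rewrite indicE mem_setE in_itv/=.
  by move: ry; rewrite ltr_norml => /andP[/ltW -> /ltW ->].
by rewrite mulr1; apply: (le_trans (hC y)); rewrite lerDr mulr_ge0// ltW.
Qed.

End smallness.

(** * Absorption argument for a finite family of convolutions *)

Section decay.
Context {R : realType}.
Local Notation mu := (@lebesgue_measure R).
Context (n : nat) (e h : nat -> R -> R) (l : R -> R) (s : R).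
Context (s0 : 0 <= s) (l1 : L1 l) (sl : L1 (fun x => weight s x * l x)).
Let Phi x := \sum_(i < n.+1) `|e i x|.
Context (ce : forall i, continuous (e i)) (ch : forall i, continuous (h i)).
Context (h1 : forall i, L1 (h i)) (hb : forall i, exists C, forall x, `|h i x| <= C).
Context (eh : forall i x, e i x = convol l (h i) x).
Context (hs : forall i, (i <= n)%N -> small Phi (h i)).

Let Phi0 x : 0 <= Phi x. Proof. exact: sumr_ge0. Qed.

Let ml := L1_measurable l1.
Let me i := measurable_of_continuous (ce (i:=i)).

Let weighted i (v w : R -> R) : continuous v -> continuous w -> (forall x, 0 <= v x) ->
  (forall x, 0 <= w x) -> (forall x z, w x <= v z * w (x - z)) ->
  L1 (fun x => v x * l x) -> (exists C, forall x, `|w x| <= C) ->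
  L1 (fun x => w x * e i x) /\
  \int[mu]_x (w x * `|e i x|) <= \int[mu]_y (v y * `|l y|) * \int[mu]_x (w x * `|h i x|).
Proof.
move=> cv cw v0 w0 vw vl [D hD]; have [C hC] := hb i.
apply: (convol_weight vl ml (@ch i) (me i) cv cw v0 w0 vw l1 hC) => //.
by apply: (L1_bddM _ (h1 i) hD); exact: measurable_of_continuous.
Qed.

(** Both weights are taken equal to 1. Plain integrability is what makes the truncated integrals
    [I k] finite, so that half of one can later be absorbed. *)
Let e1 i : L1 (e i).
Proof.
have [] := @weighted i (fun=> 1) (fun=> 1).
- by move=> x; exact: cvg_cst.
- by move=> x; exact: cvg_cst.
- by move=> x; exact: ler01.
- by move=> x; exact: ler01.
- by move=> x z; rewrite mulr1.
- by under eq_fun do rewrite mul1r.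
- by exists 1 => x; rewrite normr1.
by under eq_fun do rewrite mul1r.
Qed.

Let Phi1 : L1 Phi.
Proof. by apply: L1_sum => i _; exact/L1_norm/e1. Qed.

Let tw k := tweight s k : R -> R.

Let tw_bounded k : exists C, forall x, `|tw k x| <= C.
Proof.
by exists (k.+1%:R `^ s) => x; rewrite ger0_norm ?tweight_ge0// tweight_bounded.
Qed.

Let mtw k : measurable_fun [set: R] (tw k).
Proof. by apply: measurable_of_continuous; exact: tweight_continuous. Qed.

Let L1_tw k f : L1 f -> L1 (fun x => tw k x * f x).
Proof. by move=> f1; have [C hC] := tw_bounded k; exact: (L1_bddM (mtw k) f1 hC). Qed.

Let Lam := \int[mu]_y (weight s y * `|l y|).
Let I k := \int[mu]_x (tw k x * Phi x).

Let Lam0 : 0 <= Lam.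
Proof. by apply: int_ge0 => y; rewrite mulr_ge0// weight_ge0. Qed.

Let I0 k : 0 <= I k.
Proof. by apply: int_ge0 => y; rewrite mulr_ge0// tweight_ge0. Qed.

(** On [[- r, r]] the truncated weight is at most the full one, so the constant does not depend on
    the level k. *)
Let source_bound i (d : R) : (i <= n)%N -> 0 < d ->
  exists D, forall k, \int[mu]_x (tw k x * `|h i x|) <= d * I k + D.
Proof.
move=> il d0; have [C hC] := hb i.
have [r hr] := small_split Phi0 (@ch i) (hs il) d0 hC.
have C0 : 0 <= C by exact: le_trans (hC 0).
have [_ /(_ (- r) r) wi] := locint_cont (weight_continuous (R := R) (l := s)).
exists (C * \int[mu]_x (weight s x * \1_`[- r, r] x)) => k.
have twi : L1 (fun x => tw k x * \1_`[- r, r] x) by apply: L1_tw; exact: L1_indic_itv.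
apply: (@le_trans _ _ (\int[mu]_x (d * (tw k x * Phi x) + C * (tw k x * \1_`[- r, r] x)))).
  apply: int_le.
  - by apply: L1_tw; exact: L1_norm.
  - by apply: L1D; apply: L1Z => //; exact: L1_tw.
  - move=> x; apply: (le_trans (ler_wpM2l (tweight_ge0 _ _ _) (hr x))).
    by rewrite le_eqVlt; apply/orP; left; apply/eqP; rewrite /tw; ring.
rewrite intD; [|by apply: L1Z; exact: L1_tw|by apply: L1Z; exact: twi].
rewrite intZ; last exact: L1_tw.
rewrite lerD2l intZ; last exact: twi.
apply: ler_wpM2l; first exact: C0.
apply: int_le; [exact: twi|exact: wi|move=> x].
have /andP[i0 _] := indicE01 `[- r, r] x.
by rewrite ler_wpM2r// tweight_le.
Qed.

Let partial_bound (d : R) j : (j <= n.+1)%N -> 0 < d -> exists D, forall k,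
  \sum_(i < j) \int[mu]_x (tw k x * `|e i x|) <= j%:R * (Lam * d) * I k + D.
Proof.
move=> jn d0; elim: j jn => [|j IH] jn.
  by exists 0 => k; rewrite big_ord0 mul0r mul0r add0r.
have [D hD] := IH (ltnW jn); have [D' hD'] := source_bound jn d0.
exists (D + Lam * D') => k; rewrite big_ord_recr/=.
have [] := @weighted j (weight s) (tw k).
- exact: weight_continuous.
- exact: tweight_continuous.
- by move=> x; exact: weight_ge0.
- by move=> x; exact: tweight_ge0.
- by move=> x z; exact: tweight_submult.
- exact: sl.
- exact: tw_bounded.
move=> _ h2; apply: (le_trans (lerD (hD k) h2)).
apply: (le_trans (lerD (lexx _) (ler_wpM2l Lam0 (hD' k)))).
rewrite -natr1 le_eqVlt; apply/orP; left; apply/eqP.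
by move: (I k) Lam => J La; ring.
Qed.

Let I_bounded : exists D, forall k, I k <= D.
Proof.
(* With d = 1 / (2 q) the total factor (n + 1) Lam d is at most 1 / 2; adding 1 to Lam avoids a
   division by zero. *)
pose q : R := n.+1%:R * (Lam + 1).
have q0 : 0 < q by rewrite mulr_gt0// ltr_wpDl.
have d0 : 0 < (2 * q)^-1 by rewrite invr_gt0 mulr_gt0.
have [D hD] := partial_bound (leqnn n.+1) d0; exists (2 * D) => k.
have : I k <= 2^-1 * I k + D.
  apply: (@le_trans _ _ (\sum_(i < n.+1) \int[mu]_x (tw k x * `|e i x|))).
    suff -> : \sum_(i < n.+1) \int[mu]_x (tw k x * `|e i x|) = I k by [].
    rewrite /I /Phi; under [RHS]eq_Rintegral do rewrite mulr_sumr.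
    elim: n.+1 => [|j IH]; first by rewrite big_ord0; under eq_Rintegral do rewrite big_ord0; rewrite int0.
    rewrite big_ord_recr/= IH; under [RHS]eq_Rintegral do rewrite big_ord_recr/=.
    rewrite intD//; last by apply: L1_tw; exact: L1_norm.
    by apply: L1_sum => i _; apply: L1_tw; exact: L1_norm.
  apply: (le_trans (hD k)); rewrite lerD2r ler_wpM2r//.
  have L1' : 0 < Lam + 1 by rewrite ltr_wpDl.
  have -> : n.+1%:R * (Lam * (2 * q)^-1) = 2^-1 * (Lam / (Lam + 1)).
    rewrite /q; move: (Lam) L1' => La La1; field.
    by rewrite gt_eqF// addrC natr1 pnatr_eq0.
  rewrite -[leRHS]mulr1 ler_wpM2l ?invr_ge0//.
  by rewrite ler_pdivrMr// mul1r lerDl.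
by move: (I k) => J; lra.
Qed.

Lemma decay_L1 i : (i <= n)%N -> L1 (fun x => weight s x * e i x).
Proof.
move=> il; have [D hD] := I_bounded.
have mw : measurable_fun [set: R] (weight s).
  by apply: measurable_of_continuous; exact: weight_continuous.
have wPhi : L1 (fun x => weight s x * Phi x).
  apply: (@int_mono R (fun k x => tw k x * Phi x) _ D) => //.
  - by move=> k; exact: L1_tw.
  - by apply: measurable_funM => //; exact: L1_measurable.
  - by move=> k x; rewrite mulr_ge0// tweight_ge0.
  - by move=> x a b ab; rewrite ler_wpM2r// tweight_mono.
  - by move=> x; apply: cvgM; [exact: tweight_cvg|exact: cvg_cst].
apply: (L1_leP _ wPhi); first exact: measurable_funM.
move=> x; rewrite normrM ger0_norm ?weight_ge0// ler_wpM2l ?weight_ge0//.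
rewrite /Phi (bigD1 (Ordinal (n := n.+1) (m := i) il))//= lerDl.
by apply: sumr_ge0.
Qed.

End decay.

(** * Membership in Lebesgue spaces *)

Section Lfun_criteria.
Context {R : realType}.
Local Notation mu := (@lebesgue_measure R).
Implicit Types (f h : R -> R).

Lemma Lfun_measurable f (p : \bar R) : f \in Lfun mu p -> measurable_fun [set: R] f.
Proof. by rewrite inE => /andP[/[!inE]/= mf _]. Qed.

Lemma Lfun_bounded f (C : R) : measurable_fun [set: R] f -> (forall x, `|f x| <= C) ->
  f \in Lfun mu +oo%E.
Proof.
move=> mf fC; rewrite inE; apply/andP; split; rewrite inE//= /finite_norm unlock /=.
case: ifPn => _; last exact: ltry.
apply: (@le_lt_trans _ _ C%:E); last exact: ltry.
by apply/ess_supP/nearW => x /=; rewrite lee_fin.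
Qed.

(** From |f|^q <= C^(q - 1) |f|. *)
Lemma Lfun_L1_bounded f (C q : R) : 1 <= q -> L1 f -> (forall x, `|f x| <= C) ->
  f \in Lfun mu q%:E.
Proof.
move=> q1 f1 fC; have mf := L1_measurable f1.
have q0 : 0 < q by rewrite (lt_le_trans ltr01).
have C0 : 0 <= C by exact: le_trans (fC 0).
have fq : L1 (fun x => `|f x| `^ q).
  apply: (@L1_leP _ _ (fun x => C `^ (q - 1) * `|f x|)).
  - apply: (measurableT_comp (measurable_powR _)) => //; exact: measurableT_comp.
  - by apply: L1Z; exact: L1_norm.
  move=> x; rewrite ger0_norm ?powR_ge0// -(mulr_powRB1 (normr_ge0 (f x)) q0) mulrC.
  by rewrite ler_wpM2r// ge0_ler_powR// ?subr_ge0// nnegrE.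
rewrite inE; apply/andP; split; rewrite inE//= /finite_norm unlock /=.
by apply: poweR_lty; rewrite L1_EFin// ltry.
Qed.

Lemma Lfun_ess_bounded f : f \in Lfun mu +oo%E -> exists M : R, {ae mu, forall x, `|f x| <= M}.
Proof.
rewrite inE => /andP[_]; rewrite inE/= /finite_norm unlock /=.
have -> : (0 < mu [set: R])%E by rewrite -set_itvNyy lebesgue_measure_itv/= ltry.
move=> /(@ess_supr_bounded _ _ _ mu (fun x => `|f x|))[M hM].
by exists M; apply: ae_imp hM.
Qed.

(** The weight of order l is split into orders l - s and s. For q conjugate to p, the factor of
    order l - s is in L^q because (s - l) q > 1, which amounts to l < s - 1 + 1/p. Hölder's
    inequality is used through Young's inequality at each point; for p = +oo the essential bound
    replaces it. *)
Lemma Lfun_weight_L1 f (p : \bar R) (s l : R) : (1 < p)%E -> measurable_fun [set: R] f ->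
  (fun x => weight s x * f x) \in Lfun mu p -> l < s - 1 + fine (p^-1)%E ->
  L1 (fun x => weight l x * f x).
Proof.
move=> p1 mf Lf ls.
have mw t : measurable_fun [set: R] (weight t : R -> R).
  by apply: measurable_of_continuous; exact: weight_continuous.
have mwf : measurable_fun [set: R] (fun x => weight l x * f x) by exact: measurable_funM.
have wE x : weight l x * f x = weight (l - s) x * (weight s x * f x).
  by rewrite mulrA -weightD subrK.
case: p p1 Lf ls => [p| |//]; last first.
  move=> _ /Lfun_ess_bounded[M hM]; rewrite invey/= addr0 => ls.
  have w1 : L1 (fun x : R => M * weight (l - s) x).
    by apply: L1Z; rewrite -opprB; apply: L1_weight; lra.
  apply: L1P => //; apply: (@le_lt_trans _ _ (\int[mu]_x `|M * weight (l - s) x|%:E)%E); last exact: L1_lty.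
  apply: ae_ge0_le_integral => //.
  - by apply/measurable_EFinP; exact: measurableT_comp.
  - by apply: L1_EFin_measurable; exact: L1_norm.
  apply: ae_imp hM => x hM _; rewrite lee_fin wE [leLHS]normrM [leRHS]normrM mulrC.
  by rewrite ler_wpM2r//; apply: (le_trans hM); exact: ler_norm.
rewrite lte_fin => p1 Lf; have p0 : 0 < p by rewrite (lt_trans ltr01).
rewrite inver gt_eqF//= => ls.
have q0 : 0 < 1 - p^-1 by rewrite subr_gt0 invf_lt1.
have fp : L1 (fun x => `|weight s x * f x| `^ p) by apply: Lfun_integrable => //; exact: ltW.
have w1 : L1 (weight (- ((s - l) / (1 - p^-1)))).
  by apply: L1_weight; rewrite ltr_pdivlMr// mul1r; lra.
apply: (L1_leP mwf (L1D (L1Zr p^-1 fp) (L1Zr (1 - p^-1) w1))).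
move=> x; rewrite wE mulrC normrM.
have := @conjugate_powR R `|weight s x * f x| `|weight (l - s) x| p (1 - p^-1)^-1.
rewrite invrK invr_gt0 subrKC; move=> /(_ (normr_ge0 _) (normr_ge0 _) p0 q0 erefl) h.
apply: (le_trans h); rewrite lerD2l; apply: ler_wpM2r; first exact: ltW.
rewrite (ger0_norm (weight_ge0 _ _)) /weight -powRrM.
by rewrite -mulNr opprB.
Qed.

End Lfun_criteria.

(** * From weighted integrability to pointwise decay *)

Section pointwise_decay.
Context {R : realType}.
Local Notation mu := (@lebesgue_measure R).
Context (f f' : R -> R) (s : R) (s0 : 0 < s) (pf : prim f f').
Context (wf : L1 (fun x => weight s x * f x)) (wf' : L1 (fun x => weight s x * f' x)).

Let G t := weight s t * (`|f t| + `|f' t|).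
Let h x := `|x| `^ s * f x.

Let G1 : L1 G.
Proof.
have := L1D (L1_norm wf) (L1_norm wf'); congr L1; apply/funext => x.
by rewrite !normrM (ger0_norm (weight_ge0 s x)) -mulrDr.
Qed.

Let G0 t : 0 <= G t.
Proof. by rewrite mulr_ge0 ?weight_ge0. Qed.

(** Every t in [[x, x + 1]] satisfies |x| <= 1 + |t|, so the weight moves inside the integral that
    bounds |f(x)|. *)
Let h_le x : `|h x| <= \int[mu]_t (G t * \1_`[x, x + 1] t).
Proof.
have xx : x <= x <= x + 1 by rewrite lexx lerDl ler01.
have mi := measurable_itv_indic (R := R) `[x, x + 1].
rewrite normrM (ger0_norm (powR_ge0 _ _)).
apply: (le_trans (ler_wpM2l (powR_ge0 _ _) (prim_norm_le pf xx))).
have lf : L1 (fun t => (`|f t| + `|f' t|) * \1_`[x, x + 1] t).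
  have cf := prim_continuous pf; have [[mf' lf'] _] := pf.
  have [_ /(_ x (x + 1)) lf] := locint_cont cf.
  have := L1D (L1_norm lf) (L1_norm (lf' x (x + 1))); congr L1; apply/funext => t.
  have /andP[i0 _] := indicE01 `[x, x + 1] t.
  by rewrite !normrM (ger0_norm i0) mulrDl.
rewrite -intZ//; apply: int_le.
- exact: L1Z.
- by apply: (@L1_bddMr _ _ _ 1) => // t; exact: indic_norm_le1.
move=> t; rewrite mulrA.
have /andP[i0 _] := indicE01 `[x, x + 1] t.
have [tx|tx] := boolP (t \in `[x, x + 1]); last first.
  have -> : (\1_`[x, x + 1] t : R) = 0 by rewrite indicE mem_setE (negbTE tx).
  by rewrite !mulr0.
rewrite ler_wpM2r// /G ler_wpM2r//.
apply: powR_le_weight; first exact: ltW.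
move: tx; rewrite in_itv/= => /andP[t1 t2].
by apply: norm_le_near; rewrite ler_norml; apply/andP; split; lra.
Qed.

Let mh : measurable_fun [set: R] h.
Proof.
apply: measurable_funM.
  by apply: (@measurableT_comp _ _ _ _ _ _ (fun x => x `^ s)%R).
by apply: measurable_of_continuous; exact: prim_continuous pf.
Qed.

Let h1 : L1 h.
Proof.
apply: (L1_leP mh (L1_norm wf)) => x; rewrite [leLHS]normrM [leRHS]normrM ler_wpM2r//.
rewrite (ger0_norm (powR_ge0 _ _)) (ger0_norm (weight_ge0 _ _)).
by apply: powR_le_weight; [exact: ltW|rewrite lerDr].
Qed.

Let h_bounded : exists C, forall x, `|h x| <= C.
Proof.
exists (\int[mu]_t G t) => x; apply: (le_trans (h_le x)); apply: int_le => //.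
  by apply: (@L1_bddMr _ _ _ 1) => // t; exact: indic_norm_le1.
move=> t; rewrite -[leRHS]mulr1; apply: ler_wpM2l; first exact: G0.
by have /andP[] := indicE01 `[x, x + 1] t.
Qed.

Let h_vanish : vanish h.
Proof.
move=> e e0; have [r hr] := L1_tail G1 G0 e0; exists (r + 1) => y ry.
apply: (le_trans (h_le y)); apply: hr => // t /=; rewrite in_itv/= => /andP[t1 t2].
suff : `|y| <= 1 + `|t| by lra.
by apply: norm_le_near; rewrite ler_norml; apply/andP; split; lra.
Qed.

Lemma pointwise_decay (p : \bar R) : (1 < p)%E ->
  [/\ h \in Lfun mu (hoelder_conjugate p), h \in Lfun mu +oo%E,
    h x @[x --> +oo] --> 0 & h x @[x --> -oo] --> 0].
Proof.
move=> p1; have [C hC] := h_bounded; split.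
(* The conjugate exponent is finite, since an infinite one would force p = 1. *)
- have := hoelder_conj_ge1 (ltW p1).
  have := @hoelder_conjugate_eqy R p.
  case: (hoelder_conjugate p) => [q|/(_ erefl) E|//].
    by move=> _ q1; exact: (Lfun_L1_bounded q1 h1 hC).
  by rewrite E ltxx in p1.
- exact: (Lfun_bounded mh hC).
- apply/cvgrPdist_le => e e0; have [r hr] := h_vanish e0; near=> x.
  rewrite sub0r normrN; apply: hr; apply: le_trans (ler_norm _).
  by near: x; apply: nbhs_pinfty_ge; rewrite num_real.
- apply/cvgrPdist_le => e e0; have [r hr] := h_vanish e0; near=> x.
  rewrite sub0r normrN; apply: hr; rewrite -normrN; apply: le_trans (ler_norm _).
  rewrite lerNr; near: x; apply: nbhs_ninfty_le; rewrite num_real//.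
Unshelve. all: by end_near. Qed.

End pointwise_decay.

Section derivatives.
Context {R : realType}.
Implicit Types (f g : R -> R) (P : (R -> R) -> Prop).

Lemma smooth_derive1n k f : smooth f -> smooth f^`(k)%classic.
Proof. by move=> sf; elim: k => [//|k IH]; rewrite derive1nS; exact: smooth_derive. Qed.

Lemma smooth_is_derive1n k f (x : R) : smooth f ->
  is_derive x 1 f^`(k)%classic (f^`(k.+1)%classic x).
Proof. by move=> sf; rewrite derive1nS; apply: smooth_is_derive; exact: smooth_derive1n. Qed.

Lemma jet_of_smooth P k f : smooth f -> (forall i, (i <= k)%N -> P f^`(i)%classic) -> jet P k f.
Proof.
elim: k f => [|k IH] f sf Pf; split => //; try exact: (Pf 0%N).
exists f^`()%classic; split; first by move=> x; exact: smooth_is_derive.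
by apply: IH => [|i ik]; [exact: smooth_derive|rewrite -derive1Sn; exact: Pf].
Qed.

End derivatives.

(** * Weighted integrability of the derivatives of eta *)

Section wave_decay.
Context {R : realType}.
Local Notation mu := (@lebesgue_measure R).
Context (c : R) (a b a1 b1 : R -> R).
Context (m : R -> R) (mm : measurable_fun [set: R] m) (Km : R) (mK : forall x, `|m x| <= Km).
Context (l : R -> R) (l1 : L1 l) (Sl : forall x, St l x = 0).
Context (KN : R) (NK : forall x, `|Ct l x| <= KN * japanese x).
Context (g : R -> R) (W : wave c a b a1 b1 g).
Local Notation eta := (weta a b).
Local Notation eta1 := (weta1 a b a1 b1).
Local Notation F := (wforce a b a1 b1 g).
Local Notation A := (fun x => Ct l x * Ct F x).
Local Notation B := (fun x => Ct l x * St F x).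
Context (hg : forall x, g x = inverse_transform (fun x => m x * A x) (fun x => m x * B x) x).
Context (he : forall x, eta x = inverse_transform A B x).

Let cN : continuous (Ct l) := Ct_continuous l1.
Let jets k := wave_jets mm mK cN NK W hg he k.
Let smo := wave_smooth mm mK cN NK W hg he.
Let se : smooth eta. Proof. by have [] := smo. Qed.
Let sg : smooth g. Proof. by have [] := smo. Qed.
Let sF : smooth F. Proof. by have [] := smo. Qed.
Let cg : continuous g. Proof. exact: smooth_continuous. Qed.

Let regF k : regular1 F^`(k)%classic.
Proof. by have [_ _ jF] := jets k; exact: jet_derive1n jF. Qed.

Let regE k : regular2 eta^`(k)%classic.
Proof. by have [je _ _] := jets k; exact: jet_derive1n je. Qed.

Let bddF k : exists C, forall x, `|F^`(k)%classic x| <= C.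
Proof.
have [c0 f0 _] := regF k; have [c1 f1 _] := regF k.+1.
have pf := derive_prim (fun x => smooth_is_derive1n k x sF) c1.
by eexists => x; exact: (prim_bounded pf f0 f1 x).
Qed.

(** Two derivatives of F make its transforms O(1 / (1 + x^2)); their integrability is what inversion
    and the convolution theorem require. *)
Let transform_L1 : L1 (Ct F) /\ L1 (St F).
Proof.
have [_ _ jF] := jets 2.
have [[_ [C0 hC0] _] [_ [S0 hS0] _]] := jet_transform (leq0n 2) jF.
have [[_ [C2 hC2] _] [_ [S2 hS2] _]] := jet_transform (leqnn 2) jF.
have F1 := wforce_L1 W.
have dec (f : R -> R) (C D : R) : continuous f -> (forall x, `|x ^+ 0 * f x| <= C) ->
    (forall x, `|x ^+ 2 * f x| <= D) -> L1 f.
  move=> cf hC hD; apply: (@L1_decay _ _ (C + D)); first exact: measurable_of_continuous.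
  move=> x; rewrite /japanese ler_pdivlMr; last by rewrite ltr_pwDl// sqr_ge0.
  have := hC x; have := hD x; rewrite expr0 mul1r normrM (ger0_norm (sqr_ge0 x)).
  by rewrite mulrDr mulr1 [X in _ -> _ -> _ + X <= _]mulrC; lra.
by split; [apply: dec hC0 hC2; exact: Ct_continuous|apply: dec hS0 hS2; exact: St_continuous].
Qed.

Lemma weta_convol x : eta x = convol l F x.
Proof.
have [C1 S1] := transform_L1.
rewrite he; apply: convol_inverse_transform => //; last exact: (wforce_L1 W).
exact: smooth_continuous.
Qed.

(** All derivatives fall on the smooth factor F, the kernel being merely integrable. *)
Lemma weta_derive_convol k x : eta^`(k)%classic x = convol l F^`(k)%classic x.
Proof.
elim: k x => [|k IH] x; first exact: weta_convol.
have [C hC] := bddF k; have [D hD] := bddF k.+1.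
have h := is_derive_convol l1 (fun x => smooth_is_derive1n k x sF) hC hD.
by rewrite derive1nS (funext IH) (is_derive_derive1 h).
Qed.

Section small.
Context (k : nat).
(** Orders 0 to k + 1, so that eta' is always included: the bound on F itself involves it. *)
Let Phi x := \sum_(i < k.+2) `|eta^`(i)%classic x|.

Let Phi0 x : 0 <= Phi x. Proof. exact: sumr_ge0. Qed.

Let dom i : (i <= k.+1)%N -> dominated Phi eta^`(i)%classic.
Proof.
move=> il; exists 1 => x.
by rewrite mul1r /Phi (bigD1 (Ordinal (n := k.+2) (m := i) il))//= lerDl sumr_ge0.
Qed.

Let van_eta i : vanish eta^`(i)%classic.
Proof. by have [je _ _] := jets i.+1; exact: (jet_derive1n (jet_vanish je)). Qed.

Let small_wforce : small Phi F.
Proof.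
have eta1E : eta^`()%classic = eta1.
  by apply: is_derive_derive1 => x; exact: (is_derive_weta W).
have d0 : dominated Phi eta by exact: (dom (i := 0%N)).
have d1 : dominated Phi eta1 by rewrite -eta1E; exact: (dom (i := 1%N)).
have v0 : vanish eta by exact: (van_eta 0%N).
have v1 : vanish eta1 by rewrite -eta1E; exact: (van_eta 1%N).
have vg : vanish g by have [_ jg _] := jets 1; exact: jet_head (jet_vanish jg).
apply: (@smallD _ Phi); last by apply: smallZ; exact: small_mul.
have s2 : small Phi (fun x => eta1 x * eta1 x + c ^+ 2 * (eta x * eta x)).
  by apply: smallD; [exact: small_mul|apply: smallZ; exact: small_mul].
(* Beyond r one has eta <= 1 / 2, that is |u|^2 >= 1 / 2, so a bound on |u|^2 |u'|^2 bounds
   |u'|^2. *)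
have [r hr] := v0 (2^-1) ltac:(by rewrite invr_gt0).
apply: (small_le _ s2) => y /hr; rewrite ler_norml => /andP[_ ey].
have J := wave_momentum W y.
(* Lagrange's identity: |u|^2 |u'|^2 is the sum of the squares of a a1 + b b1 and of a b1 - b a1.
   The first is eta'^2 / 4, the second is given by the momentum. *)
have E : (1 - eta y) * (a1 y ^+ 2 + b1 y ^+ 2) = (eta1 y ^+ 2 + c ^+ 2 * eta y ^+ 2) / 4.
  have -> : c ^+ 2 * eta y ^+ 2 = 4 * (c / 2 * eta y) ^+ 2 by field.
  by rewrite -J /weta1 /weta; field.
have S0 : 0 <= a1 y ^+ 2 + b1 y ^+ 2 by rewrite addr_ge0// sqr_ge0.
have S1 : 0 <= eta1 y ^+ 2 + c ^+ 2 * eta y ^+ 2.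
  by apply: addr_ge0; [exact: sqr_ge0|apply: mulr_ge0; exact: sqr_ge0].
rewrite -!expr2 (ger0_norm S1) ger0_norm ?mulr_ge0//.
have h : 2^-1 * (a1 y ^+ 2 + b1 y ^+ 2) <= (1 - eta y) * (a1 y ^+ 2 + b1 y ^+ 2).
  by apply: ler_wpM2r => //; lra.
by rewrite E in h; lra.
Qed.

(** Leibniz' rule pairs a derivative of eta, dominated by Phi, with a derivative of [g], which tends
    to 0. *)
Let jet_small : jet (small Phi) k.+1 F.
Proof.
split; first exact: small_wforce.
have dg (x : R) : is_derive x 1 g (g^`()%classic x) by exact: smooth_is_derive.
exists (fun x => 4 * (eta1 x * g x) + 2 * (eta x * g^`()%classic x)); split.
  by move=> x; exact: (is_derive_wforce mm mK cN NK W hg he (dg x)).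
have je : jet (dominated Phi) k.+1 eta by apply: jet_of_smooth => // i il; exact: dom.
have de (x : R) : is_derive x 1 eta (eta1 x) by exact: (is_derive_weta W).
have je1 := jet_step de je.
have jg : jet vanish k.+1 g by have [_ jg _] := jets k.+2; exact: jet_vanish.
have jg1 := jet_step dg jg.
have SD := @smallD _ Phi.
apply: jetD => //; (apply: jetZ; first by move=> f; exact: smallZ).
  by apply: (jetM (@small_mul _ Phi Phi0) SD je1); exact: jet_pred.
by apply: (jetM (@small_mul _ Phi Phi0) SD _ jg1); exact: jet_pred.
Qed.

Lemma small_derive_wforce i : (i <= k.+1)%N -> small Phi F^`(i)%classic.
Proof. by move=> il; exact: jet_derive1n (jet_le il jet_small). Qed.

End small.

Lemma weta_decay (s : R) k : 0 <= s -> L1 (fun x => weight s x * l x) ->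
  L1 (fun x => weight s x * eta^`(k)%classic x).
Proof.
move=> s0 sl.
apply: (@decay_L1 R k.+1 (fun i => eta^`(i)%classic) (fun i => F^`(i)%classic) l s) => //.
- by move=> i; have [] := regE i.
- by move=> i; have [] := regF i.
- by move=> i; have [] := regF i.
- by move=> i x; exact: weta_derive_convol.
- by move=> i il; exact: small_derive_wforce.
Qed.

End wave_decay.

(** * Division by the symbol *)

Section wave_conclusion.
Context {R : realType}.
Local Notation mu := (@lebesgue_measure R).

Lemma transform_pair_ae (f A A' B B' : R -> R) : locint A -> locint B ->
  measurable_fun [set: R] A' -> measurable_fun [set: R] B' ->
  {ae mu, forall x, A x = A' x} -> {ae mu, forall x, B x = B' x} ->
  transform_pair f A B -> transform_pair f A' B'.
Proof.
move=> lA lB mA' mB' hA hB h phi tp; have [-> ->] := h _ tp.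
have mp := measurable_of_continuous (testfun_continuous tp).
split; apply: eq_ae_int.
- exact: (L1_measurable (testfun_mulL1 lA tp)).
- exact: measurable_funM.
- by apply: ae_imp hA => x ->.
- exact: (L1_measurable (testfun_mulL1 lB tp)).
- exact: measurable_funM.
- by apply: ae_imp hB => x ->.
Qed.

Context (c : R) (a b a1 b1 g : R -> R) (W : wave c a b a1 b1 g).
Context (m : R -> R) (mm : measurable_fun [set: R] m) (Km : R) (mK : forall x, `|m x| <= Km).
Context (l : R -> R) (l1 : L1 l) (Sl : forall x, St l x = 0).
Context (KN : R) (NK : forall x, `|Ct l x| <= KN * japanese x).
Context (NM : {ae mu, forall x, Ct l x * (x ^+ 2 + 2 * m x - c ^+ 2) = 1}).
Context (A B : R -> R) (lA : locint A) (lB : locint B).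
Context (te : transform_pair (weta a b) A B).
Context (tg : transform_pair g (fun x => m x * A x) (fun x => m x * B x)).

Lemma wave_conclusion : [/\ smooth a, smooth b, smooth (weta a b) &
  forall (s : R) k, 0 <= s -> L1 (fun x => weight s x * l x) ->
    L1 (fun x => weight s x * (weta a b)^`(k)%classic x)].
Proof.
have cN : continuous (Ct l) := Ct_continuous l1.
have mN := measurable_of_continuous cN.
have F1 := wforce_L1 W.
have mCF : measurable_fun [set: R] (fun x => Ct l x * Ct (wforce a b a1 b1 g) x).
  by apply: measurable_funM => //; apply: measurable_of_continuous; exact: Ct_continuous.
have mSF : measurable_fun [set: R] (fun x => Ct l x * St (wforce a b a1 b1 g) x).
  by apply: measurable_funM => //; apply: measurable_of_continuous; exact: St_continuous.
(* The cosine transform of [l] is the inverse of M_c, so multiplying M_c A = Ct F by it isolates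
   A. *)
have hA : {ae mu, forall x, A x = Ct l x * Ct (wforce a b a1 b1 g) x}.
  apply: ae_imp (ae_and NM (wave_symbol_Ct W lA mm mK te tg)) => x [E ->].
  by rewrite mulrA E mul1r.
have hB : {ae mu, forall x, B x = Ct l x * St (wforce a b a1 b1 g) x}.
  apply: ae_imp (ae_and NM (wave_symbol_St W lB mm mK te tg)) => x [E ->].
  by rewrite mulrA E mul1r.
have te' := transform_pair_ae lA lB mCF mSF hA hB te.
have tg' : transform_pair g (fun x => m x * (Ct l x * Ct (wforce a b a1 b1 g) x))
    (fun x => m x * (Ct l x * St (wforce a b a1 b1 g) x)).
  apply: transform_pair_ae tg.
  - exact: locint_bddM mK lA.
  - exact: locint_bddM mK lB.
  - exact: measurable_funM.
  - exact: measurable_funM.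
  - by apply: ae_imp hA => x ->.
  - by apply: ae_imp hB => x ->.
have [h [Wh _ hh he]] := wave_regularize mm mK cN NK W te' tg'.
have [sa sb se _ _] := wave_smooth mm mK cN NK Wh hh he.
split; [exact: sa|exact: sb|exact: se|].
by move=> s k; exact: (weta_decay mm mK l1 Sl NK Wh hh he).
Qed.

End wave_conclusion.

Local Open Scope complex_scope.

(** * Complex-valued functions and distributions *)

Section complex_unpacking.
Context {R : realType}.
Local Notation mu := (@lebesgue_measure R).
Implicit Types (f h : R -> R[i]) (phi psi : R -> R).

(** Test functions are taken real-valued: the pairing is complex, so the real and imaginary parts of
    the represented function can be read off separately. *)
Definition rc phi : R -> R[i] := fun x => (phi x)%:C.

Lemma cmodE (z : R[i]) : cmod z = Num.sqrt (complex.Re z ^+ 2 + complex.Im z ^+ 2).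
Proof. by rewrite /cmod normc_def. Qed.

Lemma cmod_sqr (z : R[i]) : cmod z ^+ 2 = complex.Re z ^+ 2 + complex.Im z ^+ 2.
Proof. by rewrite cmodE sqr_sqrtr// addr_ge0 ?sqr_ge0. Qed.

Lemma cmod_ge0 (z : R[i]) : 0 <= cmod z.
Proof. by rewrite cmodE sqrtr_ge0. Qed.

Lemma Re_le_cmod (z : R[i]) : `|complex.Re z| <= cmod z.
Proof. by rewrite cmodE -sqrtr_sqr ler_wsqrtr// lerDl sqr_ge0. Qed.

Lemma Im_le_cmod (z : R[i]) : `|complex.Im z| <= cmod z.
Proof. by rewrite cmodE -sqrtr_sqr ler_wsqrtr// lerDr sqr_ge0. Qed.

Lemma cmod_le (z : R[i]) : cmod z <= `|complex.Re z| + `|complex.Im z|.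
Proof.
rewrite cmodE -[leRHS]ger0_norm ?addr_ge0// -sqrtr_sqr ler_wsqrtr//.
rewrite sqrrD !real_normK ?num_real// addrAC lerDl.
by rewrite mulrn_wge0// mulr_ge0.
Qed.

Lemma cmod_real (x : R) : cmod x%:C = `|x|.
Proof. by rewrite cmodE/= expr0n/= addr0 sqrtr_sqr. Qed.

Lemma cmod_realM (x : R) (z : R[i]) : cmod (x%:C * z) = `|x| * cmod z.
Proof.
rewrite !cmodE; case: z => [y t] /=.
by rewrite !mul0r subr0 addr0 !exprMn -mulrDr sqrtrM ?sqr_ge0// sqrtr_sqr.
Qed.

Lemma derive1n_cst0 k : (fun _ : R => 0 : R)^`(k)%classic = fun=> 0.
Proof.
elim: k => [//|k IH]; rewrite derive1nS IH.
by apply: is_derive_derive1 => x; exact: is_derive_cst.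
Qed.

Lemma cderiven_rc k phi : cderiven k (rc phi) = rc phi^`(k)%classic.
Proof. by apply/funext => x; rewrite /cderiven derive1n_cst0. Qed.

Lemma test_function_rc phi : testfun phi -> test_function (rc phi).
Proof.
move=> [sp [M hM]]; split; first by split; [exact: sp|exact: smooth_cst].
apply: (@subclosed_compact _ _ `[- M, M]); [exact: closed_closure|exact: segment_compact|].
rewrite [X in _ `<=` X](_ : _ = closure `[- M, M]); last by apply/closure_id; exact: itv_closed.
apply: closureS => x /= px; rewrite in_itv/= -ler_norml leNgt.
by apply: contra_neqN px => /hM; rewrite /rc => ->.
Qed.

Lemma distribution_of_rc f phi : distribution_of f (rc phi) =
  (\int[mu]_x (re_fun f x * phi x)) +i* (\int[mu]_x (im_fun f x * phi x)).
Proof.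
rewrite /distribution_of /cintegral; congr (_ +i* _); apply: int_eq => x;
  rewrite /re_fun /im_fun /rc; case: (f x) => [s t] /=; ring.
Qed.

Lemma fourier_rc phi : testfun phi -> fourier (rc phi) = fun xi => Ct phi xi -i* St phi xi.
Proof.
move=> tp; apply/funext => xi; rewrite /fourier /cintegral; congr (_ +i* _).
  by apply: int_eq => x; rewrite /re_fun /rc /=; ring.
rewrite /St -intN; last exact: L1_sin (testfun_L1 tp).
by apply: int_eq => x; rewrite /im_fun /rc /=; ring.
Qed.

Lemma schwartz_transfun phi psi : transfun phi -> transfun psi ->
  schwartz (fun x => phi x +i* psi x).
Proof.
move=> tp tq; split; first by split; exact: transfun_smooth.
move=> j k.
have der k' (q : R -> R) : transfun q -> transfun q^`(k')%classic.
  by move=> th; elim: k' => [//|k' IH]; rewrite derive1nS; exact: transfun_derive1.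
have [C hC] := transfun_moment j (der k _ tp); have [D hD] := transfun_moment j (der k _ tq).
exists (C + D) => _ [x _ <-].
apply: (@le_trans _ _ (`|x| ^+ j * (`|phi^`(k)%classic x| + `|psi^`(k)%classic x|))).
  by apply: ler_wpM2l; [exact: exprn_ge0|exact: cmod_le].
by rewrite mulrDr lerD.
Qed.

Lemma transfun0 : transfun (fun _ : R => 0 : R).
Proof.
have := transfun_Ct (@testfun0 R); congr transfun; apply/funext => x.
by rewrite /Ct; under eq_Rintegral do rewrite mul0r; exact: int0.
Qed.

Lemma cLfun2_sqr f : cLfun 2%:E f ->
  L1 (fun x => re_fun f x ^+ 2) /\ L1 (fun x => im_fun f x ^+ 2).
Proof.
move=> [[mr mi] /Lfun2_integrable_sqr h].
split; apply: (L1_leP _ h).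
- exact: measurable_funX.
- by move=> x; rewrite ger0_norm ?sqr_ge0// cmod_sqr lerDl sqr_ge0.
- exact: measurable_funX.
- by move=> x; rewrite ger0_norm ?sqr_ge0// cmod_sqr lerDr sqr_ge0.
Qed.

Lemma cL1loc_locint f : cL1loc f -> locint (re_fun f) /\ locint (im_fun f).
Proof. by move=> [/locint_locally h1 /locint_locally h2]. Qed.

End complex_unpacking.

(** * Convergence of cut-offs in the Schwartz space *)

Section cutoff_convergence.
Context {R : realType}.
Local Notation mu := (@lebesgue_measure R).
Implicit Types (h : nat -> R -> R) (phi psi chi f : R -> R).

Let dl (n : nat) : R := n.+1%:R^-1.

Let dl_gt0 n : 0 < dl n. Proof. by rewrite invr_gt0 ltr0n. Qed.
Let dl_le1 n : dl n <= 1. Proof. by rewrite invf_le1 ?ltr0n// ler1n. Qed.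

(* Convergence to 0 in the Schwartz space, at the rate 1 / n. *)
Definition rapid_null h := forall j : nat, exists C : R, forall n x, `|x| ^+ j * `|h n x| <= C * dl n.

Fixpoint null_jet k h : Prop := rapid_null h /\
  (if k is k'.+1 then exists h', (forall n (x : R), is_derive x 1 (h n) (h' n x)) /\ null_jet k' h' else True).

Lemma rapid_nullD h h' : rapid_null h -> rapid_null h' -> rapid_null (fun n x => h n x + h' n x).
Proof.
move=> H H' j; have [C hC] := H j; have [D hD] := H' j; exists (C + D) => n x.
apply: (@le_trans _ _ (`|x| ^+ j * (`|h n x| + `|h' n x|))).
  by apply: ler_wpM2l; [exact: exprn_ge0|exact: ler_normD].
by rewrite mulrDr mulrDl; exact: lerD.
Qed.

Lemma null_jetD k h h' : null_jet k h -> null_jet k h' -> null_jet k (fun n x => h n x + h' n x).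
Proof.
elim: k h h' => [|k IH] h h' [H dH] [H' dH']; split; try exact: rapid_nullD; first by [].
have [g [dg jg]] := dH; have [g' [dg' jg']] := dH'.
exists (fun n x => g n x + g' n x); split; last exact: IH.
by move=> n x; exact: is_deriveD.
Qed.

Lemma null_jet_rapid k h : null_jet k h -> rapid_null (fun n => (h n)^`(k)%classic).
Proof.
elim: k h => [|k IH] h [H dH] //.
have [h' [dh jh']] := dH.
rewrite (_ : (fun n => _) = (fun n => (h' n)^`(k)%classic)); first exact: IH.
by apply/funext => n; rewrite derive1Sn (is_derive_derive1 (dh n)).
Qed.

Let is_derive_dilate n theta f (x : R) : smooth theta -> smooth f ->
  is_derive x 1 (fun x => theta (dl n * x + 0) * f x)
    (dl n * theta^`()%classic (dl n * x + 0) * f x + theta (dl n * x + 0) * f^`()%classic x).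
Proof.
move=> st sf; apply: is_deriveM_fun; last exact: smooth_is_derive.
by apply: is_derive_comp_affine => y; exact: smooth_is_derive.
Qed.

(** The small factor survives differentiation, since derivatives of the dilated cut-off only bring
    further factors at most 1. *)
Lemma null_jet_scaled k (s : nat -> R) theta f : (forall n, `|s n| <= dl n) ->
  testfun theta -> transfun f -> null_jet k (fun n x => s n * (theta (dl n * x + 0) * f x)).
Proof.
elim: k s theta f => [|k IH] s theta f hs tt tf.
all: have rn : rapid_null (fun n x => s n * (theta (dl n * x + 0) * f x)).
1,3: move=> j; have [C hC] := testfun_bounded tt; have [D hD] := transfun_moment j tf.
1,2: have C0 : 0 <= C by exact: le_trans (hC 0).
1,2: exists (C * D) => n x; rewrite !normrM.
1,2: have -> : `|x| ^+ j * (`|s n| * (`|theta (dl n * x + 0)| * `|f x|)) =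
      `|theta (dl n * x + 0)| * (`|x| ^+ j * `|f x|) * `|s n| by ring.
1,2: by apply: ler_pM => //; rewrite ?mulr_ge0 ?exprn_ge0//; apply: ler_pM => //; rewrite mulr_ge0 ?exprn_ge0.
- by split.
split => //.
exists (fun n x => (s n * dl n) * (theta^`()%classic (dl n * x + 0) * f x) +
  s n * (theta (dl n * x + 0) * f^`()%classic x)); split.
  move=> n x; have := is_deriveM_fun (is_derive_cst (s n) x 1) (is_derive_dilate n x (testfun_smooth tt) (transfun_smooth tf)).
  rewrite mul0r add0r /cst mulrDr.
  by congr (is_derive _ _ _ (_ + _)); ring.
apply: null_jetD; apply: IH => //; [|exact: testfun_derive|exact: transfun_derive1].
move=> n; rewrite normrM (ger0_norm (ltW (dl_gt0 n))) -[leRHS]mulr1.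
by apply: ler_pM => //; exact: ltW.
Qed.

(** The Lipschitz bound on [chi] at 0 trades one moment of [f] for a factor 1 / (n + 1). In the
    derivative, the term from the cut-off already has this factor, and the rest is the same
    difference for f'. *)
Lemma null_jet_cut k chi f : testfun chi -> chi 0 = 1 -> transfun f ->
  null_jet k (fun n x => f x - cut chi f n x).
Proof.
move=> tc c0; have [L hL] := testfun_lipschitz tc.
elim: k f => [|k IH] f tf.
all: have rn : rapid_null (fun n x => f x - cut chi f n x).
1,3: move=> j; have [D hD] := transfun_moment j.+1 tf.
1,2: exists (L * D) => n x; rewrite /cut -{1}[f x]mul1r -mulrBl normrM.
1,2: have := hL (dl n * x + 0) 0; rewrite c0 sub0r normrN addr0 normrM (ger0_norm (ltW (dl_gt0 n))) => h.
1,2: have L0 : 0 <= L by have := hL 0 1; rewrite subr0 normr1 mulr1; exact: le_trans.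
1,2: apply: (@le_trans _ _ (`|x| ^+ j * (L * (dl n * `|x|) * `|f x|))); 
  first by (apply: ler_wpM2l; [exact: exprn_ge0|apply: ler_wpM2r]).
1,2: have -> : `|x| ^+ j * (L * (dl n * `|x|) * `|f x|) = L * (`|x| ^+ j.+1 * `|f x|) * dl n by rewrite exprS; ring.
1,2: by apply: ler_wpM2r; [exact: ltW|apply: ler_wpM2l].
- by split.
split => //.
exists (fun n x => (- dl n) * (chi^`()%classic (dl n * x + 0) * f x) +
  (f^`()%classic x - cut chi f^`()%classic n x)); split.
  move=> n x; have df := smooth_is_derive x (transfun_smooth tf).
  have := is_deriveB df (is_derive_dilate n x (testfun_smooth tc) (transfun_smooth tf)).
  move=> H; apply: (is_derive_eq H); rewrite /cut -/(dl n); ring.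
apply: null_jetD; last by apply: IH; exact: transfun_derive1.
apply: null_jet_scaled => //; last exact: testfun_derive.
by move=> n; rewrite normrN ger0_norm// ltW.
Qed.

End cutoff_convergence.

(** * Tempered distributions applied to functions without compact support *)

Section tempered_extension.
Context {R : realType}.
Local Notation mu := (@lebesgue_measure R).
Implicit Types (phi psi f : R -> R).

Lemma schwartz_rc phi : smooth phi ->
  (forall j k, exists C, forall x, `|x| ^+ j * `|phi^`(k)%classic x| <= C) -> schwartz (rc phi).
Proof.
move=> sp hp; split; first by split; [exact: sp|exact: smooth_cst].
move=> j k; have [C hC] := hp j k; exists C => _ [x _ <-].
by rewrite cderiven_rc cmod_real.
Qed.

Lemma schwartz_seminorm_ge0 j k (phi : R -> R[i]) : schwartz phi -> 0 <= schwartz_seminorm j k phi.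
Proof.
move=> [_ /(_ j k) ub]; rewrite /schwartz_seminorm.
have h0 := imageT (fun x : R => `|x| ^+ j * cmod (cderiven k phi x)) 0.
apply: le_trans (ub_le_sup ub h0).
by apply: mulr_ge0; [exact: exprn_ge0|exact: cmod_ge0].
Qed.

Lemma schwartz_testfun phi : testfun phi -> schwartz (rc phi).
Proof.
move=> tp; apply: schwartz_rc; first exact: testfun_smooth.
move=> j k; have tk : testfun phi^`(k)%classic.
  by elim: k => [//|k IH]; rewrite derive1nS; exact: testfun_derive.
have tj : testfun (fun x => x ^+ j * phi^`(k)%classic x).
  elim: j => [|j IH]; first by under eq_fun do rewrite expr0 mul1r.
  by under eq_fun do rewrite exprS -mulrA; exact: testfun_Xmul.
have [C hC] := testfun_bounded tj; exists C => x.
by rewrite -normrX -normrM.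
Qed.

Lemma schwartz_rc_transfun psi : transfun psi -> schwartz (rc psi).
Proof. by move=> tp; exact: (schwartz_transfun tp (@transfun0 R)). Qed.

Lemma sum_le_scaled (N : nat) (s : nat -> nat -> R) (d : nat -> R) :
  (forall j, exists C, forall n, s j n <= C * d n) ->
  exists C, forall n, \sum_(j < N) s j n <= C * d n.
Proof.
move=> hs; elim: N => [|N [C hC]]; first by exists 0 => n; rewrite big_ord0 mul0r.
have [D hD] := hs N; exists (C + D) => n.
by rewrite big_ord_recr/= mulrDl; exact: lerD.
Qed.

Context (T : (R -> R[i]) -> R[i]) (tT : tempered T).
Context (l : R -> R[i]) (l1 : L1 (re_fun l)) (l2 : L1 (im_fun l)).
Context (Tl : represents T l).

Let cut_int_cvg k chi f : L1 k -> testfun chi -> chi 0 = 1 -> transfun f ->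
  \int[mu]_x (k x * cut chi f n x) @[n --> \oo] --> \int[mu]_x (k x * f x).
Proof.
move=> k1 tc c0 tf; have [C hC] := testfun_bounded tc; have [D hD] := transfun_bounded tf.
have mk := L1_measurable k1; have mf := measurable_of_continuous (transfun_continuous tf).
have C0 : 0 <= C by exact: le_trans (hC 0).
apply: (@dct R (fun n x => k x * cut chi f n x) (fun x => k x * f x) (fun x => `|k x| * (C * D)) _ _ _ _ _).2.
- move=> n; apply: measurable_funM => //; apply: measurable_of_continuous.
  exact/testfun_continuous/testfun_cut/transfun_smooth.
- exact: measurable_funM.
- by apply: L1Zr; exact: L1_norm.
- by move=> n x; rewrite normrM ler_wpM2l// /cut normrM; apply: ler_pM.
- by move=> x; apply: cvgM; [exact: cvg_cst|exact: cut_cvg].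
Qed.

(** Since [represents] speaks of compactly supported functions, the cut-offs of [f] are used. They
    converge in every Schwartz seminorm, so T passes to the limit by continuity; the integral does
    so by dominated convergence, [l] being integrable. *)
Lemma tempered_transfun f : transfun f -> T (rc f) = distribution_of l (rc f).
Proof.
move=> tf; have [chi [tc c0]] := @exists_cutoff R.
have [linT [N [K TK]]] := tT.
have scut n : schwartz (rc (cut chi f n)) by apply/schwartz_testfun/testfun_cut/transfun_smooth.
have null k := null_jet_rapid (null_jet_cut k tc c0 tf).
have sdiff n : smooth (fun x => f x - cut chi f n x).
  by apply: smoothB; [exact: transfun_smooth|exact/testfun_smooth/testfun_cut/transfun_smooth].
have Sdiff n : schwartz (rc (fun x => f x - cut chi f n x)).
  apply: schwartz_rc => // j k; have [C hC] := null k j.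
  by exists (C * n.+1%:R^-1) => x; exact: hC.
have [C hC] : exists C, forall n, cmod (T (rc f) - distribution_of l (rc (cut chi f n))) <= C * n.+1%:R^-1.
  have [C hC] : exists C, forall n, \sum_(j < N.+1) \sum_(k < N.+1)
      schwartz_seminorm j k (rc (fun x => f x - cut chi f n x)) <= C * n.+1%:R^-1.
    apply: (@sum_le_scaled N.+1 (fun j n => \sum_(k < N.+1)
      schwartz_seminorm j k (rc (fun x => f x - cut chi f n x))) (fun n => n.+1%:R^-1)) => j.
    apply: (@sum_le_scaled N.+1 (fun k n =>
      schwartz_seminorm j k (rc (fun x => f x - cut chi f n x))) (fun n => n.+1%:R^-1)) => k.
    have [C hC] := null k j; exists C => n; apply: ge_sup.
      by eexists; exact: (ex_intro2 _ _ 0 I erefl).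
    by move=> _ [x _ <-]; rewrite cderiven_rc cmod_real; exact: hC.
  exists (`|K| * C) => n.
  have -> : T (rc f) - distribution_of l (rc (cut chi f n)) = T (rc (fun x => f x - cut chi f n x)).
    rewrite -Tl.2; last by apply: test_function_rc; apply: testfun_cut => //; exact: transfun_smooth.
    have := linT (-1) _ _ (scut n) (schwartz_rc_transfun tf).
    rewrite mulN1r addrC => <-; congr T; apply/funext => x.
    by rewrite /rc mulN1r addrC rmorphB.
  apply: (le_trans (TK _ (Sdiff n))).
  have S0 : 0 <= \sum_(j < N.+1) \sum_(k < N.+1)
      schwartz_seminorm j k (rc (fun x => f x - cut chi f n x)).
    apply: sumr_ge0 => j _; apply: sumr_ge0 => k _.
    exact: schwartz_seminorm_ge0.
  apply: (@le_trans _ _ (`|K| * \sum_(j < N.+1) \sum_(k < N.+1)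
      schwartz_seminorm j k (rc (fun x => f x - cut chi f n x)))).
    by apply: ler_wpM2r => //; exact: ler_norm.
  by rewrite -mulrA ler_wpM2l.
have lim (z : R) (k : R -> R) : L1 k ->
    (forall n, `|z - \int[mu]_x (k x * cut chi f n x)| <= C * n.+1%:R^-1) ->
    z = \int[mu]_x (k x * f x).
  move=> k1 hz; apply: (cvg_unique (@Rhausdorff R) _ (cut_int_cvg k1 tc c0 tf)).
  have Cn0 : C * n.+1%:R^-1 @[n --> \oo] --> (0 : R).
    by rewrite -(mulr0 C); apply: cvgM; [exact: cvg_cst|exact: cvg_harmonic].
  apply/cvgrPdist_le => e e0.
  have /cvgrPdist_le/(_ _ e0) [M _ hM] := Cn0.
  exists M => // n /hM /=; rewrite sub0r normrN => h.
  by apply: (le_trans (hz n)); apply: le_trans h; exact: ler_norm.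
rewrite distribution_of_rc; apply/eqP; rewrite eq_complex; apply/andP; split; apply/eqP => /=.
  apply: lim => // n; apply: le_trans (hC n); apply: le_trans (Re_le_cmod _).
  by rewrite distribution_of_rc; case: (T (rc f)) => [p q] /=.
apply: lim => // n; apply: le_trans (hC n); apply: le_trans (Im_le_cmod _).
by rewrite distribution_of_rc; case: (T (rc f)) => [p q] /=.
Qed.

End tempered_extension.

(** * Parity and uniqueness of transforms *)

Section parity.
Context {R : realType}.
Local Notation mu := (@lebesgue_measure R).
Implicit Types (f g P Q : R -> R) (phi : R -> R).

Lemma locint_opp f : locint f -> locint (fun x => f (- x)).
Proof.
move=> [mf hf]; split; first by apply: (measurableT_comp mf); exact: oppr_measurable.
move=> x y; have := L1_opp (hf (- y) (- x)); congr L1; apply/funext => t.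
congr (_ * _); rewrite !indicE !mem_setE !in_itv/=.
by rewrite lerN2 lerN2 andbC.
Qed.

Lemma int_reflect f phi : locint f -> testfun phi ->
  \int[mu]_x (f (- x) * phi x) = \int[mu]_x (f x * phi (- x)).
Proof.
move=> lf tp; rewrite -(int_opp (testfun_mulL1 lf (testfun_opp tp))).
by apply: int_eq => x; rewrite opprK.
Qed.

Lemma parity_ae f (e : R) : locint f ->
  (forall phi, testfun phi -> \int[mu]_x (f x * phi (- x)) = e * \int[mu]_x (f x * phi x)) ->
  {ae mu, forall x, f (- x) = e * f x}.
Proof.
move=> lf hf; have lo := locint_opp lf.
suff : {ae mu, forall x, f (- x) - e * f x = 0} by apply: ae_imp => x /subr0_eq.
apply: dubois_reymond => [|phi tp]; first by apply: locintB => //; exact: locintZ.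
rewrite (int_eq (g := fun x => f (- x) * phi x - e * (f x * phi x))); last by move=> x; ring.
have I1 := testfun_mulL1 lo tp; have I2 := testfun_mulL1 lf tp.
rewrite intB//; last exact: L1Z.
by rewrite intZ// int_reflect// hf// subrr.
Qed.

Lemma parity_int f (e : R) phi : locint f -> testfun phi ->
  {ae mu, forall x, f (- x) = e * f x} ->
  \int[mu]_x (f x * phi (- x)) = e * \int[mu]_x (f x * phi x).
Proof.
move=> lf tp hf; have I2 := testfun_mulL1 lf tp.
rewrite -int_reflect// -intZ//; apply: eq_ae_int.
- exact: (L1_measurable (testfun_mulL1 (locint_opp lf) tp)).
- by apply: L1_measurable; exact: L1Z.
- by apply: ae_imp hf => x ->; rewrite mulrA.
Qed.

(* Reflecting phi separates the even and the odd part of the transform of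
   f1 + i f2; with an even symbol this makes the convolution real. *)
Lemma separate_parity f1 f2 P Q : slow f1 -> slow f2 ->
  (forall phi, testfun phi ->
    \int[mu]_x (f1 x * Ct phi x) + \int[mu]_x (f2 x * St phi x) = \int[mu]_x (P x * phi x)) ->
  (forall phi, testfun phi ->
    \int[mu]_x (f1 x * St phi x) - \int[mu]_x (f2 x * Ct phi x) = \int[mu]_x (Q x * phi x)) ->
  (forall phi, testfun phi -> \int[mu]_x (P x * phi (- x)) = \int[mu]_x (P x * phi x)) ->
  (forall phi, testfun phi -> \int[mu]_x (Q x * phi (- x)) = - \int[mu]_x (Q x * phi x)) ->
  transform_pair f1 P Q /\ transform_pair f2 (fun=> 0) (fun=> 0).
Proof.
move=> s1 s2 hP hQ eP oQ.
have intC f phi : testfun phi -> \int[mu]_x (f x * Ct (fun x => phi (- x)) x) = \int[mu]_x (f x * Ct phi x).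
  by move=> tp; apply: int_eq => x; rewrite Ct_opp//; exact: testfun_L1.
have intS f phi : slow f -> testfun phi ->
    \int[mu]_x (f x * St (fun x => phi (- x)) x) = - \int[mu]_x (f x * St phi x).
  move=> sf tp; rewrite -intN; last exact: slow_transfun (transfun_St tp).
  by apply: int_eq => x; rewrite St_opp ?mulrN//; exact: testfun_L1.
have H phi : testfun phi ->
    [/\ \int[mu]_x (f1 x * Ct phi x) = \int[mu]_x (P x * phi x),
        \int[mu]_x (f2 x * St phi x) = 0,
        \int[mu]_x (f1 x * St phi x) = \int[mu]_x (Q x * phi x) &
        \int[mu]_x (f2 x * Ct phi x) = 0].
  move=> tp; have to := testfun_opp tp.
  have := hP _ tp; have := hP _ to; have := hQ _ tp; have := hQ _ to.
  rewrite (intC f1 _ tp) (intC f2 _ tp) (intS _ _ s1 tp) (intS _ _ s2 tp) (eP _ tp) (oQ _ tp).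
  move: (\int[mu]_x (f1 x * St phi x)) (\int[mu]_x (f1 x * Ct phi x)) => a b.
  move: (\int[mu]_x (f2 x * St phi x)) (\int[mu]_x (f2 x * Ct phi x)) => a' b'.
  move: (\int[mu]_x (P x * phi x)) (\int[mu]_x (Q x * phi x)) => p q h1 h2 h3 h4.
  by split; lra.
split=> phi tp; have [h1 h2 h3 h4] := H _ tp; first by split.
rewrite h2 h4; split; under eq_Rintegral do rewrite mul0r; by rewrite int0.
Qed.

Lemma transform_pair0 f : slow f -> transform_pair f (fun=> 0) (fun=> 0) ->
  {ae mu, forall x, f x = 0}.
Proof.
move=> sf h; have := transform_pair_inversion sf (@L1_0 R) (@L1_0 R) h.
apply: ae_imp => x ->; rewrite /inverse_transform /Ct /St.
under eq_Rintegral do rewrite mul0r.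
under [X in _ + X]eq_Rintegral do rewrite mul0r.
by rewrite int0 addr0 mulr0.
Qed.

Lemma transform_pair_unique f P Q : L1 f -> locint P -> locint Q -> transform_pair f P Q ->
  {ae mu, forall x, Ct f x = P x} /\ {ae mu, forall x, St f x = Q x}.
Proof.
move=> f1 lP lQ h.
have lC := locint_cont (Ct_continuous f1); have lS := locint_cont (St_continuous f1).
have U K L : locint K -> locint L ->
    (forall phi, testfun phi -> \int[mu]_x (K x * phi x) = \int[mu]_x (L x * phi x)) ->
    {ae mu, forall x, K x = L x}.
  move=> lK lL KL; suff : {ae mu, forall x, K x - L x = 0} by apply: ae_imp => x /subr0_eq.
  apply: dubois_reymond => [|phi tp]; first exact: locintB.
  under eq_Rintegral do rewrite mulrBl.
  rewrite intB; [|exact: testfun_mulL1 lK tp|exact: testfun_mulL1 lL tp].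
  by rewrite KL// subrr.
split; apply: U => // phi tp; have [h1 h2] := h _ tp.
- by rewrite -h1 int_Ct//; exact: testfun_L1.
- by rewrite -h2 int_St//; exact: testfun_L1.
Qed.

End parity.

(** * Real form of the Fourier transform of distributions *)

Section fourier_representation.
Context {R : realType}.
Local Notation mu := (@lebesgue_measure R).
Implicit Types (f F : R -> R[i]) (phi : R -> R).

Lemma distribution_of_fourier f phi : slow (re_fun f) -> slow (im_fun f) -> testfun phi ->
  distribution_of f (fourier (rc phi)) =
  (\int[mu]_x (re_fun f x * Ct phi x) + \int[mu]_x (im_fun f x * St phi x)) +i*
  (\int[mu]_x (im_fun f x * Ct phi x) - \int[mu]_x (re_fun f x * St phi x)).
Proof.
move=> s1 s2 tp; rewrite fourier_rc// /distribution_of /cintegral.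
have tC := transfun_Ct tp; have tS := transfun_St tp.
rewrite -intD; [|exact: slow_transfun|exact: slow_transfun].
rewrite -intB; [|exact: slow_transfun|exact: slow_transfun].
congr (_ +i* _); apply: int_eq => x; rewrite /re_fun /im_fun; case: (f x) => [s t] /=; ring.
Qed.

Lemma represents_fourier f F phi : slow (re_fun f) -> slow (im_fun f) ->
  represents (fourier_distribution (distribution_of f)) F -> testfun phi ->
  \int[mu]_x (re_fun f x * Ct phi x) + \int[mu]_x (im_fun f x * St phi x) =
    \int[mu]_x (re_fun F x * phi x) /\
  \int[mu]_x (im_fun f x * Ct phi x) - \int[mu]_x (re_fun f x * St phi x) =
    \int[mu]_x (im_fun F x * phi x).
Proof.
move=> s1 s2 [_ h] tp; have := h _ (test_function_rc tp).
rewrite /fourier_distribution distribution_of_fourier// distribution_of_rc.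
by move=> /eqP; rewrite eq_complex => /andP[/eqP /= -> /eqP /= ->].
Qed.

Lemma fourier_rc_opp phi : testfun phi ->
  fourier (rc (fun x => phi (- x))) = fun xi => fourier (rc phi) (- xi).
Proof.
move=> tp; rewrite !fourier_rc//; last exact: testfun_opp.
apply/funext => xi; rewrite Ct_opp; last exact: testfun_L1.
rewrite St_opp; last exact: testfun_L1.
congr (_ +i* _).
  by apply: int_eq => x; rewrite mulrN cosN.
congr (- _); rewrite /St -intN; last exact: L1_sin (testfun_L1 tp).
by apply: int_eq => x; rewrite mulrN sinN mulrN.
Qed.

Lemma schwartz_fourier_rc phi : testfun phi -> schwartz (fourier (rc phi)).
Proof.
move=> tp; rewrite fourier_rc//; apply: schwartz_transfun; first exact: transfun_Ct.
have := transfun_St (testfunN tp); congr transfun; apply/funext => x.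
by rewrite StN//; exact: testfun_L1.
Qed.

(** Reflecting phi reflects its Fourier transform, on which [W] is even. *)
Lemma even_symbol (W : (R -> R[i]) -> R[i]) F : even_distribution W ->
  represents (fourier_distribution W) F ->
  {ae mu, forall x, re_fun F (- x) = 1 * re_fun F x}.
Proof.
move=> We [/cL1loc_locint[lF _] h]; apply: parity_ae => // phi tp; rewrite mul1r.
have to := testfun_opp tp.
have := h _ (test_function_rc to); have := h _ (test_function_rc tp).
rewrite /fourier_distribution fourier_rc_opp// We; last exact: schwartz_fourier_rc.
move=> -> /eqP; rewrite !distribution_of_rc eq_complex => /andP[/eqP /= -> _].
by [].
Qed.

(** The transform of a real phi is Ct phi - i St phi; linearity reduces to these two real
    functions. *)
Lemma tempered_fourier (T : (R -> R[i]) -> R[i]) l phi : tempered T ->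
  L1 (re_fun l) -> L1 (im_fun l) -> represents T l -> testfun phi ->
  T (fourier (rc phi)) = distribution_of l (fourier (rc phi)).
Proof.
move=> tT l1 l2 Tl tp.
have tC := transfun_Ct tp; have tS := transfun_St tp.
rewrite distribution_of_fourier; [|exact: slow_L1|exact: slow_L1|exact: tp].
have E : fourier (rc phi) = fun x => (0 -i* 1) * rc (St phi) x + rc (Ct phi) x.
  rewrite fourier_rc//; apply/funext => x; apply/eqP; rewrite eq_complex /rc /=.
  by apply/andP; split; apply/eqP; ring.
rewrite E tT.1; [|exact: schwartz_rc_transfun|exact: schwartz_rc_transfun].
rewrite (tempered_transfun tT l1 l2 Tl tC) (tempered_transfun tT l1 l2 Tl tS) !distribution_of_rc.
move: (\int[mu]_x (re_fun l x * Ct phi x)) (\int[mu]_x (re_fun l x * St phi x)) => a b.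
move: (\int[mu]_x (im_fun l x * Ct phi x)) (\int[mu]_x (im_fun l x * St phi x)) => a' b'.
by apply/eqP; rewrite eq_complex /=; apply/andP; split; apply/eqP; ring.
Qed.

End fourier_representation.

(** * The symbol and the equation *)

Section equation.
Context {R : realType}.
Local Notation mu := (@lebesgue_measure R).
Implicit Types (phi : R -> R).

(** As [e] is real, its transform A - i B has A even and B odd. Multiplication by a real even symbol
    preserves both, so the resulting function is real. *)
Lemma nonlocal_term (e m : R -> R) (What gc : R -> R[i]) (K : R) :
  measurable_fun [set: R] m -> (forall x, `|m x| <= K) ->
  {ae mu, forall x, What x = (m x)%:C} -> {ae mu, forall x, m (- x) = 1 * m x} ->
  fourier_multiplier What (rc e) gc ->
  {ae mu, forall x, im_fun gc x = 0} /\
  exists A B, [/\ locint A, locint B, transform_pair e A B &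
    transform_pair (re_fun gc) (fun x => m x * A x) (fun x => m x * B x)].
Proof.
move=> mm mK Wm me [ce cg [F [cF rF rG]]].
have se : slow e by apply: slow_sqr; [exact: ce.1.1|exact: (cLfun2_sqr ce).1].
have s0 : slow (fun _ : R => 0 : R) by apply: slow_L1; exact: L1_0.
have s1 : slow (re_fun gc) by apply: slow_sqr; [exact: cg.1.1|exact: (cLfun2_sqr cg).1].
have s2 : slow (im_fun gc) by apply: slow_sqr; [exact: cg.1.2|exact: (cLfun2_sqr cg).2].
have [lA lF2] := cL1loc_locint rF.1; have [lG1 lG2] := cL1loc_locint rG.1.
have int00 (k : R -> R) : \int[mu]_x (im_fun (rc e) x * k x) = 0.
  by rewrite (int_eq (g := fun=> 0)) ?int0// => x; rewrite mul0r.
(* The sign of B follows from the convention that a transform is A - i B. *)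
pose A := re_fun F; pose B x := - im_fun F x.
have lB : locint B by exact: locintN.
have pair_e : transform_pair e A B.
  move=> phi tp; have [] := represents_fourier (f := rc e) se s0 rF tp.
  rewrite !int00 addr0 sub0r => h1 h2; split; first exact: h1.
  under [RHS]eq_Rintegral do rewrite mulNr.
  rewrite intN; last exact: testfun_mulL1.
  by rewrite -h2 opprK.
have parA : {ae mu, forall x, A (- x) = 1 * A x}.
  apply: parity_ae => // phi tp; have [h1 _] := pair_e _ tp.
  have [h2 _] := pair_e _ (testfun_opp tp).
  rewrite mul1r -h1 -h2; apply: int_eq => x; rewrite Ct_opp//; exact: testfun_L1.
have parB : {ae mu, forall x, B (- x) = -1 * B x}.
  apply: parity_ae => // phi tp; have [_ h1] := pair_e _ tp.
  have [_ h2] := pair_e _ (testfun_opp tp).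
  rewrite mulN1r -h1 -h2 -intN; last exact: slow_transfun (transfun_St tp).
  by apply: int_eq => x; rewrite St_opp ?mulrN//; exact: testfun_L1.
have lmA : locint (fun x => m x * A x) by exact: locint_bddM mK lA.
have lmB : locint (fun x => m x * B x) by exact: locint_bddM mK lB.
have [] := @separate_parity R (re_fun gc) (im_fun gc) (fun x => m x * A x) (fun x => m x * B x) s1 s2.
- move=> phi tp; have [-> _] := represents_fourier s1 s2 rG tp.
  apply: eq_ae_int.
  + exact: (L1_measurable (testfun_mulL1 lG1 tp)).
  + exact: (L1_measurable (testfun_mulL1 lmA tp)).
  apply: ae_imp Wm => x Wx; rewrite /A /re_fun Wx; case: (F x) => [s t] /=; ring.
- move=> phi tp; have [_ h] := represents_fourier s1 s2 rG tp.
  rewrite -opprB h -intN; last exact: testfun_mulL1.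
  apply: eq_ae_int.
  + exact: (L1_measurable (L1N (testfun_mulL1 lG2 tp))).
  + exact: (L1_measurable (testfun_mulL1 lmB tp)).
  apply: ae_imp Wm => x Wx; rewrite /B /im_fun Wx; case: (F x) => [s t] /=; ring.
- move=> phi tp; rewrite -[RHS]mul1r; apply: parity_int => //.
  by apply: ae_imp (ae_and me parA) => x [-> ->]; ring.
- move=> phi tp; rewrite -[RHS]mulN1r; apply: parity_int => //.
  by apply: ae_imp (ae_and me parB) => x [-> ->]; ring.
move=> hg h0; split; first exact: transform_pair0.
by exists A, B; split.
Qed.

Lemma weak_derivative_rc u w phi : weak_derivative u w -> testfun phi ->
  (\int[mu]_x (re_fun u x * phi^`()%classic x) = - (\int[mu]_x (re_fun w x * phi x))) /\
  (\int[mu]_x (im_fun u x * phi^`()%classic x) = - (\int[mu]_x (im_fun w x * phi x))).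
Proof.
move=> [_ _ h] tp; have := h _ (test_function_rc tp).
rewrite cderiven_rc !distribution_of_rc => /eqP.
by rewrite eq_complex => /andP[/eqP /= h1 /eqP /= h2].
Qed.

Lemma split_equation (c p q p' q' p2 q2 : R) :
  (0 +i* c) * (- ((- p) +i* (- q))) + ((- p2) +i* (- q2)) + (p' +i* q') = 0 ->
  p2 = - (c * q - p') /\ q2 = - (- c * p - q').
Proof.
by move=> /eqP; rewrite eq_complex /= => /andP[/eqP h1 /eqP h2]; split; lra.
Qed.

(** A locally integrable function with a locally integrable weak derivative has an absolutely
    continuous representative. This is used twice: for u with derivative w, then for w, whose weak
    derivative is -i c w - u g by the equation. *)
Lemma wave_of_solution (c : R) (u gc : R -> R[i]) : energy_space u -> cLfun 2%:E gc ->
  {ae mu, forall x, im_fun gc x = 0} ->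
  (forall phi : R -> R[i], test_function phi ->
      (0 +i* c) * (- distribution_of u (cderiven 1 phi))
      + distribution_of u (cderiven 2 phi)
      + distribution_of (fun x => u x * gc x) phi = 0) ->
  exists a b a1 b1, wave c a b a1 b1 (re_fun gc) /\ {ae mu, forall x, u x = a x +i* b x}.
Proof.
move=> [_ ceta [w ww w2]] cg g2 sol.
have [/cL1loc_locint[lu1 lu2] /cL1loc_locint[lw1 lw2] _] := ww.
have [a [pa ua]] := weak_derivative_prim lu1 lw1 (fun phi tp => (weak_derivative_rc ww tp).1).
have [b [pb ub]] := weak_derivative_prim lu2 lw2 (fun phi tp => (weak_derivative_rc ww tp).2).
have ca := prim_continuous pa; have cb := prim_continuous pb.
have [g1s g2s] := cLfun2_sqr cg; have [mg1 mg2] := cg.1.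
have lg : locint (re_fun gc) by apply: slow_locint; exact: slow_sqr.
have lag : locint (fun x => a x * re_fun gc x) by exact: locintM_cont.
have lbg : locint (fun x => b x * re_fun gc x) by exact: locintM_cont.
have mu1 := locint_measurable lu1; have mu2 := locint_measurable lu2.
have mr : measurable_fun [set: R] (re_fun (fun x => u x * gc x)).
  have : measurable_fun [set: R] (fun x => re_fun u x * re_fun gc x - im_fun u x * im_fun gc x).
    by apply: measurable_funB; exact: measurable_funM.
  congr measurable_fun; apply/funext => x; rewrite /re_fun /im_fun.
  by case: (u x) (gc x) => [s t] [s' t'].
have mi : measurable_fun [set: R] (im_fun (fun x => u x * gc x)).
  have : measurable_fun [set: R] (fun x => re_fun u x * im_fun gc x + im_fun u x * re_fun gc x).
    by apply: measurable_funD; exact: measurable_funM.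
  congr measurable_fun; apply/funext => x; rewrite /re_fun /im_fun.
  by case: (u x) (gc x) => [s t] [s' t'].
have weak phi : testfun phi ->
    (\int[mu]_x (re_fun w x * phi^`()%classic x) =
      - (\int[mu]_x ((c * im_fun w x - a x * re_fun gc x) * phi x))) /\
    (\int[mu]_x (im_fun w x * phi^`()%classic x) =
      - (\int[mu]_x ((- (c * re_fun w x) - b x * re_fun gc x) * phi x))).
  move=> tp; have tp' := testfun_derive tp.
  have mp := measurable_of_continuous (testfun_continuous tp).
  have [X1 Y1] := weak_derivative_rc ww tp; have [X2 Y2] := weak_derivative_rc ww tp'.
  have := sol _ (test_function_rc tp); rewrite !cderiven_rc !derive1nS !distribution_of_rc /=.
  rewrite X1 Y1 X2 Y2.
  rewrite (eq_ae_int (f := fun x => re_fun (fun x => u x * gc x) x * phi x)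
    (g := fun x => a x * re_fun gc x * phi x)); last 3 first.
  - exact: measurable_funM.
  - exact: (L1_measurable (testfun_mulL1 lag tp)).
  - apply: ae_imp (ae_and (ae_and ua ub) g2) => x [[E1 E2] E3]; rewrite -E1; congr (_ * _).
    by move: E3; rewrite /re_fun /im_fun; case: (u x) (gc x) => [s t] [s' t'] /= ->; ring.
  rewrite (eq_ae_int (f := fun x => im_fun (fun x => u x * gc x) x * phi x)
    (g := fun x => b x * re_fun gc x * phi x)); last 3 first.
  - exact: measurable_funM.
  - exact: (L1_measurable (testfun_mulL1 lbg tp)).
  - apply: ae_imp (ae_and (ae_and ua ub) g2) => x [[E1 E2] E3]; rewrite -E2; congr (_ * _).
    by move: E3; rewrite /re_fun /im_fun; case: (u x) (gc x) => [s t] [s' t'] /= ->; ring.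
  have I1 := testfun_mulL1 lw1 tp; have I2 := testfun_mulL1 lw2 tp.
  have I3 := testfun_mulL1 lag tp; have I4 := testfun_mulL1 lbg tp.
  rewrite (int_eq (f := fun x => (c * im_fun w x - a x * re_fun gc x) * phi x)
    (g := fun x => c * (im_fun w x * phi x) - a x * re_fun gc x * phi x)); last by move=> x; ring.
  rewrite (int_eq (f := fun x => (- (c * re_fun w x) - b x * re_fun gc x) * phi x)
    (g := fun x => - c * (re_fun w x * phi x) - b x * re_fun gc x * phi x)); last by move=> x; ring.
  rewrite intB//; last exact: L1Z.
  rewrite intB//; last exact: L1Z.
  rewrite !intZ//.
  exact: split_equation.
have lk1 : locint (fun x => c * im_fun w x - a x * re_fun gc x) by apply: locintB => //; exact: locintZ.
have lk2 : locint (fun x => - (c * re_fun w x) - b x * re_fun gc x).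
  by apply: locintB => //; apply: locintN; exact: locintZ.
have [a1 [pa1 wa]] := weak_derivative_prim lw1 lk1 (fun phi tp => (weak phi tp).1).
have [b1 [pb1 wb]] := weak_derivative_prim lw2 lk2 (fun phi tp => (weak phi tp).2).
have ma1 := measurable_of_continuous (prim_continuous pa1).
have mb1 := measurable_of_continuous (prim_continuous pb1).
have ma := measurable_of_continuous ca; have mb := measurable_of_continuous cb.
have [w1s w2s] := cLfun2_sqr w2; have [es _] := cLfun2_sqr ceta.
exists a, b, a1, b1; split; last first.
  apply: ae_imp (ae_and ua ub) => x [<- <-]; rewrite /re_fun /im_fun.
  by case: (u x).
split.
- exact: eq_ae_prim pa ma1 wa.
- exact: eq_ae_prim pb mb1 wb.
- apply: (eq_ae_prim pa1); last by apply: ae_imp wb => x ->.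
  by apply: measurable_funB; apply: measurable_funM.
- apply: (eq_ae_prim pb1); last by apply: ae_imp wa => x ->.
  by apply: measurable_funB; [apply: measurableT_comp => //|]; exact: measurable_funM.
- exact: mg1.
- apply: (eq_ae_L1 _ es).
    by apply: measurable_funX; apply: measurable_funB => //; apply: measurable_funD; exact: measurable_funX.
  apply: ae_imp (ae_and ua ub) => x [<- <-]; congr (_ ^+ 2).
  by rewrite /re_fun /= /eta_fun cmod_sqr.
- by apply: (eq_ae_L1 _ w1s); [exact: measurable_funX|apply: ae_imp wa => x ->].
- by apply: (eq_ae_L1 _ w2s); [exact: measurable_funX|apply: ae_imp wb => x ->].
- exact: g1s.
Qed.

End equation.

(** * The symbol M_c and its kernel *)

Section symbol.
Context {R : realType}.
Local Notation mu := (@lebesgue_measure R).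

(* M_c > 0 forces the symbol to be real; it is made bounded everywhere by
   truncation. *)
Lemma bounded_symbol (c : R) (What : R -> R[i]) : cLfun +oo%E What ->
  {ae mu, forall xi, 0 < Mc c What xi} ->
  exists (m : R -> R) (K : R), [/\ measurable_fun [set: R] m, forall x, `|m x| <= K,
    {ae mu, forall x, What x = (m x)%:C} &
    {ae mu, forall x, 0 < x ^+ 2 + 2 * m x - c ^+ 2}].
Proof.
move=> [[mW _] /Lfun_ess_bounded[K0 hK0]] hM.
pose m x := Num.max (- `|K0|) (Num.min `|K0| (re_fun What x)).
have mm : measurable_fun [set: R] m by apply: measurable_maxr => //; exact: measurable_minr.
have Wm : {ae mu, forall x, What x = (m x)%:C /\ 0 < x ^+ 2 + 2 * m x - c ^+ 2}.
  apply: ae_imp (ae_and hK0 hM) => x [].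
  rewrite ger0_norm ?cmod_ge0// => h1; rewrite /Mc ltcE => /andP[/eqP i0 r0].
  have mE : m x = complex.Re (What x).
    have := le_trans (le_trans (Re_le_cmod _) h1) (ler_norm K0).
    rewrite ler_norml => /andP[h2 h3]; rewrite /m /re_fun.
    by rewrite (min_idPr h3) (max_idPr h2).
  move: i0 r0; rewrite mE; case: (What x) => [s t] /=.
  by rewrite !mulr0 !mul0r !subr0 !addr0 => t0 h; split; [congr (_ +i* _); lra|move: h; rewrite !expr2; lra].
exists m, `|K0|; split => //.
- move=> x; rewrite ler_norml /m le_max lexx/= ge_max ge_min lexx/= andbT.
  by rewrite (le_trans _ (normr_ge0 K0))// oppr_le0.
- by apply: ae_imp Wm => x [].
- by apply: ae_imp Wm => x [].
Qed.

Context (c : R) (What : R -> R[i]) (m : R -> R) (K : R).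
Context (mm : measurable_fun [set: R] m) (mK : forall x, `|m x| <= K).
Context (Wm : {ae mu, forall x, What x = (m x)%:C}) (me : {ae mu, forall x, m (- x) = 1 * m x}).
Local Notation M x := (x ^+ 2 + 2 * m x - c ^+ 2).
Context (M0 : {ae mu, forall x, 0 < M x}).
Context (T : (R -> R[i]) -> R[i]) (l : R -> R[i]) (tT : tempered T).
Context (TM : represents (fourier_distribution T) (fun xi => (Mc c What xi)^-1)).
Context (Tl : represents T l) (l1 : L1 (re_fun l)) (l2 : L1 (im_fun l)).

(** The symbol 1 / M_c is real and even. Separating parities therefore gives the real part of [l]
    the cosine transform 1 / M_c and no sine transform. Continuity of the sine transform makes its
    vanishing hold everywhere. *)
Lemma kernel_symbol : {ae mu, forall x, Ct (re_fun l) x * M x = 1} /\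
  (forall x, St (re_fun l) x = 0).
Proof.
(* [powR] provides the measurability of the inverse of M. *)
pose N x := (M x) `^ (-1).
have mN : measurable_fun [set: R] N.
  apply: (measurableT_comp (measurable_powR (-1))).
  apply: measurable_funB => //; apply: measurable_funD; first exact: measurable_funX.
  exact: measurable_funM.
have MN : {ae mu, forall x, (Mc c What x)^-1 = (N x)%:C}.
  apply: ae_imp (ae_and Wm M0) => x [Wx Mx]; rewrite /N powR_inv1 ?ltW//.
  rewrite fmorphV; congr (_^-1); rewrite /Mc Wx.
  by rewrite -!rmorphXn/= -[2]/(2%:R) -(rmorph_nat (real_complex R)) -rmorphM -rmorphD -rmorphB.
have [lP lQ] := cL1loc_locint TM.1.
have lN : locint N.
  split => // x y; have [_ /(_ x y) h] := lP.
  apply: (eq_ae_L1 _ h); first by apply: measurable_funM => //; exact: measurable_itv_indic.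
  by apply: ae_imp MN => t Et; rewrite /re_fun Et.
have pair phi : testfun phi ->
    \int[mu]_x (re_fun l x * Ct phi x) + \int[mu]_x (im_fun l x * St phi x) = \int[mu]_x (N x * phi x) /\
    \int[mu]_x (im_fun l x * Ct phi x) - \int[mu]_x (re_fun l x * St phi x) = 0.
  move=> tp; have := TM.2 _ (test_function_rc tp).
  rewrite /fourier_distribution (tempered_fourier tT l1 l2 Tl tp) distribution_of_rc.
  rewrite (distribution_of_fourier (slow_L1 l1) (slow_L1 l2) tp) => /eqP.
  rewrite eq_complex => /andP[/eqP /= -> /eqP /= ->]; split.
    apply: eq_ae_int.
    - exact: (L1_measurable (testfun_mulL1 lP tp)).
    - exact: (L1_measurable (testfun_mulL1 lN tp)).
    by apply: ae_imp MN => t Et; rewrite /re_fun Et.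
  rewrite -[RHS](@int0 R); apply: eq_ae_int.
  - exact: (L1_measurable (testfun_mulL1 lQ tp)).
  - exact: measurable_cst.
  by apply: ae_imp MN => t Et; rewrite /im_fun Et /= mul0r.
have int00 (k : R -> R) : \int[mu]_x (0 * k x) = 0.
  by rewrite (int_eq (g := fun=> 0)) ?int0// => x; rewrite mul0r.
have l0 : locint (fun _ : R => 0 : R) by exact: locint_cst.
have [] := @separate_parity R (re_fun l) (im_fun l) N (fun=> 0) (slow_L1 l1) (slow_L1 l2).
- by move=> phi tp; have [] := pair _ tp.
- by move=> phi tp; have [_ h] := pair _ tp; rewrite -opprB h int00 oppr0.
- move=> phi tp; rewrite -[RHS]mul1r; apply: parity_int => //.
  by apply: ae_imp me => x E; rewrite /N E !mul1r sqrrN.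
- by move=> phi tp; rewrite !int00 oppr0.
move=> tp _; have [hC hS] := transform_pair_unique l1 lN l0 tp; split.
  apply: ae_imp (ae_and hC M0) => x [-> Mx].
  by rewrite /N powR_inv1 ?ltW// mulVf// gt_eqF.
by apply: continuous_ae_eq0 => //; exact: St_continuous.
Qed.

(** Positivity almost everywhere does not by itself bound 1 / M_c. Integrability of the kernel does:
    its transform t is bounded, and t M_c = 1, rewritten as t x^2 = 1 - t (2 m - c^2), bounds t x^2
    as well. *)
Lemma kernel_decay : exists KN, forall x, `|Ct (re_fun l) x| <= KN * japanese x.
Proof.
have [hN _] := kernel_symbol; pose L := \int[mu]_x `|re_fun l x|.
have NL x : `|Ct (re_fun l) x| <= L by exact: Ct_bounded.
have cN := Ct_continuous l1.
exists (L + (1 + L * (2 * K + c ^+ 2))).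
apply: continuous_ae_le.
- by move=> x; apply: cvg_norm; exact: cN.
- by move=> x; apply: cvgM; [exact: cvg_cst|exact: japanese_continuous].
apply: ae_imp hN => x; rewrite /japanese ler_pdivlMr; last by rewrite ltr_pwDl// sqr_ge0.
have := NL x; move: (Ct (re_fun l) x) => t tL E.
have E2 : t * x ^+ 2 = 1 - t * (2 * m x - c ^+ 2) by lra.
rewrite mulrDr mulr1; apply: lerD => //.
rewrite -[x ^+ 2](ger0_norm (sqr_ge0 x)) -normrM E2.
apply: (le_trans (ler_normB _ _)); rewrite normr1 lerD2l normrM.
apply: ler_pM => //; apply: (le_trans (ler_normB _ _)).
by rewrite normrM (ger0_norm (sqr_ge0 c)) (ger0_norm (ler0n R 2)) lerD2r ler_wpM2l.
Qed.

End symbol.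

Lemma transform_pair_eq_ae (R : realType) (f f' A B : R -> R) :
  measurable_fun [set: R] f -> measurable_fun [set: R] f' ->
  {ae lebesgue_measure, forall x, f x = f' x} -> transform_pair f A B -> transform_pair f' A B.
Proof.
move=> mf mf' ff h phi tp; have [<- <-] := h _ tp.
have mC := measurable_of_continuous (transfun_continuous (transfun_Ct tp)).
have mS := measurable_of_continuous (transfun_continuous (transfun_St tp)).
split; apply: eq_ae_int.
- exact: measurable_funM.
- exact: measurable_funM.
- by apply: ae_imp ff => x ->.
- exact: measurable_funM.
- exact: measurable_funM.
- by apply: ae_imp ff => x ->.
Qed.

(** A solution is determined up to a null set, so the derivatives refer to a smooth representative
    [v]. The term [fine (p^-1)] is 1/p, with value 0 at p = +oo. *)
Theorem theorem5p8 (R : realType)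
    (W : (R -> R[i]) -> R[i]) (What : R -> R[i])
    (W_tempered : tempered W)
    (W_real : real_distribution W)
    (W_even : even_distribution W)
    (WhatE : represents (fourier_distribution W) What)
    (What_bounded : cLfun +oo%E What)
    (c : R) (c_ge0 : 0 <= c)
    (u : R -> R[i]) (u_energy : energy_space u) (u_sol : solution c What u)
    (Mc_gt0 : {ae @lebesgue_measure R, forall xi, 0 < Mc c What xi})
    (Lc_tempered : tempered_function (fun xi => (Mc c What xi)^-1))
    (calL : (R -> R[i]) -> R[i]) (calL_tempered : tempered calL)
    (calLE : represents (fourier_distribution calL)
               (fun xi => (Mc c What xi)^-1))
    (p : \bar R) (p_gt1 : (1 < p)%E)
    (s : R) (s_gt : 1 - fine (p^-1)%E < s)
    (calL_decay : exists2 l : R -> R[i], represents calL l &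
       cLfun p (fun x => ((1 + `|x|) `^ s)%:C * l x)) :
  exists v : R -> R[i],
    [/\ csmooth v,
        {ae @lebesgue_measure R, forall x, v x = u x} &
        forall (l : R) (k : nat), 0 < l < s - 1 + fine (p^-1)%E ->
          let h : R -> R := fun x => `|x| `^ l * (eta_fun v)^`(k)%classic x in
          [/\ h \in Lfun (@lebesgue_measure R) (hoelder_conjugate p),
              h \in Lfun (@lebesgue_measure R) +oo%E,
              h x @[x --> +oo] --> 0 &
              h x @[x --> -oo] --> 0]].
Proof.
have [m [K [mm mK Wm M0]]] := bounded_symbol What_bounded Mc_gt0.
(* Evenness of [W] passes to its symbol and from there to the truncated symbol [m]. *)
have me : {ae lebesgue_measure, forall x, m (- x) = 1 * m x}.
  have lm : locint m.
    by have := locint_bddM mm mK (locint_cst 1); under eq_fun do rewrite mulr1.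
  have [lW _] := cL1loc_locint WhatE.1.
  apply: parity_ae => // phi tp.
  have E (psi : R -> R) : testfun psi ->
      \int[lebesgue_measure]_x (m x * psi x) = \int[lebesgue_measure]_x (re_fun What x * psi x).
    move=> tq; apply: eq_ae_int.
    - exact: (L1_measurable (testfun_mulL1 lm tq)).
    - exact: (L1_measurable (testfun_mulL1 lW tq)).
    by apply: ae_imp Wm => x Wx; rewrite /re_fun Wx.
  rewrite (E _ (testfun_opp tp)) (E _ tp); apply: parity_int => //.
  exact: even_symbol W_even WhatE.
have [gc [mult eqn]] := u_sol.
have [g0 [A [B [lA lB te tg]]]] := nonlocal_term mm mK Wm me mult.
have cg : cLfun 2%:E gc by have [] := mult.
have [a [b [a1 [b1 [Wv uab]]]]] := wave_of_solution u_energy cg g0 eqn.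
have [l lrep [ml lLp]] := calL_decay.
have [lre lim] := cL1loc_locint lrep.1.
have cmodl : (fun x => cmod (((1 + `|x|) `^ s)%:C * l x)) = (fun x => weight s x * cmod (l x)).
  apply/funext => x; rewrite cmod_realM ger0_norm//; exact: powR_ge0.
rewrite cmodl in lLp.
(* Measurability of |l| is recovered by multiplying the weighted function by the inverse weight. *)
have mcl : measurable_fun [set: R] (fun x => cmod (l x)).
  have := measurable_funM (measurable_of_continuous (@weight_continuous R (- s))) (Lfun_measurable lLp).
  congr measurable_fun; apply/funext => x.
  by rewrite /= mulrA -weightD addNr /weight powRr0 mul1r.
have wl (r : R) : r < s - 1 + fine (p^-1)%E -> L1 (fun x => weight r x * cmod (l x)).
  exact: Lfun_weight_L1.
have wre (r : R) : r < s - 1 + fine (p^-1)%E -> L1 (fun x => weight r x * re_fun l x).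
  move=> /wl w1; apply: (L1_leP _ w1).
    apply: measurable_funM; last exact: locint_measurable lre.
    by apply: measurable_of_continuous; exact: weight_continuous.
  move=> x; rewrite normrM (ger0_norm (weight_ge0 r x)) ler_wpM2l ?weight_ge0//.
  exact: Re_le_cmod.
(* The assumption on s makes the exponent 0 admissible, so [l] itself is integrable. *)
have r0 : 0 < s - 1 + fine (p^-1)%E by lra.
have w0 : (fun x => weight 0 x * cmod (l x)) = (fun x => cmod (l x)).
  by apply/funext => x; rewrite /weight powRr0 mul1r.
have cl1 := wl _ r0; rewrite w0 in cl1.
have l1 : L1 (re_fun l).
  by apply: (L1_leP (locint_measurable lre) cl1) => x; exact: Re_le_cmod.
have l2 : L1 (im_fun l).
  by apply: (L1_leP (locint_measurable lim) cl1) => x; exact: Im_le_cmod.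
have [NM Sl] := kernel_symbol mm Wm me M0 calL_tempered calLE lrep l1 l2.
have [KN NK] := kernel_decay mm mK Wm me M0 calL_tempered calLE lrep l1 l2.
have meta : measurable_fun [set: R] (eta_fun u) by have [[[]]] := mult.
have mab := measurable_of_continuous (weta_continuous Wv).
have te' : transform_pair (weta a b) A B.
  apply: transform_pair_eq_ae te => //.
  by apply: ae_imp uab => x ux; rewrite /eta_fun ux cmod_sqr.
have [sa sb se dec] := wave_conclusion Wv mm mK l1 Sl NK NM lA lB te' tg.
exists (fun x => a x +i* b x); split.
- by split; [exact: sa|exact: sb].
- by apply: ae_imp uab => x ->.
move=> r k /andP[rpos rlt].
have -> : eta_fun (fun x => a x +i* b x) = weta a b.
  by apply/funext => x; rewrite /eta_fun cmod_sqr.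
have wr := wre _ rlt.
(* Pointwise decay at order k uses the weighted bounds at orders k and k + 1. *)
apply: pointwise_decay => //.
- apply: derive_prim => [x|]; first exact: smooth_is_derive1n.
  by apply: smooth_continuous; exact: smooth_derive1n.
- by apply: dec => //; exact: ltW.
- by apply: dec => //; exact: ltW.
Qed.
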